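(* Let $0\le\alpha<nd$, let $\sigma_{1},\dots,\sigma_{n},\omega$ be weights on $\mathbb{R}^{d}$, let $\Phi_{1},\dots,\Phi_{n} \in \widetilde{\mathcal{U}}\cap \nabla_{2}$, $\Psi \in \widetilde{\mathcal{U}}$, and let $\Phi$ be a bijection from $\mathbb{R}_{+}$ to itself such that $\Phi^{-1}=\Phi_{1}^{-1}\times\cdots\times \Phi_{n}^{-1}$ (pointwise product) and $t\mapsto \frac{\Psi(t)}{\Phi(t)}$ is increasing on $\mathbb{R}_{+}^{*}$. Then the following hold, with the classes $A^\alpha_{\vec\Phi,\Psi}$, $\widetilde A^\alpha_{\vec\varphi,\Psi}$, $B^\alpha_{\vec\Phi,\Psi}$, $W_{\vec\Phi,\Psi}$ and $\mathcal{A}_\infty$ defined in the context. (i) If $(\vec{\sigma},\omega) \in B_{\vec{\Phi},\Psi}^{\alpha}$, then there exists a constant $C_{1}>0$ such that for any $(f_{1},\dots,f_{n}) \in L^{\Phi_{1}}(\sigma_{1})\times\cdots\times L^{\Phi_{n}}(\sigma_{n})$, $$\|\mathcal{M}_{\alpha}(\sigma_{1}f_{1},\dots,\sigma_{n}f_{n}) \|_{L_{\omega}^{\Psi}}^{lux} \leq C_{1}\Psi^{-1}\left([\vec{\sigma},\omega]_{B_{\vec{\Phi},\Psi}^{\alpha}}\right)\prod_{i=1}^{n}\|f_{i}\|_{L_{\sigma_{i}}^{\Phi_{i}}}^{lux}.$$ (ii) If $(\vec{\sigma},\omega) \in A_{\vec{\Phi},\Psi}^{\alpha}$ and $\sigma_{i}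 \in \mathcal{A}_\infty$ for $1\leq i \leq n$, then there exists a constant $C_{2}>0$ such that for any $(f_{1},\dots,f_{n}) \in L^{\Phi_{1}}(\sigma_{1})\times\cdots\times L^{\Phi_{n}}(\sigma_{n})$, $$\|\mathcal{M}_{\alpha}(\sigma_{1}f_{1},\dots,\sigma_{n}f_{n}) \|_{L_{\omega}^{\Psi}}^{lux} \leq C_{2} \Psi^{-1}\left([\vec{\sigma},\omega]_{A_{\vec{\Phi},\Psi}^{\alpha}}\sum_{i=1}^{n}\Psi\circ\Phi^{-1}\left([\sigma_{i}]_{\mathcal{A}_\infty}\right)\right)\prod_{i=1}^{n}\|f_{i}\|_{L_{\sigma_{i}}^{\Phi_{i}}}^{lux}.$$ (iii) Let $\vec{\varphi}:=(\varphi_{1},\dots,\varphi_{n})$ with $\varphi_{i}$ the complementary function of $\Phi_{i}$. If $(\vec{\sigma},\omega) \in \widetilde{A}_{\vec{\varphi},\Psi}^{\alpha}$ and $\vec{\sigma} \in W_{\vec{\Phi},\Psi}$, then there exists a constant $C_{3}>0$ such that for any $(f_{1},\dots,f_{n}) \in L^{\Phi_{1}}(\sigma_{1})\times\cdots\times L^{\Phi_{n}}(\sigma_{n})$, $$\|\mathcal{M}_{\alpha}(\sigma_{1}f_{1},\dots,\sigma_{n}f_{n}) \|_{L_{\omega}^{\Psi}}^{lux} \leq C_{3} \Psi^{-1}\left([\vec{\sigma}]_{W_{\vec{\Phi},\Psi}}[\vec{\sigma},\omega]_{\widetilde{A}_{\vec{\varphi},\Psi}^{\alpha}}\right)\prod_{i=1}^{n}\|f_{i}\|_{L_{\sigma_{i}}^{\Phi_{i}}}^{lux}.$$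 The constants $C_1,C_2,C_3$ depend only on $n,\Psi,\Phi_1,\dots,\Phi_n$ (and on the fixed parameters $d,\alpha$).
   Context: $\mathbb{R}_+=[0,\infty)$, $\mathbb{R}_+^*=(0,\infty)$. $\mathcal{Q}$ is the set of non-degenerate cubes in $\mathbb{R}^d$ with sides parallel to the axes; $|Q|$ is Lebesgue measure. A weight is a locally integrable, almost everywhere positive function $\sigma$ on $\mathbb{R}^d$; $\sigma(E)=\int_E\sigma(x)\,dx$ (the same notation is used for $\nu_{\vec\sigma}$ below). $\vec\sigma=(\sigma_1,\dots,\sigma_n)$, $\vec\Phi=(\Phi_1,\dots,\Phi_n)$. Maximal functions: for $0\le\alpha<nd$, $\mathcal{M}_\alpha(f_1,\dots,f_n)(x):=\sup_{Q\in \mathcal{Q}}|Q|^{\alpha /d}\prod_{i=1}^n\frac{\chi_Q(x)}{|Q|}\int_Q|f_i(y)|\,dy$; for a single function, $\mathcal{M}f(x):=\sup_{Q\in\mathcal{Q}}\frac{\chi_Q(x)}{|Q|}\int_Q|f(y)|dy$ is the Hardy-Littlewood maximal function. A growth function is a function $\Phi:\mathbb{R}_+\to\mathbb{R}_+$, not identically zero, continuous, nondecreasing and onto. It is of upper-type $q>0$ if there is $C_q>0$ with $\Phi(st)\le C_q t^q\Phi(s)$ for all $s>0$, $t\ge 1$. For $q\ge1$, $\mathcal{U}^q$ is the set of growth functions of upper-type $q$ such that $t\mapsto\Phi(t)/t$ is nondecreasing on $\mathbb{R}_+^*$; $\mathcal{U}=\bigcup_{q\ge1}\mathcal{U}^q$.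 Standing convention: (up to replacing it by an equivalent function) every $\Phi\in\mathcal{U}$ is assumed convex, of class $C^1$, with $\Phi'(t)\approx\Phi(t)/t$ for $t>0$. $\Phi\in\Delta'$: there is $C>0$ with $\Phi(st)\le C\Phi(s)\Phi(t)$ for all $s,t>0$. $\Phi\in\Delta_2$: there is $K>0$ with $\Phi(2t)\le K\Phi(t)$ for all $t>0$. For a convex growth function $\Phi\in\Delta_2$, $\Phi\in\nabla_2$ means there is $C>0$ with $\int_0^t\frac{\Phi(s)}{s^2}ds\le C\frac{\Phi(t)}{t}$ for all $t>0$. For $q\ge1$, $\widetilde{\mathcal{U}}^q$ is the set of $\Phi\in\mathcal{U}^q\cap\Delta'$ for which there is $C>0$ with $\Phi(s/t)\le C\,\Phi(s)/t^q$ for all $s,t\ge1$; $\widetilde{\mathcal{U}}=\bigcup_{q\ge1}\widetilde{\mathcal{U}}^q$. The complementary function of an increasing convex $\Phi$ is $s\mapsto\sup_{t\ge0}\{st-\Phi(t)\}$, $s\ge0$. For $\Phi\in\mathcal{U}$ and a weight $\sigma$, $L^\Phi(\sigma)$ is the set of (classes of) measurable $f:\mathbb{R}^d\to\mathbb{C}$ with $\|f\|_{L^\Phi_\sigma}^{lux}:=\inf\{\lambda>0:\int_{\mathbb{R}^d}\Phi(|f(x)|/\lambda)\sigma(x)dx\le1\}<\infty$. Classes of weights (membership means the corresponding quantity is finite), for bijections $\Psi,\Phi_1,\dots,\Phi_n$ of $\mathbb{R}_+$: $$[\vec{\sigma},\omega]_{A_{\vec{\Phi},\Psi}^{\alpha}}:=\sup_{Q\in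 \mathcal{Q}}\omega(Q)\Psi\left(\prod_{i=1}^{n}\frac{\sigma_{i}(Q)}{|Q|^{1-\frac{\alpha}{nd}}}\right)\Psi \left(\prod_{i=1}^{n}\Phi_{i}^{-1}\left(\frac{1}{\sigma_{i}(Q)}\right)\right),$$ $$[\vec{\sigma},\omega]_{\widetilde{A}_{\vec{\Phi},\Psi}^{\alpha}}:=\sup_{Q\in \mathcal{Q}}\frac{\omega(Q)}{|Q|}\Psi\left(|Q|^{\frac{\alpha}{d}}\prod_{i=1}^{n}\Phi_{i}^{-1}\left(\frac{\sigma_{i}(Q)}{|Q|}\right)\right),$$ $$[\vec{\sigma},\omega]_{B_{\vec{\Phi},\Psi}^{\alpha}}:=\sup_{Q\in \mathcal{Q}}\omega(Q)\Psi\left(\prod_{i=1}^{n}\frac{\sigma_{i}(Q)}{|Q|^{1-\frac{\alpha}{nd}}}\right) \Psi\left(\prod_{i=1}^{n}\Phi_{i}^{-1}\left(\frac{1}{|Q|}\exp\left(\frac{1}{|Q|}\int_{Q}\log\frac{1}{\sigma_{i}}\right)\right)\right),$$ $$[\vec{\sigma}]_{W_{\vec{\Phi},\Psi}}:=\sup_{Q\in \mathcal{Q}}\Psi \circ \Phi^{-1}\left( \frac{1}{\nu_{\vec{\sigma}}(Q)}\right)\int_{Q}\Psi\left(\prod_{i=1}^{n} \Phi_{i}^{-1}\left(\mathcal{M}(\sigma_{i}\chi_{Q})(x)\right)\right)dx,\qquad \nu_{\vec{\sigma}}:= \frac{1}{\Phi\left(\prod_{i=1}^{n}\Phi_{i}^{-1}\left(\frac{1}{\sigma_{i}}\right)\right)},$$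 $$[\omega]_{\mathcal{A}_\infty}:=\sup_{Q\in \mathcal{Q}}\frac{1}{\omega(Q)}\int_Q\mathcal{M}(\omega\chi_Q)(x)\,dx .$$ *)

(* Defs.v *)
From HB Require Import structures.
From mathcomp Require Import all_boot all_order all_algebra.
From mathcomp Require Import all_classical all_reals all_analysis.
From mathcomp Require Import complex.

Set Implicit Arguments.
Unset Strict Implicit.
Unset Printing Implicit Defensive.

Import Order.TTheory GRing.Theory Num.Theory.
Import numFieldNormedType.Exports.
Local Open Scope classical_set_scope.
Local Open Scope ring_scope.

Section row_measurable.
Context (R : realType) (d : nat).

Let coor (i : 'I_d) (v : 'rV[R]_d) : R := v ord0 i.

Let rV_set0 : g_sigma_preimage coor set0.
Proof. exact: sigma_algebra0. Qed.

Let rV_setC A : g_sigma_preimage coor A -> g_sigma_preimage coor (~` A).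
Proof. exact: sigma_algebraC. Qed.

Let rV_bigcup (F : (set 'rV[R]_d)^nat) :
  (forall i, g_sigma_preimage coor (F i)) ->
  g_sigma_preimage coor (\bigcup_i (F i)).
Proof. exact: sigma_algebra_bigcup. Qed.

(* The product of the Borel sigma-algebras of the coordinates, i.e. the Borel
   sigma-algebra of R^d. *)
HB.instance Definition _ := @isMeasurable.Build default_measure_display
  'rV[R]_d (g_sigma_preimage coor) rV_set0 rV_setC rV_bigcup.

Lemma measurable_coor (i : 'I_d) :
  measurable_fun [set: 'rV[R]_d] (fun v : 'rV[R]_d => v ord0 i).
Proof.
move=> _ Y mY; rewrite setTI; apply: sub_sigma_algebra => /=.
rewrite -bigcup_seq/=; exists i => /=; first by rewrite mem_index_enum.
by exists Y => //; rewrite setTI.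
Qed.

Lemma measurable_fun_rVP d1 (T : measurableType d1) (f : T -> 'rV[R]_d) :
  measurable_fun [set: T] f <->
  forall i, measurable_fun [set: T] (fun x => f x ord0 i).
Proof.
split=> [mf i|mf].
  exact: (measurableT_comp (measurable_coor i) mf).
suff: g_sigma_preimage coor `<=` [set A | measurable (f @^-1` A)].
  by move=> s _ A mA; rewrite setTI; exact: s.
apply: smallest_sub.
  split=> [|A|F] /=; first by rewrite preimage_set0.
    by rewrite setTD preimage_setC => mA; exact: measurableC.
  by move=> mF; rewrite preimage_bigcup; exact: bigcup_measurable.
rewrite -bigcup_seq; apply: bigcup_sub => i _ A [B mB <-] /=.
by rewrite setTI; move: (mf i measurableT _ mB); rewrite setTI.
Qed.

End row_measurable.

Section lebesgue_measure_rV.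
Context (R : realType).

Definition rV_cons d (p : measurableTypeR R * 'rV[R]_d) : 'rV[R]_d.+1 :=
  \row_(i < d.+1) (if unlift ord0 i is Some j then p.2 ord0 j else p.1).

Definition rV_uncons d (v : 'rV[R]_d.+1) : measurableTypeR R * 'rV[R]_d :=
  (v ord0 ord0, \row_(j < d) v ord0 (lift ord0 j)).

Lemma rV_consK d : cancel (@rV_cons d) (@rV_uncons d).
Proof.
move=> [x v]; rewrite /rV_uncons /rV_cons !mxE unlift_none; congr pair.
by apply/rowP => j; rewrite !mxE liftK.
Qed.

Lemma measurable_rV_cons d : measurable_fun [set: measurableTypeR R * 'rV[R]_d] (@rV_cons d).
Proof.
apply/measurable_fun_rVP => i.
under eq_fun do rewrite mxE.
case: (unlift _ i) => [j|]; last exact: measurable_fst.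
exact: (measurableT_comp (@measurable_coor R d j) measurable_snd).
Qed.

Lemma measurable_rV_uncons d :
  measurable_fun [set: 'rV[R]_d.+1] (@rV_uncons d).
Proof.
apply/measurable_fun_pairP; split; first exact: measurable_coor.
apply/measurable_fun_rVP => j /=.
by under eq_fun do rewrite mxE; exact: measurable_coor.
Qed.

Section step.
Context (d : nat) (m : {sigma_finite_measure set 'rV[R]_d -> \bar R}).

Definition leb_step : set 'rV[R]_d.+1 -> \bar R :=
  pushforward (@lebesgue_measure R \x m)%E (@rV_cons d).

Let mcons A : measurable A -> measurable (@rV_cons d @^-1` A).
Proof.
by move=> mA; rewrite -[X in measurable X]setTI; exact: measurable_rV_cons.
Qed.

Let leb_step0 : leb_step set0 = 0%E.
Proof. by rewrite /leb_step /pushforward preimage_set0 measure0. Qed.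

Let leb_step_ge0 A : (0 <= leb_step A)%E.
Proof. exact: (measure_ge0 (@lebesgue_measure R \x m)%E). Qed.

Let leb_step_sigma_additive : semi_sigma_additive leb_step.
Proof.
move=> F mF tF mUF; rewrite /leb_step /pushforward preimage_bigcup.
apply: measure_semi_sigma_additive.
- by move=> k; exact: mcons.
- apply/trivIsetP => /= i j _ _ ij; rewrite -preimage_setI.
  by move/trivIsetP : tF => /(_ _ _ _ _ ij) ->//; rewrite preimage_set0.
- by rewrite -preimage_bigcup; exact: mcons.
Qed.

HB.instance Definition _ := isMeasure.Build _ _ _ leb_step
  leb_step0 leb_step_ge0 leb_step_sigma_additive.

Let leb_step_sigma_finite : sigma_finite setT leb_step.
Proof.
have /sigma_finiteP[F [TF ndF Foo]] := sigma_finiteT (@lebesgue_measure R).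
have /sigma_finiteP[G [TG ndG Goo]] := sigma_finiteT m.
exists (fun k => @rV_uncons d @^-1` (F k `*` G k)).
  apply/esym; rewrite -subTset => v _ /=.
  have : [set: measurableTypeR R] (rV_uncons v).1 by [].
  rewrite TF => -[p _ Fp].
  have : [set: 'rV[R]_d] (rV_uncons v).2 by [].
  rewrite TG => -[q _ Gq].
  exists (maxn p q) => //; split => /=.
    by move: Fp; exact/subsetPset/ndF/leq_maxl.
  by move: Gq; exact/subsetPset/ndG/leq_maxr.
move=> k; have [mF Fk] := Foo k; have [mG Gk] := Goo k; split.
  rewrite -[X in measurable X]setTI; apply: measurable_rV_uncons => //.
  exact: measurableX.
rewrite /leb_step /pushforward -comp_preimage.
rewrite (_ : _ \o _ = id); last by apply/funext => x /=; rewrite rV_consK.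
by rewrite preimage_id product_measure1E// lte_mul_pinfty// ge0_fin_numE.
Qed.

HB.instance Definition _ :=
  Measure_isSigmaFinite.Build _ _ _ leb_step leb_step_sigma_finite.

End step.

(* Lebesgue measure on R^d, as the d-fold product of the Lebesgue measure of
   the line; for d = 0 it is the unit mass at the only point of R^0. *)
Fixpoint leb (d : nat) : {sigma_finite_measure set 'rV[R]_d -> \bar R} :=
  match d with
  | 0 => @dirac _ 'rV[R]_0 0 R
  | d'.+1 => @leb_step d' (leb d')
  end.

End lebesgue_measure_rV.
Arguments leb R d : clear implicits.

Section lebesgue_box.
Context (R : realType).

Definition box d (a b : 'rV[R]_d) : set 'rV[R]_d :=
  [set x | forall i, a ord0 i <= x ord0 i <= b ord0 i].

Lemma measurable_box d (a b : 'rV[R]_d) : measurable (box a b).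
Proof.
rewrite (_ : box a b = \bigcap_(i in [set: 'I_d])
    ((fun v : 'rV[R]_d => v ord0 i) @^-1` `[a ord0 i, b ord0 i])).
  apply: fin_bigcap_measurable => // i _.
  by rewrite -[X in measurable X]setTI; exact: measurable_coor.
by apply/seteqP; split => x xab i /=; [move=> _|]; move: (xab i);
  rewrite /= in_itv/=; [|exact].
Qed.

Lemma leb_box d (a b : 'rV[R]_d) : (forall i, a ord0 i <= b ord0 i) ->
  leb R d (box a b) = (\prod_(i < d) (b ord0 i - a ord0 i))%:E.
Proof.
elim: d a b => [|d IHd] a b ab.
  by rewrite big_ord0 /= diracE mem_set// => -[].
rewrite big_ord_recl /= /leb_step /pushforward.
pose a' : 'rV[R]_d := \row_j a ord0 (lift ord0 j).
pose b' : 'rV[R]_d := \row_j b ord0 (lift ord0 j).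
rewrite (_ : _ @^-1` _ = `[a ord0 ord0, b ord0 ord0] `*` box a' b').
  rewrite product_measure1E//; last exact: measurable_box.
  rewrite IHd => [|i]; last by rewrite !mxE.
  rewrite EFinM; congr (_ * _)%E; last first.
    by congr _%:E; apply: eq_bigr => i _; rewrite !mxE.
  apply: etrans (lebesgue_measure_itv `[a ord0 ord0, b ord0 ord0]) _.
  rewrite /= lte_fin; case: ltP => [_|ba]; first by rewrite EFinB.
  by rewrite (le_anti (introT andP (conj ba (ab _)))) subrr.
apply/seteqP; split => -[x v] /=.
  move=> xv; split; first by move: (xv ord0); rewrite mxE unlift_none in_itv.
  by move=> i; move: (xv (lift ord0 i)); rewrite !mxE liftK.
rewrite in_itv/= => -[x0 vab] i; rewrite mxE.
by case: unliftP => [j|] -> //; move: (vab j); rewrite !mxE.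
Qed.

End lebesgue_box.

Section growth_functions.
Context (R : realType).
Implicit Types (Phi Psi : R -> R) (q s t : R).

(* Functions from [0, +oo[ to itself are represented by functions R -> R, of
   which only the values on Rplus matter. *)
Definition Rplus : set R := [set t | 0 <= t].

Definition growth Phi :=
  [/\ (forall t, 0 <= t -> 0 <= Phi t),
      (exists2 t, 0 <= t & Phi t != 0),
      {within Rplus, continuous Phi},
      (forall s t, 0 <= s -> s <= t -> Phi s <= Phi t) &
      set_surj Rplus Rplus Phi].

Definition upper_type q Phi :=
  exists2 C, 0 < C &
    forall s t, 0 < s -> 1 <= t -> Phi (s * t) <= C * t `^ q * Phi s.

Definition classU_ q Phi :=
  [/\ 1 <= q, growth Phi, upper_type q Phi &
      forall s t, 0 < s -> s <= t -> Phi s / s <= Phi t / t].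

Definition convexR Phi := convex_function (E := R^o) Rplus Phi.

(* The normalization under which the elements of the classes U^q are
   considered. For a convex Phi, continuity of Phi' on ]0, +oo[ amounts to its
   continuity on [0, +oo[ (with the right derivative at 0). *)
Definition normalized Phi :=
  [/\ convexR Phi,
      (forall t, 0 < t -> derivable Phi t 1),
      (forall t, 0 < t -> {for t, continuous (derive1 Phi)}) &
      exists c C, [/\ 0 < c, 0 < C & forall t, 0 < t ->
        c * (Phi t / t) <= derive1 Phi t <= C * (Phi t / t)]].

Definition Delta' Phi :=
  exists2 C, 0 < C & forall s t, 0 < s -> 0 < t ->
    Phi (s * t) <= C * Phi s * Phi t.

Definition Delta2 Phi :=
  exists2 K, 0 < K & forall t, 0 < t -> Phi (2 * t) <= K * Phi t.

Definition nabla2 Phi :=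
  [/\ convexR Phi, growth Phi, Delta2 Phi &
      exists2 C, 0 < C & forall t, 0 < t ->
        (\int[lebesgue_measure]_(s in `]0%R, t]) (Phi s / s ^+ 2)%:E
         <= (C * (Phi t / t))%:E)%E].

Definition classUt_ q Phi :=
  [/\ classU_ q Phi, Delta' Phi &
      exists2 C, 0 < C & forall s t, 1 <= s -> 1 <= t ->
        Phi (s / t) <= C * (Phi s / t `^ q)].

Definition classUt Phi := exists q, classUt_ q Phi.

Definition complementary Phi s : R :=
  sup [set s * t - Phi t | t in Rplus].

(* The inverse of a bijection of Rplus. *)
Definition ginv Phi : R -> R := 'pinv_(fun=> 0) Rplus Phi.

End growth_functions.

Section weights.
Context (R : realType) (d : nat).
Local Notation E := 'rV[R]_d.
Local Notation mu := (leb R d).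
Implicit Types (Q : set E) (s w : E -> R) (f : E -> R[i]).

(* Closed cubes; the suprema below are the same over open cubes, since a cube can
   be enlarged slightly. *)
Definition cubes : set (set E) :=
  [set Q | exists a l, 0 < l /\ Q = box a (a + const_mx l)].

Definition vol Q : R := fine (mu Q).

(* Measurability for the completed sigma-algebra: being almost everywhere equal
   to a Borel function. On such functions the library integral against mu, a
   supremum over Borel simple functions, is the Lebesgue integral. *)
Definition leb_measurable (g : E -> R) :=
  exists2 h : E -> R, measurable_fun setT h & {ae mu, forall x, g x = h x}.

Definition leb_measurableC f :=
  leb_measurable (fun x => complex.Re (f x)) /\
  leb_measurable (fun x => complex.Im (f x)).

Definition modulus f (x : E) : \bar R := (Normc.normc (f x))%:E.

Definition locally_integrable_rV (g : E -> R) :=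
  leb_measurable g /\
  forall K, compact K -> (\int[mu]_(x in K) `|g x|%:E < +oo)%E.

Definition weight s :=
  locally_integrable_rV s /\ {ae mu, forall x, 0 < s x}.

Definition wmeas s Q : \bar R := (\int[mu]_(x in Q) (s x)%:E)%E.

(* Operators and norms below apply a function Phi of Rplus to elements of
   [0, +oo] through er_map Phi, i.e. with the convention Phi(+oo) = +oo. *)

Definition luxnorm (Phi : R -> R) s (g : E -> \bar R) : \bar R :=
  ereal_inf [set lam%:E | lam in [set lam : R | 0 < lam /\
    (\int[mu]_x (er_map Phi (`|g x| / lam%:E) * (s x)%:E) <= 1)%E]].

Definition inL (Phi : R -> R) s f :=
  leb_measurableC f /\ (luxnorm Phi s (modulus f) < +oo)%E.

Definition Malpha n (alpha : R) (f : 'I_n -> E -> R[i]) (x : E) : \bar R :=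
  ereal_sup [set ((vol Q `^ (alpha / d%:R))%:E *
    \prod_(i < n)
      ((\1_Q x)%:E / (vol Q)%:E * \int[mu]_(y in Q) modulus (f i) y))%E
    | Q in cubes].

Definition HLmax (g : E -> R) (x : E) : \bar R :=
  ereal_sup [set ((\1_Q x)%:E / (vol Q)%:E * \int[mu]_(y in Q) `|g y|%:E)%E
    | Q in cubes].

Definition Aconst n (alpha : R) (Phi : 'I_n -> R -> R) (Psi : R -> R)
    (s : 'I_n -> E -> R) w : \bar R :=
  ereal_sup [set (wmeas w Q *
    er_map Psi (\prod_(i < n)
      (wmeas (s i) Q / (vol Q `^ (1 - alpha / (n%:R * d%:R)))%:E)) *
    er_map Psi (\prod_(i < n) er_map (ginv (Phi i)) (wmeas (s i) Q)^-1))%E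
    | Q in cubes].

Definition At_const n (alpha : R) (Phi : 'I_n -> R -> R) (Psi : R -> R)
    (s : 'I_n -> E -> R) w : \bar R :=
  ereal_sup [set (wmeas w Q / (vol Q)%:E *
    er_map Psi ((vol Q `^ (alpha / d%:R))%:E *
      \prod_(i < n) er_map (ginv (Phi i)) (wmeas (s i) Q / (vol Q)%:E)))%E
    | Q in cubes].

Definition Bconst n (alpha : R) (Phi : 'I_n -> R -> R) (Psi : R -> R)
    (s : 'I_n -> E -> R) w : \bar R :=
  ereal_sup [set (wmeas w Q *
    er_map Psi (\prod_(i < n)
      (wmeas (s i) Q / (vol Q `^ (1 - alpha / (n%:R * d%:R)))%:E)) *
    er_map Psi (\prod_(i < n) er_map (ginv (Phi i))
      ((vol Q)%:E^-1 * expeR ((vol Q)%:E^-1 *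
         \int[mu]_(x in Q) (ln (s i x)^-1)%:E))))%E
    | Q in cubes].

(* Phi0 is the bijection of Rplus whose inverse is the product of the inverses
   of the Phi i. *)
Definition nu n (Phi : 'I_n -> R -> R) (Phi0 : R -> R) (s : 'I_n -> E -> R)
    (x : E) : R :=
  (Phi0 (\prod_(i < n) ginv (Phi i) (s i x)^-1))^-1.

Definition Wconst n (Phi : 'I_n -> R -> R) (Phi0 Psi : R -> R)
    (s : 'I_n -> E -> R) : \bar R :=
  ereal_sup [set (er_map (Psi \o ginv Phi0) (wmeas (nu Phi Phi0 s) Q)^-1 *
    \int[mu]_(x in Q) er_map Psi (\prod_(i < n)
      er_map (ginv (Phi i)) (HLmax (fun y => s i y * \1_Q y)%R x)))%E
    | Q in cubes].

Definition Ainf w : \bar R :=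
  ereal_sup [set ((wmeas w Q)^-1 *
    \int[mu]_(x in Q) HLmax (fun y => w y * \1_Q y)%R x)%E
    | Q in cubes].

End weights.

(* Main.v *)
(* Together with the growth bounds, [Delta'] makes every function of the class
   comparable to a power: [Phi_i] to [t^p_i], [Psi] to [t^q] and [Phi] to [t^p0],
   where [1/p0 = sum_i 1/p_i]; moreover [p_i > 1] by [nabla2] and [p0 <= q] by the
   monotonicity of [Psi / Phi]. By the one-third trick and Fatou's lemma, the
   maximal function may be replaced by the maximum of
   [Lam_Q = |Q|^(alpha/d - n) prod_i int_Q f_i sigma_i] over the cubes of a finite
   laminar family, whose atoms turn all integrals into finite sums. Replacing the
   family by a sparse subfamily of principal cubes, the [q]-th power of this
   maximum is controlled by the sum of the [w(Q) Lam_Q^q], and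
   [Lam_Q = Gam_Q prod_i <f_i>_(Q, sigma_i)] where
   [Gam_Q = |Q|^(alpha/d - n) prod_i sigma_i(Q)]. The weight condition bounds
   [w(Q) Gam_Q^q] by products of coefficients satisfying a packing condition: by
   the L^2 maximal inequality for the square roots of the weights in (i), by
   [A_infty] in (ii), by [W] in (iii). Carleson's embedding theorem and the maximal
   inequality in [L^p_i(sigma_i)] conclude. *)
Require Import Defs.
From HB Require Import structures.
From mathcomp Require Import all_boot all_order all_algebra.
From mathcomp Require Import all_classical all_reals all_analysis.
From mathcomp Require Import complex.
From mathcomp Require Import measurable_realfun.
From mathcomp Require Import ring lra zify.
Import Order.TTheory GRing.Theory Num.Theory.
Import numFieldNormedType.Exports.
Local Open Scope classical_set_scope.
Local Open Scope ring_scope.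

Set Implicit Arguments.
Unset Strict Implicit.
Unset Printing Implicit Defensive.

(** * Powers of real numbers *)

Section real_powers.
Context {R : realType}.
Implicit Types (a b p q r t x : R).

(** Principal cubes are selected by the size of [Lam_Q^(1/beta)], with [beta = n - alpha/d]: then
    [|Q| Lam_Q^(1/beta)] is the product of the [(int_Q f_i sigma_i)^(1/beta)], and since
    [n/beta >= 1] Hoelder's inequality bounds its sum over disjoint subcubes of Q by n times its
    value at Q. A jump by a factor above 2n between nested selected cubes thus leaves half of each
    cube free. Both bounds on alpha enter here, as [0 < beta <= n]. The weight conditions give
    coefficients of two kinds. In (i) and (ii) each weight has its own packing sequence, and
    Hoelder's inequality with the exponents [q/p_i], whose sum is at least 1, separates the
    functions before the embedding. In (iii) the condition W controls the weights only jointly, so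
    the product of the averages is embedded as a whole, against the power [q/p0 >= 1] of the measure
    [prod_i sigma_i^(p0/p_i)]. The maximal functions are never shown to be measurable: they enter
    integrals only through pointwise or almost everywhere bounds. No constant is sharp, which allows
    elementary substitutes for the classical inequalities. *)

Lemma ler_powRl a b r : 0 <= r -> 0 <= a -> a <= b -> a `^ r <= b `^ r.
Proof.
move=> r0 a0 ab; apply: ge0_ler_powR => //; rewrite nnegrE//.
exact: le_trans ab.
Qed.

Lemma powRrK a r : 0 <= a -> r != 0 -> (a `^ r) `^ r^-1 = a.
Proof. by move=> a0 r0; rewrite -powRrM mulfV// powRr1. Qed.

Lemma powRVK a r : 0 <= a -> r != 0 -> (a `^ r^-1) `^ r = a.
Proof. by move=> a0 r0; rewrite -powRrM mulVf// powRr1. Qed.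

Lemma powR_prod (J : Type) (s : seq J) (P : pred J) (F : J -> R) r :
  (forall i, P i -> 0 <= F i) ->
  (\prod_(i <- s | P i) F i) `^ r = \prod_(i <- s | P i) F i `^ r.
Proof.
move=> F0; suff: 0 <= \prod_(i <- s | P i) F i /\
  (\prod_(i <- s | P i) F i) `^ r = \prod_(i <- s | P i) F i `^ r by case.
apply: (big_ind2 (fun x y => 0 <= x /\ x `^ r = y)); first by rewrite powR1.
- by move=> x1 x2 y1 y2 [x0 <-] [y0 <-]; rewrite mulr_ge0// powRM.
- by move=> i Pi; rewrite F0.
Qed.

Lemma powR_sum_exp (J : finType) a (th : J -> R) : 0 < a ->
  \prod_i a `^ th i = a `^ (\sum_i th i).
Proof.
move=> a0; apply/esym; elim/big_rec2 : _ => [|i y x _ <-]; first by rewrite powRr0.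
by rewrite powRD ?(gt_eqF a0) ?implybT.
Qed.

(** Young's inequality for [a ^ (p - 1)] and [b] with the exponents [p / (p - 1)] and [p]. It is a
    discrete form of d(t^p) = p/(p-1) t d(t^(p-1)), by which [doob] trades increments of the p-th
    power of a level for the level times increments of its (p-1)-th power. *)
Lemma powR_diff_le1 p a b : 1 < p -> 0 <= a -> a <= b ->
  b `^ p - a `^ p <= p / (p - 1) * (b * (b `^ (p - 1) - a `^ (p - 1))).
Proof.
move=> p1 a0 ab; have b0 : 0 <= b by exact: le_trans ab.
have p0 : 0 < p by lra.
have q0 : 0 < p - 1 by lra.
have := @conjugate_powR R (a `^ (p - 1)) b (p / (p - 1)) p (powR_ge0 _ _) b0
  (divr_gt0 p0 q0) p0.
have -> : (p / (p - 1))^-1 + p^-1 = 1 by field; rewrite !gt_eqF.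
move=> /(_ erefl).
rewrite -powRrM mulrCA divff ?gt_eqF// mulr1 => Y.
rewrite mulrBr mulr_powRB1//.
have -> : p / (p - 1) * (b `^ p - b * a `^ (p - 1)) =
  b `^ p + p / (p - 1) * (b `^ p / p - a `^ (p - 1) * b).
  by field; rewrite !gt_eqF.
rewrite lerD2l -subr_ge0 opprK.
have -> : p / (p - 1) * (b `^ p / p - a `^ (p - 1) * b) + a `^ p =
  p / (p - 1) * (a `^ p * ((p - 1) / p) + b `^ p / p - a `^ (p - 1) * b).
  by field; rewrite !gt_eqF.
apply: mulr_ge0; first by rewrite divr_ge0 ?ltW.
by rewrite subr_ge0 (le_trans Y)// invf_div.
Qed.

(** The tangent bound at [b], again from Young's inequality, now for [b ^ (r - 1)] and [a]. *)
Lemma powR_diff_le2 r a b : 1 <= r -> 0 <= a -> a <= b ->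
  b `^ r - a `^ r <= r * b `^ (r - 1) * (b - a).
Proof.
move=> r1 a0 ab; have b0 : 0 <= b by exact: le_trans ab.
have r0 : 0 < r by lra.
move: r1; rewrite le_eqVlt => /predU1P[<-|r1].
  by rewrite subrr !powRr1// powRr0 !mul1r.
have q0 : 0 < r - 1 by lra.
have := @conjugate_powR R (b `^ (r - 1)) a (r / (r - 1)) r (powR_ge0 _ _) a0
  (divr_gt0 r0 q0) r0.
have -> : (r / (r - 1))^-1 + r^-1 = 1 by field; rewrite !gt_eqF.
move=> /(_ erefl).
rewrite -powRrM mulrCA divff ?gt_eqF// mulr1 invf_div => Y.
rewrite mulrBr -mulrA [b `^ _ * b]mulrC mulr_powRB1// -mulrA -subr_ge0.
have -> : r * b `^ r - r * (b `^ (r - 1) * a) - (b `^ r - a `^ r) =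
  r * (b `^ r * ((r - 1) / r) + a `^ r / r - b `^ (r - 1) * a).
  by field; rewrite !gt_eqF.
by apply: mulr_ge0; [exact: ltW|rewrite subr_ge0].
Qed.

(** A crude arithmetic-geometric mean inequality: every [y i] is at most the sum, and the exponents
    add up to 1. *)
Lemma prod_powR_le_sum (J : finType) (th y : J -> R) :
  (forall i, 0 < th i) -> \sum_i th i = 1 -> (forall i, 0 <= y i) ->
  \prod_i y i `^ th i <= \sum_i y i.
Proof.
move=> th0 th1 y0.
have ss0 : 0 <= \sum_i y i by apply: sumr_ge0 => i _; exact: y0.
have [s0|s0] := eqVneq (\sum_i y i) 0.
  have [i _] : exists2 i : J, true & true.
    have [] := pickP [pred i : J | true] => [i _|n0]; first by exists i.
    by move: th1; rewrite big_pred0 // => /eqP; rewrite eq_sym oner_eq0.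
  have yi : y i = 0.
    by move/eqP: s0; rewrite psumr_eq0// => /allP/(_ i (mem_index_enum _))/eqP.
  by rewrite (bigD1 i)//= yi powR0 ?gt_eqF// mul0r.
have {}s0 : 0 < \sum_i y i by rewrite lt_neqAle eq_sym s0.
have -> : \sum_i y i = \prod_j (\sum_i y i) `^ th j.
  by rewrite powR_sum_exp// th1 powRr1.
apply: ler_prod => i _; rewrite powR_ge0/= ler_powRl ?(ltW (th0 i))//.
by rewrite (bigD1 i)//= lerDl sumr_ge0.
Qed.

End real_powers.

(** * Laminar families of finite sets *)

Section laminar.
Context {R : realType} {X I : finType}.
Variable Q : I -> pred X.
Implicit Types (J P : pred I) (m f : X -> R) (lam : I -> R).

(** Indices are compared through their sets, and two indices may have the same set, so this is only
    a preorder. *)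
Definition subQ i j := [forall x, Q i x ==> Q j x].
Definition disQ i j := [forall x, ~~ (Q i x && Q j x)].
Definition laminar := forall i j, [|| subQ i j, subQ j i | disQ i j].
Definition disjointQ J := forall i j, J i -> J j -> i != j -> disQ i j.

Lemma subQP i j : reflect (forall x, Q i x -> Q j x) (subQ i j).
Proof.
by apply: (iffP forallP) => h x; [move/implyP: (h x)|apply/implyP/h].
Qed.

Lemma subQ_trans i j k : subQ i j -> subQ j k -> subQ i k.
Proof. by move=> /subQP ij /subQP jk; apply/subQP => x /ij/jk. Qed.

Lemma subQ_refl i : subQ i i. Proof. exact/subQP. Qed.

Lemma disQC i j : disQ i j = disQ j i.
Proof. by apply: eq_forallb => x; rewrite andbC. Qed.

(** The indices are inserted one at a time: a new one is dropped if a chosen set contains it;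
    otherwise it replaces the chosen sets that it contains, and by laminarity the remaining ones are
    disjoint from it. *)
Lemma maximal_subfamily P : laminar ->
  exists J, [/\ forall i, J i -> P i, disjointQ J &
    forall i, P i -> exists2 j, J j & subQ i j].
Proof.
move=> lamQ.
suff H (s : seq I) : exists J, [/\ forall i, J i -> i \in s, disjointQ J &
    forall i, i \in s -> exists2 j, J j & subQ i j].
  have [J [JP dJ cJ]] := H (enum P).
  exists J; split => // i.
    by move/JP; rewrite mem_enum.
  by move=> Pi; apply: cJ; rewrite mem_enum.
elim: s => [|i s [J [Js dJ cJ]]]; first by exists pred0; split.
case: (boolP [exists j, J j && subQ i j]) => [/existsP[j /andP[Jj ij]]|nex].
  exists J; split => //; first by move=> k /Js ks; rewrite inE ks orbT.
  by move=> k; rewrite inE => /predU1P[->|/cJ//]; exists j.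
exists [pred k | (k == i) || (J k && ~~ subQ k i)]; split => /=.
- by move=> k /predU1P[->|/andP[/Js ks _]]; rewrite inE ?eqxx ?ks ?orbT.
- have H k : J k -> ~~ subQ k i -> disQ k i.
    move=> Jk nki; have := lamQ k i; rewrite (negbTE nki)/=.
    case/orP => // ik; exfalso; move/negP: nex; apply; apply/existsP.
    by exists k; rewrite Jk.
  move=> k l /predU1P[->|/andP[Jk nk]] /predU1P[->|/andP[Jl nl]] kl.
  + by rewrite eqxx in kl.
  + by rewrite disQC; exact: H.
  + exact: H.
  + exact: dJ.
- move=> k; rewrite inE => /predU1P[->|/cJ[j Jj kj]].
    by exists i; rewrite ?eqxx ?subQ_refl.
  have [ji|nji] := boolP (subQ j i); last by exists j; rewrite ?Jj ?nji ?orbT.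
  by exists i; rewrite ?eqxx// (subQ_trans kj).
Qed.

Lemma sum_disjointQ J m : disjointQ J ->
  \sum_(j | J j) \sum_(x | Q j x) m x =
  \sum_(x | [exists j, J j && Q j x]) m x.
Proof.
move=> dJ; rewrite (exchange_big_dep (fun x => [exists j, J j && Q j x]))/=.
  apply: eq_bigr => x /existsP[j /andP[Jj Qjx]].
  rewrite (big_pred1 j)// => k /=; apply/idP/eqP => [/andP[Jk Qkx]|->].
    apply/eqP/negPn/negP => kj; have /forallP/(_ x) := dJ _ _ Jk Jj kj.
    by rewrite Qkx Qjx.
  by rewrite Jj Qjx.
by move=> j x Jj Qjx; apply/existsP; exists j; rewrite Jj Qjx.
Qed.

Lemma ler_sum_sub (T : finType) (A B : pred T) (F : T -> R) :
  (forall x, 0 <= F x) -> (forall x, A x -> B x) ->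
  \sum_(x | A x) F x <= \sum_(x | B x) F x.
Proof.
move=> F0 AB; rewrite [leRHS](bigID A)/=.
rewrite (eq_bigl A) => [|x]; last first.
  by apply/andP/idP => [[]//|Ax]; rewrite (AB _ Ax).
by rewrite lerDl sumr_ge0.
Qed.

Lemma ler_sum_cover J P (m : I -> R) : (forall i, 0 <= m i) ->
  (forall i, P i -> exists2 j, J j & subQ i j) ->
  \sum_(i | P i) m i <= \sum_(j | J j) \sum_(i | P i && subQ i j) m i.
Proof.
move=> m0 cJ; rewrite (exchange_big_dep P)/=; last by move=> ? ? _ /andP[].
apply: ler_sum => i Pi; have [j Jj ij] := cJ _ Pi.
rewrite (bigD1 j)/= ?Jj ?Pi//.
by rewrite lerDl sumr_ge0.
Qed.

(** For nonnegative [lam], the maximal function of the family; the default value 0 makes it vanish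
    off the union of the sets. *)
Definition maxQ lam x := \big[Num.max/0]_(i | Q i x) lam i.

Lemma maxQ_ge0 lam x : 0 <= maxQ lam x.
Proof. by apply/bigmax_geP; left. Qed.

Lemma maxQ_ge lam x i : Q i x -> lam i <= maxQ lam x.
Proof. by move=> Qi; apply: (le_bigmax_cond _ _ Qi). Qed.

Lemma maxQ_attained lam x : (forall i, 0 <= lam i) ->
  maxQ lam x = 0 \/ exists2 i, Q i x & maxQ lam x = lam i.
Proof.
move=> lam0; rewrite /maxQ; elim/big_rec: _ => [|i y Qi]; first by left.
move=> IH; case: (leP (lam i) y) => _ //.
by right; exists i.
Qed.

(** The values of [lam] in increasing order, with 0 put in front: integrals over the levels become
    finite sums. Repeated values are kept. *)
Lemma levels lam : (forall i, 0 <= lam i) ->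
  exists (M : nat) (v : nat -> R), [/\ v 0 = 0,
    (forall j k, (j <= k <= M)%N -> v j <= v k) &
    (forall i, exists2 l, (l <= M)%N & lam i = v l)].
Proof.
move=> lam0; pose s := sort <=%O (codom lam).
exists (size s), (fun l => if l is k.+1 then nth 0 s k else 0); split => //.
  have s0 l : 0 <= nth 0 s l.
    have [ls|/(nth_default 0)->//] := ltnP l (size s).
    have := mem_nth 0 ls; rewrite mem_sort => /codomP[i ->]; exact: lam0.
  move=> [|j] [|k] //= /andP[jk ks].
  apply: (sorted_leq_nth le_trans le_refl 0 (sort_le_sorted _)) => //;
    rewrite inE//; exact: leq_trans ks.
move=> i; have : lam i \in s by rewrite mem_sort codom_f.
by move=> /(nthP 0)[l ls lE]; exists l.+1.
Qed.

(** The sum telescopes up to [l]. Beyond [l] either the indicator vanishes, or [v j], [v j.+1] and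
    [v l] coincide and the increment of [h] vanishes. *)
Lemma layer_cake (h : R -> R) M (v : nat -> R) l : h 0 = 0 -> v 0 = 0 ->
  (forall j k, (j <= k <= M)%N -> v j <= v k) -> (l <= M)%N ->
  h (v l) = \sum_(0 <= j < M) (h (v j.+1) - h (v j)) * (v j.+1 <= v l)%R%:R.
Proof.
move=> h0 v0 vm lM; rewrite (big_cat_nat (leq0n l) lM)/=.
rewrite [X in _ + X]big_nat_cond [X in _ + X]big1 => [|j].
  rewrite addr0 (eq_big_nat _ _ (F2 := fun j => h (v j.+1) - h (v j))).
    by rewrite telescope_sumr// v0 h0 subr0.
  by move=> j /andP[_ jl]; rewrite vm ?mulr1// jl lM.
rewrite andbT => /andP[lj jM]; case: leP; rewrite ?mulr0// mulr1 => vl.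
have e1 : v j.+1 = v l.
  by apply/eqP; rewrite eq_le vl (vm l j.+1)// jM (leq_trans lj).
have e2 : v j = v l.
  by apply/eqP; rewrite eq_le (vm l j) ?lj ?(ltnW jM)// -e1 vm ?leqnSn.
by rewrite e1 e2 subrr.
Qed.

Lemma layer_cake_maxQ (h : R -> R) M (v : nat -> R) lam x :
  (forall i, 0 <= lam i) -> h 0 = 0 -> v 0 = 0 ->
  (forall j k, (j <= k <= M)%N -> v j <= v k) ->
  (forall i, exists2 l, (l <= M)%N & lam i = v l) ->
  h (maxQ lam x) = \sum_(0 <= j < M) (h (v j.+1) - h (v j)) *
    [exists i, (v j.+1 <= lam i)%R && Q i x]%:R.
Proof.
move=> lam0 h0 v0 vm lamv.
have [l lM lE] : exists2 l, (l <= M)%N & maxQ lam x = v l.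
  by case: (maxQ_attained x lam0) => [->|[i _ ->]]; [exists 0%N|exact: lamv].
rewrite lE (layer_cake h0 v0 vm lM); apply: eq_big_nat => j /andP[_ jM].
(* A level equal to 0 is below the maximum even where no set contains [x]; the increment of [h] is
   then 0. *)
have := vm 0%N j.+1 => /(_ jM); rewrite v0 le_eqVlt => /predU1P[vj|vj].
  have -> : v j = 0.
    have A : v 0 <= v j by apply: vm; rewrite (ltnW jM).
    have B : v j <= v j.+1 by apply: vm; rewrite leqnSn.
    by move: A B; rewrite v0 -vj => A B; apply/le_anti; rewrite A B.
  by rewrite -vj subrr !mul0r.
congr (_ * (nat_of_bool _)%:R); apply/idP/existsP => [|[i /andP[vi Qi]]].
  rewrite -lE => /bigmax_geP[|[i Qi vi]]; first by rewrite leNgt vj.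
  by exists i; rewrite vi Qi.
by rewrite -lE (le_trans vi)// maxQ_ge.
Qed.

End laminar.

Lemma sum_powR_le {R : realType} (J : finType) (P : pred J) (N : J -> R) r :
  1 <= r -> (forall j, 0 <= N j) ->
  \sum_(j | P j) N j `^ r <= (\sum_(j | P j) N j) `^ r.
Proof.
move=> r1 N0; set S := \sum_(j | P j) N j.
have S0 : 0 <= S by exact: sumr_ge0.
rewrite -[leRHS]mulr_powRB1//; last by lra.
rewrite {1}/S mulr_suml; apply: ler_sum => j Pj.
rewrite -[leLHS]mulr_powRB1//; last by lra.
rewrite ler_wpM2l// ler_powRl//; first by lra.
by rewrite /S (bigD1 j)//= lerDl sumr_ge0.
Qed.

(* With [S] the left sum for [r = 1], [N j * u j.+1 <= S] since [N] decreases. *)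
Lemma sum_diff_powR_le {R : realType} (M : nat) (u N : nat -> R) r : 1 <= r ->
  u 0 = 0 -> (forall j, (j < M)%N -> u j <= u j.+1) ->
  (forall j k, (j <= k)%N -> N k <= N j) -> (forall j, 0 <= N j) ->
  \sum_(0 <= j < M) (u j.+1 `^ r - u j `^ r) * N j `^ r <=
  r * (\sum_(0 <= j < M) (u j.+1 - u j) * N j) `^ r.
Proof.
move=> r1 u0 um Nm N0; set S := \sum_(0 <= j < M) (u j.+1 - u j) * N j.
have u_ge0 j : (j <= M)%N -> 0 <= u j.
  elim: j => [|j IH jM]; first by rewrite u0.
  by rewrite (le_trans (IH (ltnW jM)))// um.
have T0 j : (j < M)%N -> 0 <= (u j.+1 - u j) * N j.
  by move=> jM; rewrite mulr_ge0// subr_ge0 um.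
have S0 : 0 <= S by rewrite /S big_nat_cond; apply: sumr_ge0 => j /andP[/andP[_ /T0]].
have NS j : (j < M)%N -> N j * u j.+1 <= S.
  move=> jM; rewrite /S (big_cat_nat (leq0n j.+1) jM)/= -[leLHS]addr0.
  apply: lerD; last first.
    by rewrite big_nat_cond; apply: sumr_ge0 => k /andP[/andP[_ /T0]].
  have -> : u j.+1 = \sum_(0 <= k < j.+1) (u k.+1 - u k).
    by rewrite telescope_sumr// u0 subr0.
  rewrite mulr_sumr !big_nat; apply: ler_sum => k /andP[_ kj].
  by rewrite mulrC ler_wpM2l ?subr_ge0 ?um ?Nm// (leq_trans kj).
rewrite -[X in r * X]mulr_powRB1//; last by lra.
rewrite {1}/S mulr_suml mulr_sumr !big_nat; apply: ler_sum => j /andP[_ jM].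
have uj := u_ge0 _ (ltnW jM); have uj1 := u_ge0 _ jM.
apply: (@le_trans _ _ (r * u j.+1 `^ (r - 1) * (u j.+1 - u j) * N j `^ r)).
  by rewrite ler_wpM2r ?powR_ge0// powR_diff_le2// um.
rewrite -!mulrA ler_wpM2l//; first by lra.
rewrite mulrCA ler_wpM2l ?subr_ge0 ?um//.
rewrite -(@mulr_powRB1 _ (N j) r)//; last by lra.
rewrite mulrCA ler_wpM2l// -powRM// ler_powRl//; first by lra.
  exact: mulr_ge0.
by rewrite mulrC NS.
Qed.

(** * Maximal inequality and Carleson embedding *)

Section maximal_theorem.
Context {R : realType} {X I : finType} (Q : I -> pred X).
Hypothesis lamQ : laminar Q.
Implicit Types (J P : pred I) (m f nu : X -> R) (lam a : I -> R).

Lemma sum_maxQ (h : R -> R) M (v : nat -> R) lam (g : X -> R) :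
  (forall i, 0 <= lam i) -> h 0 = 0 -> v 0 = 0 ->
  (forall j k, (j <= k <= M)%N -> v j <= v k) ->
  (forall i, exists2 l, (l <= M)%N & lam i = v l) ->
  \sum_x h (maxQ Q lam x) * g x = \sum_(0 <= j < M) (h (v j.+1) - h (v j)) *
    \sum_(x | [exists i, (v j.+1 <= lam i) && Q i x]) g x.
Proof.
move=> lam0 h0 v0 vm lamv.
under eq_bigr do rewrite (layer_cake_maxQ Q _ lam0 h0 v0 vm lamv) mulr_suml.
rewrite exchange_big/=; apply: eq_bigr => j _.
rewrite mulr_sumr [RHS]big_mkcond/=; apply: eq_bigr => x _.
by case: ifP => _; rewrite ?(mulr0, mul0r, mulr1).
Qed.

(** The level set is the union of the maximal sets with [v <= lam i]. These are disjoint, so the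
    hypothesis can be summed over them. *)
Lemma weak_type lam m f v : 0 <= v -> (forall x, 0 <= m x) ->
  (forall i, lam i * \sum_(x | Q i x) m x <= \sum_(x | Q i x) f x * m x) ->
  v * \sum_(x | [exists i, (v <= lam i) && Q i x]) m x <=
  \sum_(x | [exists i, (v <= lam i) && Q i x]) f x * m x.
Proof.
move=> v0 m0 H.
have [J [Jv dJ cJ]] := maximal_subfamily (fun i => v <= lam i) lamQ.
have E x : [exists i, (v <= lam i) && Q i x] = [exists j, J j && Q j x].
  apply/existsP/existsP => -[i /andP[Pi Qi]].
    by have [j Jj /subQP ij] := cJ _ Pi; exists j; rewrite Jj ij.
  by exists i; rewrite Jv.
rewrite !(eq_bigl _ _ E) -!sum_disjointQ// mulr_sumr; apply: ler_sum => j Jj.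
by apply: le_trans (H j); rewrite ler_wpM2r ?sumr_ge0// Jv.
Qed.

(** The factor left by the absorption argument of [doob]; [q] is the conjugate exponent of [p]. *)
Definition doob_const (p : R) := let q := p / (p - 1) in 2 * (q * (2 * q) `^ (p - 1)).

Lemma doob_const_gt0 p : 1 < p -> 0 < doob_const p.
Proof.
move=> p1; rewrite /doob_const/=; set q := p / (p - 1).
have q0 : 0 < q by rewrite divr_gt0; lra.
by rewrite mulr_gt0// mulr_gt0// powR_gt0// mulr_gt0.
Qed.

(** With F the maximal function, the weak type bound summed over the levels gives
    [sum F^p m <= q sum f F^(p-1) m]. Where [f <= F / (2 q)] the right side is at most half of the
    left one and is absorbed, all sums being finite; elsewhere [F] is at most [2 q f]. *)
Lemma doob p lam m f : 1 < p -> (forall x, 0 <= m x) -> (forall x, 0 <= f x) ->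
  (forall i, 0 <= lam i) ->
  (forall i, lam i * \sum_(x | Q i x) m x <= \sum_(x | Q i x) f x * m x) ->
  \sum_x maxQ Q lam x `^ p * m x <= doob_const p * \sum_x f x `^ p * m x.
Proof.
move=> p1 m0 f0 lam0 H.
have [q qE] : exists q, q = p / (p - 1) by eexists.
have q0 : 0 < q by rewrite qE divr_gt0; lra.
have [M [v [v0 vm lamv]]] := levels lam0.
have vge0 j : (j <= M)%N -> 0 <= v j by move=> jM; rewrite -v0 vm.
have S1 : \sum_x maxQ Q lam x `^ p * m x <=
    \sum_x q * (f x * maxQ Q lam x `^ (p - 1)) * m x.
  have -> : \sum_x q * (f x * maxQ Q lam x `^ (p - 1)) * m x =
      q * \sum_x maxQ Q lam x `^ (p - 1) * (f x * m x).
    by rewrite mulr_sumr; apply: eq_bigr => x _; ring.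
  rewrite (@sum_maxQ (fun t => t `^ p) M v)//; last by rewrite powR0//; lra.
  rewrite (@sum_maxQ (fun t => t `^ (p - 1)) M v)//; last by rewrite powR0//; lra.
  rewrite mulr_sumr !big_nat; apply: ler_sum => j /andP[_ jM].
  have vj := vge0 _ (ltnW jM); have vj1 := vge0 _ jM.
  have vv : v j <= v j.+1 by rewrite vm// leqnSn.
  apply: (@le_trans _ _ (q * (v j.+1 * (v j.+1 `^ (p - 1) - v j `^ (p - 1))) *
    \sum_(x | [exists i, (v j.+1 <= lam i) && Q i x]) m x)).
    by rewrite ler_wpM2r ?sumr_ge0// qE powR_diff_le1.
  rewrite -!mulrA ler_pM2l// mulrCA ler_wpM2l//.
    by rewrite subr_ge0 ler_powRl//; lra.
  exact: weak_type.
suff S2 : \sum_x q * (f x * maxQ Q lam x `^ (p - 1)) * m x <=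
    2^-1 * \sum_x maxQ Q lam x `^ p * m x +
    q * (2 * q) `^ (p - 1) * \sum_x f x `^ p * m x.
  by move: (le_trans S1 S2); rewrite /doob_const/= -qE; lra.
rewrite !mulr_sumr -big_split/=; apply: ler_sum => x _.
set F := maxQ Q lam x.
have -> : 2^-1 * (F `^ p * m x) + q * (2 * q) `^ (p - 1) * (f x `^ p * m x) =
  (2^-1 * F `^ p + q * (2 * q) `^ (p - 1) * f x `^ p) * m x by ring.
rewrite ler_wpM2r//.
 have F0 : 0 <= F by exact: maxQ_ge0.
have [h|h] := leP (f x) (F / (2 * q)).
  rewrite -[leLHS]addr0 lerD ?mulr_ge0 ?powR_ge0 ?(ltW q0)//.
  rewrite -(@mulr_powRB1 _ F p)//; last by lra.
  rewrite !mulrA ler_wpM2r ?powR_ge0//.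
  move: h; rewrite ler_pdivlMr ?mulr_gt0// => h.
  by rewrite ler_pdivlMl//; move: h; lra.
rewrite -[leLHS]add0r lerD ?mulr_ge0 ?powR_ge0//.
rewrite -mulrA ler_pM2l// -(@mulr_powRB1 _ (f x) p)//; last by lra.
rewrite [leRHS]mulrCA ler_wpM2l//.
rewrite -powRM ?mulr_ge0 ?(ltW q0)// ler_powRl//; first by lra.
by move: h; rewrite ltr_pdivrMr ?mulr_gt0// mulrC => /ltW.
Qed.

(** Carleson's embedding for packing by a power of the measure. At each level the sets with large
    [lam] lie in disjoint maximal ones, to which the packing condition applies, and [r >= 1] bounds
    the sum of the powers by the power of the sum; [sum_diff_powR_le] then reassembles the
    levels. *)
Lemma carleson p r (A : R) a lam nu : 0 < p -> 1 <= r -> 0 <= A ->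
  (forall i, 0 <= a i) -> (forall i, 0 <= lam i) -> (forall x, 0 <= nu x) ->
  (forall j, \sum_(i | subQ Q i j) a i <= A * (\sum_(x | Q j x) nu x) `^ r) ->
  \sum_i a i * lam i `^ (p * r) <=
  A * (r * (\sum_x maxQ Q lam x `^ p * nu x) `^ r).
Proof.
move=> p0 r1 A0 a0 lam0 nu0 H.
have [M [v [v0 vm lamv]]] := levels lam0.
have vge0 j : (j <= M)%N -> 0 <= v j by move=> jM; rewrite -v0 vm.
(* The index is clamped at [M.-1] so that [N] decreases along all natural numbers, as
   [sum_diff_powR_le] requires, and not only below [M]. *)
pose N j := \sum_(x | [exists i, (v (minn j M.-1).+1 <= lam i) && Q i x]) nu x.
have pn0 : p != 0 by rewrite gt_eqF.
have prn0 : p * r != 0 by rewrite mulf_neq0// gt_eqF//; lra.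
rewrite (@sum_maxQ (fun t => t `^ p) M v)//; last by rewrite powR0.
pose h t : R := t `^ (p * r).
have -> : \sum_i a i * lam i `^ (p * r) = \sum_(0 <= j < M)
    (h (v j.+1) - h (v j)) * \sum_(i | v j.+1 <= lam i) a i.
  under eq_bigr => i _.
    have [l lM lE] := lamv i.
    rewrite lE -/(h (v l)) (@layer_cake _ _ M)//; last by rewrite /h powR0.
    rewrite -lE mulr_sumr; over.
  rewrite exchange_big/=; apply: eq_bigr => j _.
  rewrite mulr_sumr [RHS]big_mkcond/=; apply: eq_bigr => i _.
  by case: (v j.+1 <= lam i); rewrite ?(mulr0, mulr1)// mulrC.
have vv j : (j < M)%N -> v j <= v j.+1 by move=> jM; rewrite vm// leqnSn.
have := @sum_diff_powR_le R M (fun j => v j `^ p) N r r1.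
rewrite v0 powR0// => /(_ erefl).
have um j : (j < M)%N -> v j `^ p <= v j.+1 `^ p.
  by move=> jM; rewrite ler_powRl ?(ltW p0) ?vge0 ?vv// ltnW.
move=> /(_ um).
have Nm j k : (j <= k)%N -> N k <= N j.
  move=> jk; rewrite /N; have [M0|M0] := posnP M.
    by rewrite M0/= !minn0.
  apply: ler_sum_sub => // x /existsP[i /andP[vi Qi]].
  apply/existsP; exists i; rewrite Qi (le_trans _ vi)// vm//; apply/andP; split.
    by rewrite ltnS leq_min geq_minr geq_min jk.
  by rewrite -[leqRHS](prednK M0) ltnS geq_minr.
have N0 j : 0 <= N j by apply: sumr_ge0.
move=> /(_ Nm N0) S3.
have NE j : (j < M)%N ->
    N j = \sum_(x | [exists i, (v j.+1 <= lam i) && Q i x]) nu x.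
  by move=> jM; rewrite /N (minn_idPl _)// -ltnS (ltn_predK jM).
rewrite [X in A * (r * X `^ r)](eq_big_nat _ _ (F2 := fun j => (v j.+1 `^ p - v j `^ p) * N j)); last first.
  by move=> j /andP[_ jM]; rewrite /= (NE _ jM).
apply: le_trans (ler_wpM2l A0 S3).
rewrite mulr_sumr !big_nat; apply: ler_sum => j /andP[_ jM].
rewrite mulrCA /h !powRrM ler_wpM2l//.
  by rewrite subr_ge0 ler_powRl ?um ?powR_ge0//; lra.
rewrite NE//.
have [J [Jv dJ cJ]] := maximal_subfamily (fun i => v j.+1 <= lam i) lamQ.
have E x : [exists i, (v j.+1 <= lam i) && Q i x] = [exists j, J j && Q j x].
  apply/existsP/existsP => -[i /andP[Pi Qi]].
    by have [k Jk /subQP ik] := cJ _ Pi; exists k; rewrite Jk ik.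
  by exists i; rewrite Jv.
rewrite (eq_bigl _ _ E) -sum_disjointQ//.
apply: le_trans (ler_sum_cover a0 cJ) _.
apply: (@le_trans _ _ (\sum_(k | J k) A * (\sum_(x | Q k x) nu x) `^ r)).
  apply: ler_sum => k Jk; apply: le_trans (H k).
  by apply: ler_sum_sub => // i /andP[].
rewrite -mulr_sumr ler_wpM2l//.
by apply: sum_powR_le => // k; exact: sumr_ge0.
Qed.

End maximal_theorem.

(* For exponents of sum 1 this is Hoelder's inequality, up to the constant. *)
Lemma holder_sum {R : realType} (n : nat) (J : finType) (P : pred J)
    (t : 'I_n -> R) (Y : 'I_n -> J -> R) :
  (forall m, 0 < t m) -> 1 <= \sum_m t m -> (forall m j, 0 <= Y m j) ->
  \sum_(j | P j) \prod_m Y m j `^ t m <=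
  n%:R * \prod_m (\sum_(j | P j) Y m j) `^ t m.
Proof.
move=> t0 t1 Y0; set S := fun m => \sum_(j | P j) Y m j.
have S0 m : 0 <= S m by exact: sumr_ge0.
have YS m j : P j -> Y m j <= S m.
  by move=> Pj; rewrite /S (bigD1 j)//= lerDl sumr_ge0.
have T0 : 0 < \sum_m t m by apply: lt_le_trans t1.
have D m j : P j -> Y m j `^ t m = (Y m j / S m) `^ t m * S m `^ t m.
  move=> Pj; have [s0|s0] := eqVneq (S m) 0.
    have -> : Y m j = 0 by apply/le_anti; rewrite Y0 -s0 YS.
    by rewrite mul0r powR0 ?mul0r// gt_eqF.
  by rewrite -powRM ?divr_ge0// divfK.
have Y1 m j : P j -> 0 <= Y m j / S m <= 1.
  move=> Pj; rewrite divr_ge0//=; have [s0|s0] := eqVneq (S m) 0.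
    by rewrite s0 invr0 mulr0.
  by rewrite ler_pdivrMr ?mul1r ?YS// lt_neqAle eq_sym s0 S0.
have E j : P j -> \prod_m Y m j `^ t m <=
    (\sum_m Y m j / S m) * \prod_m S m `^ t m.
  move=> Pj; rewrite (eq_bigr _ (fun m _ => D m j Pj)) big_split/=.
  rewrite ler_wpM2r//; first by apply: prodr_ge0 => m _; exact: powR_ge0.
  have := @prod_powR_le_sum R 'I_n (fun m => t m / \sum_m t m)
    (fun m => Y m j / S m).
  move=> /(_ (fun m => divr_gt0 (t0 m) T0)).
  rewrite -mulr_suml divff ?gt_eqF// => /(_ erefl) H.
  apply: le_trans (H _); last by move=> m; case/andP: (Y1 m j Pj).
  apply: ler_prod => m _; rewrite powR_ge0/=.
  have /andP[y0 y1] := Y1 m j Pj.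
  move: y0; rewrite le_eqVlt => /predU1P[<-|y0].
    by rewrite !powR0// gt_eqF// divr_gt0.
  (* The normalized values lie in ]0, 1], so passing to the smaller exponent [t m / \sum_m t m]
     increases the power. The hypothesis that the exponents have sum at least 1 is used here. *)
  apply: ger_powR; first by rewrite y0.
  by rewrite ler_pdivrMr// ler_peMr// ltW.
apply: le_trans (ler_sum _ E) _; rewrite -mulr_suml ler_wpM2r//.
  by apply: prodr_ge0 => m _; exact: powR_ge0.
rewrite exchange_big/= -[n in n%:R]card_ord -sumr_const.
apply: ler_sum => m _; rewrite -mulr_suml -/(S m).
by have [->|s0] := eqVneq (S m) 0; rewrite ?mul0r// divff.
Qed.

(** * Sparse families *)

Section sparse.
Context {R : realType} {X I : finType} (Q : I -> pred X).
Hypothesis lamQ : laminar Q.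
Implicit Types (J P : pred I) (mu : X -> R) (b B : I -> R).

Definition mass mu i : R := \sum_(x | Q i x) mu x.

Lemma mass_ge0 mu i : (forall x, 0 <= mu x) -> 0 <= mass mu i.
Proof. by move=> mu0; exact: sumr_ge0. Qed.

Definition maxQ_in B j x := \big[Num.max/0]_(i | Q i x && subQ Q i j) B i.

(** The stopping rule of principal cubes. [K] is the constant in the superadditivity of [mass * b],
    and the factor 2 is what leaves half of the mass of each set uncovered. *)
Definition principal (K : R) b P := (forall k l, P k -> P l -> k != l ->
  subQ Q k l -> 2 * K * b l < b k).

(** Greedy selection from large sets to small ones, size being the number [c] of members of the
    family inside a set: a set is selected unless an already selected set containing it satisfies
    the bound on [b]. The list is increasing in [c] and treated from its tail, so larger sets come
    before smaller ones. *)
Lemma principal_exists (K : R) b : 1 <= K -> (forall i, 0 <= b i) ->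
  (forall i j, subQ Q i j -> subQ Q j i -> b i <= b j) ->
  exists2 P, principal K b P &
    forall i, exists j, [/\ P j, subQ Q i j & b i <= 2 * K * b j].
Proof.
move=> K1 b0 bE; pose c i := #|[pred k | subQ Q k i]|.
have cP i k : subQ Q k i -> (c i <= c k)%N -> subQ Q i k.
  move=> ki cik.
  have s : [pred l | subQ Q l k] \subset [pred l | subQ Q l i].
    by apply/fintype.subsetP => l /= lk; rewrite inE/=; exact: subQ_trans ki.
  have := geq_leqif (subset_leqif_card s).
  rewrite -/(c i) -/(c k) cik => /esym/idP/fintype.subsetP/(_ i).
  by rewrite !inE/= subQ_refl => /(_ isT).
suff H (s : seq I) : sorted (fun i j => (c i <= c j)%N) s ->
    exists P, [/\ forall i, P i -> i \in s, principal K b P &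
    forall i, i \in s -> exists j, [/\ P j, subQ Q i j & b i <= 2 * K * b j]].
  have [|P [_ pP cov]] := H (sort (fun i j => (c i <= c j)%N) (enum I)).
    by apply: sort_sorted => i j; exact: leq_total.
  by exists P => // i; apply: cov; rewrite mem_sort mem_enum.
have ctr : transitive (fun i j => (c i <= c j)%N).
  by move=> j i k; exact: leq_trans.
elim: s => [_|i s IH si]; first by exists pred0; split.
have [P [Ps pP cov]] := IH (path_sorted si).
have ci k : k \in s -> (c i <= c k)%N.
  by move: si; rewrite /= path_sortedE// => /andP[/allP h _] /h.
have [/existsP[j /and3P[Pj ij bij]]|nex] :=
    boolP [exists j, [&& P j, subQ Q i j & b i <= 2 * K * b j]].
  exists P; split => //; first by move=> k /Ps ks; rewrite inE ks orbT.
  by move=> k; rewrite inE => /predU1P[->|/cov//]; exists j.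
have lt_b j : P j -> subQ Q i j -> 2 * K * b j < b i.
  move=> Pj ij; rewrite ltNge; apply/negP => h; move/negP: nex; apply.
  by apply/existsP; exists j; rewrite Pj ij.
exists [pred k | (k == i) || P k]; split => /=.
- by move=> k /predU1P[->|/Ps ks]; rewrite inE ?eqxx ?ks ?orbT.
- move=> k l /predU1P[->|Pk] /predU1P[->|Pl] kl; first by rewrite eqxx in kl.
  + exact: lt_b.
  (* A selected set inside the new one is also at least as large in the sense of [c], so both are
     the same set; [b] then takes the same value and the strict jump is impossible. *)
  + move=> ki; have ik := cP _ _ ki (ci _ (Ps _ Pk)).
    have := lt_b _ Pk ik; have := bE _ _ ik ki; have := bE _ _ ki ik.
    have : b k <= 2 * K * b k by rewrite ler_peMl//; move: K1; lra.
    by move: (b k) (b i) => u v; lra.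
  + exact: pP.
- move=> k; rewrite inE => /predU1P[->|/cov[j [Pj kj bkj]]].
    exists i; rewrite eqxx subQ_refl; split => //.
    by rewrite ler_peMl//; move: K1; lra.
  by exists j; rewrite Pj orbT.
Qed.

(* Every cube of a principal family keeps half of its mass after removal of the
   smaller cubes of the family. *)
Lemma sparse_packing (K : R) mu b P :
  (forall x, 0 <= mu x) -> (forall i, 0 < mass mu i) ->
  1 <= K -> (forall i, 0 <= b i) ->
  (forall i J, disjointQ Q J -> (forall j, J j -> subQ Q j i) ->
    \sum_(j | J j) mass mu j * b j <= K * (mass mu i * b i)) ->
  principal K b P ->
  forall B, (forall i, 0 <= B i) -> forall j,
    \sum_(i | P i && subQ Q i j) mass mu i * B i <=
    2 * \sum_(x | Q j x) mu x * maxQ_in B j x.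
Proof.
move=> mu0 mup K1 b0 sup pP B B0 j.
pose Ch i := [pred k | [&& P k, subQ Q k i & k != i]].
pose E i x := Q i x && [forall k, Ch i k ==> ~~ Q k x].
have half i : P i -> mass mu i <= 2 * \sum_(x | E i x) mu x.
  move=> Pi; have [J [JC dJ cJ]] := maximal_subfamily (Ch i) lamQ.
  have Jsub k : J k -> subQ Q k i by move=> /JC /and3P[].
  have bJ k : J k -> 2 * K * b i < b k.
    by move=> /JC /and3P[Pk ki ne]; exact: pP.
  (* The maximal selected sets inside [Q i] have [b] above [2 * K * b i], while their total
     [mass * b] is at most [K] times that of [i]: they fill at most half of [Q i]. If [b i = 0], the
     same bound shows that there are none. *)
  have hJ : 2 * \sum_(k | J k) mass mu k <= mass mu i.
    have S := sup i J dJ Jsub.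
    have := b0 i; rewrite le_eqVlt => /predU1P[bi0|bi0].
      rewrite big_pred0 ?mulr0 ?mass_ge0// => k; apply/negP => Jk.
      move: S; rewrite -bi0 !mulr0 (bigD1 k)//=; apply/negP; rewrite -ltNge.
      apply: ltr_wpDr; first by apply: sumr_ge0 => l _; rewrite mulr_ge0// ltW.
      by rewrite mulr_gt0//; have := bJ _ Jk; rewrite -bi0 mulr0.
    have KB : 0 < K * b i by rewrite mulr_gt0//; apply: lt_le_trans K1.
    rewrite -(ler_pM2r KB) [leRHS]mulrCA; apply: le_trans S.
    rewrite -mulrA mulrCA mulr_suml.
    apply: ler_sum => k Jk.
    have := ltW (bJ _ Jk); have := mass_ge0 k mu0.
    move: (mass mu k) => u u0 h.
    by rewrite ler_wpM2l// mulrA.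
  have cov : mass mu i <= \sum_(x | E i x) mu x + \sum_(k | J k) mass mu k.
    rewrite /mass sum_disjointQ// [leLHS](bigID (E i))/=.
    apply: lerD; apply: ler_sum_sub => //; first by move=> x /andP[].
    move=> x /andP[Qix]; rewrite /E Qix/= => /forallPn[k].
    rewrite negb_imply negbK => /andP[Ck Qkx].
    have [l Jl /subQP kl] := cJ _ Ck.
    by apply/existsP; exists l; rewrite Jl kl.
  by move: hJ cov; set u := \sum_(k | J k) _; set v := \sum_(x | E i x) _; lra.
apply: (@le_trans _ _ (\sum_(i | P i && subQ Q i j)
    2 * \sum_(x | E i x) mu x * B i)).
  apply: ler_sum => i /andP[Pi _].
  by rewrite -mulr_suml mulrA ler_wpM2r// half.
rewrite -mulr_sumr ler_pM2l// (exchange_big_dep (Q j))/=; last first.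
  by move=> i x /andP[_ /subQP ij] /andP[/ij].
apply: ler_sum => x Qjx.
(* By laminarity the remainders [E i] of the selected sets are pairwise disjoint, so the inner sum
   has at most one term. *)
have [i /andP[/andP[Pi ij] Ei]|nE] :=
    pickP [pred i | (P i && subQ Q i j) && E i x]; last first.
  by rewrite big_pred0// mulr_ge0//; apply/bigmax_geP; left.
rewrite (big_pred1 i) => [|k].
  rewrite ler_wpM2l//; apply: (le_bigmax_cond _ B (j := i)).
  by case/andP: Ei => ->.
apply/idP/eqP => [/andP[/andP[Pk kj] Ek]|->]; last by rewrite /= Pi ij.
apply/eqP/negPn/negP => ki.
move: Ei Ek => /andP[Qi /forallP Ei] /andP[Qk /forallP Ek].
case/or3P: (lamQ k i) => h.
- by move: (Ei k); rewrite /= Pk h ki/= Qk.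
- by move: (Ek i); rewrite /= Pi h eq_sym ki/= Qi.
- by move/forallP/(_ x): h; rewrite Qk Qi.
Qed.

End sparse.

(** * Discrete weighted bounds *)

Section discrete_bounds.
Context {R : realType} {X I : finType} (Q : I -> pred X) (n : nat).
Variables (mu w : X -> R) (s f : 'I_n -> X -> R) (beta q : R) (p : 'I_n -> R).
Hypothesis lamQ : laminar Q.
Hypothesis mu0 : forall x, 0 <= mu x.
Hypothesis w0 : forall x, 0 <= w x.
Hypothesis s0 : forall m x, 0 <= s m x.
Hypothesis f0 : forall m x, 0 <= f m x.
Hypothesis mu_gt0 : forall i, 0 < mass Q mu i.
Hypothesis s_gt0 : forall m i, 0 < mass Q (s m) i.
Hypothesis beta_gt0 : 0 < beta.
Hypothesis beta_le : beta <= n%:R.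
Hypothesis q_gt0 : 0 < q.
Hypothesis p_gt1 : forall m, 1 < p m.
Hypothesis q_ge : 1 <= \sum_m q / p m.

Let p_gt0 m : 0 < p m. Proof. by apply: lt_trans (p_gt1 m). Qed.
Let n_ge1 : 1 <= n%:R :> R.
Proof.
by rewrite (ler_nat R 1 n) lt0n; apply: contraTneq beta_le => ->; rewrite -ltNge.
Qed.

Definition fmass m i : R := \sum_(x | Q i x) f m x * s m x.
Definition avg m i : R := fmass m i / mass Q (s m) i.
Definition Gcube i : R := mass Q mu i `^ (- beta) * \prod_m mass Q (s m) i.
Definition Lcube i : R := mass Q mu i `^ (- beta) * \prod_m fmass m i.

Lemma fmass_ge0 m i : 0 <= fmass m i.
Proof. by apply: sumr_ge0 => x _; exact: mulr_ge0. Qed.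

Lemma avg_ge0 m i : 0 <= avg m i.
Proof. by rewrite divr_ge0 ?fmass_ge0// mass_ge0. Qed.

Lemma Gcube_ge0 i : 0 <= Gcube i.
Proof. by rewrite mulr_ge0 ?powR_ge0// prodr_ge0// => m _; exact: mass_ge0. Qed.

Lemma Lcube_ge0 i : 0 <= Lcube i.
Proof. by rewrite mulr_ge0 ?powR_ge0// prodr_ge0// => m _; exact: fmass_ge0. Qed.

Lemma LcubeE i : Lcube i = Gcube i * \prod_m avg m i.
Proof.
rewrite /Lcube /Gcube -mulrA -big_split/=; congr (_ * _).
by apply: eq_bigr => m _; rewrite mulrC divfK// gt_eqF.
Qed.

(** With [b = Lcube ^ beta^-1] the superadditivity comes from [holder_sum] with [n] exponents
    [beta^-1]. Each set lies in a principal one with a loss of [2 n] in [b], hence of [(2 n) ^ beta]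
    in [Lcube], and the maximum at a point is then dominated by one term of the sum over principal
    sets. *)
Lemma sparse_domination : exists P : pred I,
  (\sum_x w x * maxQ Q Lcube x `^ q <=
   ((2 * n%:R) `^ beta) `^ q * \sum_(i | P i) mass Q w i * Lcube i `^ q) /\
  forall B, (forall i, 0 <= B i) -> forall j,
    \sum_(i | P i && subQ Q i j) mass Q mu i * B i <=
    2 * \sum_(x | Q j x) mu x * maxQ_in Q B j x.
Proof.
pose b i := Lcube i `^ beta^-1.
have b0 i : 0 <= b i by exact: powR_ge0.
have bn0 : beta != 0 by rewrite gt_eqF.
have bV0 : 0 < beta^-1 by rewrite invr_gt0.
have mb i : mass Q mu i * b i = \prod_m fmass m i `^ beta^-1.
  rewrite /b /Lcube powRM ?powR_ge0 ?prodr_ge0// => [|m _]; last exact: fmass_ge0.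
  rewrite -powRrM mulNr divff// powR_inv1 ?mass_ge0// mulrA divff ?gt_eqF//.
  by rewrite mul1r powR_prod// => m _; exact: fmass_ge0.
have bE i j : subQ Q i j -> subQ Q j i -> b i <= b j.
  move=> /subQP ij /subQP ji.
  have e x : Q i x = Q j x by apply/idP/idP => [/ij|/ji].
  suff -> : b i = b j by [].
  rewrite /b /Lcube /mass /fmass (eq_bigl _ _ e); congr ((_ * _) `^ _).
  by apply: eq_bigr => m _; rewrite (eq_bigl _ _ e).
have sup i J : disjointQ Q J -> (forall j, J j -> subQ Q j i) ->
    \sum_(j | J j) mass Q mu j * b j <= n%:R * (mass Q mu i * b i).
  move=> dJ Ji; under eq_bigr do rewrite mb.
  rewrite mb.
  have := @holder_sum R n I J (fun=> beta^-1) fmass (fun=> bV0).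
  have h1 : 1 <= \sum_(m < n) beta^-1.
    by rewrite sumr_const card_ord -(mulr_natl beta^-1) ler_pdivlMr// mul1r.
  move=> /(_ h1 fmass_ge0) H; apply: le_trans H _.
  rewrite ler_wpM2l//; apply: ler_prod => m _; rewrite powR_ge0/=.
  apply: ler_powRl; first exact: ltW.
    by apply: sumr_ge0 => j _; exact: fmass_ge0.
  rewrite sum_disjointQ//; apply: ler_sum_sub => [x|x /existsP[j /andP[/Ji]]].
    exact: mulr_ge0.
  by move/subQP; exact.
have [P pP cov] := principal_exists n_ge1 b0 bE.
exists P; split; last exact: sparse_packing sup pP.
rewrite mulr_sumr.
under [leRHS]eq_bigr do rewrite /mass mulr_suml mulr_sumr.
rewrite [leRHS](exchange_big_dep predT)//=; apply: ler_sum => x _.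
have [->|[i Qi ->]] := maxQ_attained Q x Lcube_ge0.
  rewrite powR0 ?gt_eqF// mulr0; apply: sumr_ge0 => i _.
  by rewrite !mulr_ge0// powR_ge0.
have [j [Pj /subQP ij bij]] := cov i.
rewrite (bigD1 j)/=; last by rewrite Pj ij.
rewrite -[leLHS]addr0 lerD//; last first.
  by apply: sumr_ge0 => k _; rewrite !mulr_ge0// powR_ge0.
rewrite mulrCA ler_wpM2l// -powRM ?powR_ge0 ?Lcube_ge0//.
apply: ler_powRl; [exact: ltW|exact: Lcube_ge0|].
rewrite -(powRVK (Lcube_ge0 i) bn0) -(powRVK (Lcube_ge0 j) bn0).
rewrite -powRM ?powR_ge0 ?mulr_ge0//.
by apply: ler_powRl => //; [exact: ltW|exact: powR_ge0].
Qed.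

Lemma avg_doob m : \sum_x maxQ Q (avg m) x `^ p m * s m x <=
  doob_const (p m) * \sum_x f m x `^ p m * s m x.
Proof.
apply: doob => // i; first exact: avg_ge0.
by rewrite /avg divfK// gt_eqF// s_gt0.
Qed.

(** The power of [2 n] comes from the passage to principal sets, the factor [n] from [holder_sum],
    and for each [m] the 2 from [sparse_packing] and [doob_const] from the maximal inequality. *)
Definition disc_const : R := ((2 * n%:R) `^ beta) `^ q * n%:R *
  \prod_m (2 * doob_const (p m)) `^ (q / p m).

Lemma norms_ge0 m : 0 <= \sum_x f m x `^ p m * s m x.
Proof. by apply: sumr_ge0 => x _; rewrite mulr_ge0// powR_ge0. Qed.

(** Each weight has its own coefficients [B m]. [holder_sum] with the exponents [q / p m] separates
    the functions; for each [m], Carleson's embedding with [r = 1] and the maximal inequality are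
    then applied to the measure [s m] with the exponent [p m]. *)
Lemma discrete_bound_split (K : R) (A : 'I_n -> R) (B : 'I_n -> I -> R) :
  0 <= K -> (forall m, 0 <= A m) -> (forall m i, 0 <= B m i) ->
  (forall i, mass Q w i * Gcube i `^ q <=
     K * \prod_m (mass Q mu i * B m i) `^ (q / p m)) ->
  (forall m j, \sum_(x | Q j x) mu x * maxQ_in Q (B m) j x <=
     A m * mass Q (s m) j) ->
  \sum_x w x * maxQ Q Lcube x `^ q <=
  disc_const * (K * \prod_m A m `^ (q / p m) *
    \prod_m (\sum_x f m x `^ p m * s m x) `^ (q / p m)).
Proof.
move=> K0 A0 B0 H1 H2; have [P [dom pack]] := sparse_domination.
apply: le_trans dom _.
pose a m i := if P i then mass Q mu i * B m i else 0.
have qp0 m : 0 < q / p m by rewrite divr_gt0.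
have a0 m i : 0 <= a m i.
  by rewrite /a; case: ifP => // _; rewrite mulr_ge0// mass_ge0.
have S1 : \sum_(i | P i) mass Q w i * Lcube i `^ q <=
    K * \sum_(i | P i) \prod_m (a m i * avg m i `^ p m) `^ (q / p m).
  rewrite mulr_sumr; apply: ler_sum => i Pi.
  rewrite LcubeE powRM ?Gcube_ge0 ?prodr_ge0// => [|m _]; last exact: avg_ge0.
  rewrite mulrA.
  have -> : \prod_m (a m i * avg m i `^ p m) `^ (q / p m) =
      \prod_m (mass Q mu i * B m i) `^ (q / p m) * (\prod_m avg m i) `^ q.
    rewrite powR_prod => [|m _]; last exact: avg_ge0.
    rewrite -big_split/=; apply: eq_bigr => m _.
    rewrite /a Pi powRM ?powR_ge0// ?mulr_ge0 ?mass_ge0//.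
    by rewrite -[(avg m i `^ _) `^ _]powRrM mulrCA divff ?mulr1 ?gt_eqF.
  by rewrite mulrA ler_wpM2r// powR_ge0.
have S2 := @holder_sum R n I P (fun m => q / p m)
  (fun m i => a m i * avg m i `^ p m) qp0 q_ge.
have {}S2 := S2 (fun m i => mulr_ge0 (a0 m i) (powR_ge0 _ _)).
have S3 m : \sum_(i | P i) a m i * avg m i `^ p m <=
    2 * doob_const (p m) * (A m * \sum_x f m x `^ p m * s m x).
  have H j : \sum_(i | subQ Q i j) a m i <=
      (2 * A m) * (\sum_(x | Q j x) s m x) `^ 1.
    rewrite powRr1 ?mass_ge0// -mulrA.
    have {}H2 : 2 * \sum_(x | Q j x) mu x * maxQ_in Q (B m) j x <=
      2 * (A m * \sum_(x | Q j x) s m x) by rewrite ler_pM2l//; exact: H2.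
    apply: le_trans H2; apply: le_trans (pack _ (B0 m) j).
    rewrite big_mkcond [leRHS]big_mkcond/=; apply: ler_sum => i _.
    by rewrite /a; case: (P i); case: (subQ Q i j).
  have A20 : 0 <= 2 * A m by rewrite mulr_ge0.
  have := carleson lamQ (p_gt0 m) (lexx 1) A20 (a0 m) (avg_ge0 m) (s0 m) H.
  rewrite mulr1 mul1r powRr1 => [C|]; last first.
    by apply: sumr_ge0 => x _; rewrite mulr_ge0// powR_ge0.
  apply: (@le_trans _ _ (\sum_i a m i * avg m i `^ p m)).
    by apply: ler_sum_sub => // i; rewrite mulr_ge0// powR_ge0.
  apply: le_trans C _.
  have -> : 2 * doob_const (p m) * (A m * \sum_x f m x `^ p m * s m x) =
    2 * A m * (doob_const (p m) * \sum_x f m x `^ p m * s m x) by ring.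
  by rewrite ler_wpM2l// avg_doob.
rewrite /disc_const -!mulrA ler_wpM2l ?powR_ge0//.
apply: le_trans S1 _.
have -> : forall u v t : R, n%:R * (u * (K * (v * t))) = K * (n%:R * (u * (v * t))).
  by move=> *; ring.
rewrite ler_wpM2l//; apply: le_trans S2 _; rewrite ler_wpM2l//.
rewrite -!big_split/=; apply: ler_prod => m _; rewrite powR_ge0/=.
have d0 : 0 <= 2 * doob_const (p m) by rewrite mulr_ge0// ltW// doob_const_gt0.
rewrite -powRM ?norms_ge0// -powRM ?(mulr_ge0 (A0 m) (norms_ge0 m))//.
apply: ler_powRl (S3 m); first exact: ltW.
by apply: sumr_ge0 => i _; rewrite mulr_ge0// powR_ge0.
Qed.

Definition disc_const_joint (p0 : R) : R := ((2 * n%:R) `^ beta) `^ q *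
  (2 * (q / p0 * (n%:R * \prod_m doob_const (p m) `^ (p0 / p m)) `^ (q / p0))).

(** One sequence of coefficients serves all weights and is packed by a power of [nu]. The product of
    the averages is embedded with exponent [p0] and [r = q / p0]; its maximal function is at most
    the product of the maximal functions, which [holder_sum] with the exponents [p0 / p m]
    separates. *)
Lemma discrete_bound_joint (p0 K A Cnu : R) (B : I -> R) (nu : X -> R) :
  0 < p0 -> \sum_m p0 / p m = 1 ->
  0 <= K -> 0 <= A -> 0 <= Cnu -> (forall i, 0 <= B i) -> (forall x, 0 <= nu x) ->
  (forall i, mass Q w i * Gcube i `^ q <= K * (mass Q mu i * B i)) ->
  (forall j, \sum_(x | Q j x) mu x * maxQ_in Q B j x <=
     A * mass Q nu j `^ (q / p0)) ->
  (forall x, nu x <= Cnu * \prod_m s m x `^ (p0 / p m)) ->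
  \sum_x w x * maxQ Q Lcube x `^ q <=
  disc_const_joint p0 * (K * A * Cnu `^ (q / p0) *
    \prod_m (\sum_x f m x `^ p m * s m x) `^ (q / p m)).
Proof.
move=> p00 p01 K0 A0 C0 B0 nu0 H1 H2 H3; have [P [dom pack]] := sparse_domination.
apply: le_trans dom _.
pose a i := if P i then mass Q mu i * B i else 0.
pose lam i := \prod_m avg m i.
have lam0 i : 0 <= lam i by apply: prodr_ge0 => m _; exact: avg_ge0.
have r1 : 1 <= q / p0.
  apply: le_trans q_ge _; rewrite -[leRHS]mulr1 -p01 mulr_sumr.
  by apply: ler_sum => m _; rewrite mulrA divfK ?gt_eqF.
have a0 i : 0 <= a i.
  by rewrite /a; case: ifP => // _; rewrite mulr_ge0// mass_ge0.
have S1 : \sum_(i | P i) mass Q w i * Lcube i `^ q <=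
    K * \sum_i a i * lam i `^ (p0 * (q / p0)).
  rewrite mulr_sumr big_mkcond/=; apply: ler_sum => i _.
  rewrite /a; case: ifP => _; last by rewrite mul0r mulr0.
  rewrite LcubeE (powRM _ (Gcube_ge0 i) (lam0 i)) mulrA.
  have -> : p0 * (q / p0) = q by field; rewrite gt_eqF.
  by rewrite mulrA ler_wpM2r ?powR_ge0.
have A20 : 0 <= 2 * A by rewrite mulr_ge0.
have pk j : \sum_(i | subQ Q i j) a i <=
    2 * A * (\sum_(x | Q j x) nu x) `^ (q / p0).
  have {}H2 : 2 * \sum_(x | Q j x) mu x * maxQ_in Q B j x <=
    2 * (A * (\sum_(x | Q j x) nu x) `^ (q / p0)) by rewrite ler_pM2l//; exact: H2.
  rewrite -mulrA; apply: le_trans H2; apply: le_trans (pack _ B0 j).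
  rewrite big_mkcond [leRHS]big_mkcond/=; apply: ler_sum => i _.
  by rewrite /a; case: (P i); case: (subQ Q i j).
have S2 := carleson lamQ p00 r1 A20 a0 lam0 nu0 pk.
have S3 : \sum_x maxQ Q lam x `^ p0 * nu x <= Cnu *
    (n%:R * \prod_m (doob_const (p m)) `^ (p0 / p m) *
     \prod_m (\sum_x f m x `^ p m * s m x) `^ (p0 / p m)).
  apply: (@le_trans _ _ (Cnu *
    \sum_x \prod_m (maxQ Q (avg m) x `^ p m * s m x) `^ (p0 / p m))).
    rewrite mulr_sumr; apply: ler_sum => x _.
    have -> : \prod_m (maxQ Q (avg m) x `^ p m * s m x) `^ (p0 / p m) =
        (\prod_m maxQ Q (avg m) x) `^ p0 * \prod_m s m x `^ (p0 / p m).
      rewrite powR_prod => [|m _]; last exact: maxQ_ge0.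
      rewrite -big_split/=; apply: eq_bigr => m _.
      rewrite powRM ?powR_ge0//.
      by rewrite -[(maxQ _ _ _ `^ _) `^ _]powRrM mulrCA divff ?mulr1 ?gt_eqF.
    rewrite mulrCA; apply: ler_pM => //; first exact: powR_ge0.
    apply: ler_powRl; [exact: ltW|exact: maxQ_ge0|].
    apply/bigmax_leP; split => [|i Qi]; first by apply: prodr_ge0 => m _; exact: maxQ_ge0.
    by apply: ler_prod => m _; rewrite avg_ge0/= maxQ_ge.
  rewrite ler_wpM2l//.
  have pp0 m : 0 < p0 / p m by rewrite divr_gt0.
  have := @holder_sum R n X predT (fun m => p0 / p m)
    (fun m x => maxQ Q (avg m) x `^ p m * s m x) pp0.
  rewrite p01 => /(_ (lexx _)) H.
  apply: le_trans (H _) _.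
    by move=> m x; rewrite mulr_ge0// powR_ge0.
  rewrite -mulrA ler_wpM2l// -big_split/=; apply: ler_prod => m _.
  rewrite powR_ge0/= -powRM ?norms_ge0//; last exact/ltW/doob_const_gt0.
  apply: ler_powRl (avg_doob m); first exact: ltW.
  by apply: sumr_ge0 => x _; rewrite mulr_ge0// powR_ge0.
rewrite /disc_const_joint -mulrA ler_wpM2l ?powR_ge0//.
apply: le_trans S1 _.
have D0 : 0 <= \prod_m doob_const (p m) `^ (p0 / p m).
  by apply: prodr_ge0 => m _; exact: powR_ge0.
have N0 : 0 <= \prod_m (\sum_x f m x `^ p m * s m x) `^ (p0 / p m).
  by apply: prodr_ge0 => m _; exact: powR_ge0.
have S4 : (\sum_x maxQ Q lam x `^ p0 * nu x) `^ (q / p0) <=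
    Cnu `^ (q / p0) * ((n%:R * \prod_m doob_const (p m) `^ (p0 / p m)) `^ (q / p0) *
      \prod_m (\sum_x f m x `^ p m * s m x) `^ (q / p m)).
  have -> : \prod_m (\sum_x f m x `^ p m * s m x) `^ (q / p m) =
     (\prod_m (\sum_x f m x `^ p m * s m x) `^ (p0 / p m)) `^ (q / p0).
    rewrite powR_prod => [|m _]; last exact: powR_ge0.
    apply: eq_bigr => m _; rewrite -powRrM; congr (_ `^ _).
    by field; rewrite !gt_eqF.
  rewrite -!powRM ?mulr_ge0//.
  apply: ler_powRl S3; first by lra.
  by apply: sumr_ge0 => x _; rewrite mulr_ge0// powR_ge0.
have := ler_wpM2l (le_trans ler01 r1) S4.
move: S2; rewrite /mass.
move: (q / p0) => r.
set v := \prod_m _ `^ (q / p m); set e := (n%:R * _) `^ r.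
set c := Cnu `^ r; set S := _ `^ r => S2 H.
have -> : 2 * (r * e) * (K * A * c * v) = K * (2 * A * (r * (c * (e * v)))).
  by ring.
by rewrite ler_wpM2l// (le_trans S2)// ler_wpM2l.
Qed.

End discrete_bounds.

(** * Integrals *)

Section integral_without_measurability.
Local Open Scope ereal_scope.
Context {d0 : measure_display} {T : measurableType d0} {R : realType}.
Variable mu : {measure set T -> \bar R}.
Implicit Types (D : set T) (f g : T -> \bar R).
Import HBNNSimple.

Lemma ge0_le_integral_nm D f g : (forall x, D x -> 0 <= f x) ->
  (forall x, D x -> f x <= g x) ->
  \int[mu]_(x in D) f x <= \int[mu]_(x in D) g x.
Proof.
move=> f0 fg; rewrite !ge0_integralE//; last first.
  by move=> x Dx; exact: le_trans (f0 _ Dx) (fg _ Dx).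
apply: le_ereal_sup => _ [h /= hf <-]; exists h => //= x.
apply: le_trans (hf x) _; rewrite /patch; case: ifPn => //.
by rewrite inE => /fg.
Qed.

(* The library integral of a nonnegative function is a supremum over simple
   functions below it, so neither function has to be measurable. *)
Lemma ge0_ae_le_integral_nm D f g : (forall x, D x -> 0 <= f x) ->
  (forall x, D x -> 0 <= g x) ->
  {ae mu, forall x, D x -> f x <= g x} ->
  \int[mu]_(x in D) f x <= \int[mu]_(x in D) g x.
Proof.
move=> f0 g0 [N [mN N0 sN]].
rewrite [leLHS]ge0_integralE//; apply: ge_ereal_sup => _ [h /= hf <-].
rewrite -integralT_nnsfun.
rewrite (ge0_negligible_integral mN measurableT)//=; last 2 first.
- exact/measurable_EFinP.
- by move=> x _; rewrite lee_fin fun_ge0.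
rewrite [leLHS]integral_mkcond [leRHS]integral_mkcond.
apply: ge0_le_integral_nm => x _.
  by rewrite /patch; case: ifP => // _; rewrite lee_fin fun_ge0.
rewrite /patch; case: ifPn => [|_]; last first.
  by case: ifPn => //; rewrite inE => /g0.
rewrite inE => -[_ Nx]; have := hf x; rewrite /patch; case: ifPn => // + hfx.
rewrite inE => Dx; apply: le_trans hfx _.
by apply: contrapT => nfg; apply: Nx; apply: sN => /= /(_ Dx).
Qed.

Lemma ae_le_integral_nm D f g : {ae mu, forall x, D x -> f x <= g x} ->
  \int[mu]_(x in D) f x <= \int[mu]_(x in D) g x.
Proof.
move=> fg; rewrite (integralE mu D f) (integralE mu D g).
apply: leeB.
  apply: ge0_ae_le_integral_nm => [x _|x _|]; rewrite ?funepos_ge0//.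
  move: fg; apply: filterS => x fg Dx.
  by rewrite !funeposE ge_max !le_max (fg Dx) lexx orbT.
apply: ge0_ae_le_integral_nm => [x _|x _|]; rewrite ?funeneg_ge0//.
move: fg; apply: filterS => x fg Dx.
by rewrite !funenegE ge_max !le_max leeN2 (fg Dx) lexx orbT.
Qed.

Lemma ae_eq_integral_nm D f g : {ae mu, forall x, D x -> f x = g x} ->
  \int[mu]_(x in D) f x = \int[mu]_(x in D) g x.
Proof.
move=> fg; apply/le_anti/andP; split; apply: ae_le_integral_nm;
  by move: fg; apply: filterS => x fg /fg ->.
Qed.

End integral_without_measurability.

Section integral_inequalities.
Context {d0 : measure_display} {T : measurableType d0} {R : realType}.
Variable mu : {measure set T -> \bar R}.
Variables (A : set T).
Hypothesis mA : measurable A.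
Implicit Types (s g h : T -> R).

Lemma integral_ge0_lty_fine s : (forall x, 0 <= s x) ->
  (\int[mu]_(x in A) (s x)%:E < +oo)%E ->
  (\int[mu]_(x in A) (s x)%:E)%E = (fine (\int[mu]_(x in A) (s x)%:E)%E)%:E.
Proof.
by move=> s0 sf; rewrite fineK// ge0_fin_numE// integral_ge0// => x _; rewrite lee_fin.
Qed.

Lemma ge0_fine_integral s : (forall x, 0 <= s x) ->
  0 <= fine (\int[mu]_(x in A) (s x)%:E)%E.
Proof. by move=> s0; rewrite fine_ge0// integral_ge0// => x _; rewrite lee_fin. Qed.

Lemma integral_scale (k : R) s : 0 <= k -> measurable_fun setT s ->
  (forall x, 0 <= s x) ->
  (\int[mu]_(x in A) (k * s x)%:E = k%:E * \int[mu]_(x in A) (s x)%:E)%E.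
Proof.
move=> k0 ms s0; under eq_integral do rewrite EFinM.
rewrite ge0_integralZl_EFin//.
- by move=> x _; rewrite lee_fin.
- exact/measurable_EFinP/measurable_funTS.
Qed.

Lemma fine_integral_gt0 s : measurable_fun setT s -> (forall x, 0 < s x) ->
  (0 < mu A)%E -> (\int[mu]_(x in A) (s x)%:E < +oo)%E ->
  0 < fine (\int[mu]_(x in A) (s x)%:E)%E.
Proof.
move=> ms s0 A0 sf; have s0' x : 0 <= s x by exact: ltW.
rewrite lt_neqAle ge0_fine_integral// andbT; apply/eqP => e0.
have I0 : (\int[mu]_(x in A) `|(s x)%:E| = 0)%E.
  under eq_integral do rewrite gee0_abs ?lee_fin//.
  by rewrite integral_ge0_lty_fine// -e0.
have mm : measurable_fun A (fun x => (s x)%:E).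
  by apply/measurable_EFinP; exact: measurable_funTS.
have [N [mN N0 sN]] := (ae_eq_integral_abs mu mA mm).1 I0.
suff : mu A = 0%E by move=> e; rewrite e ltxx in A0.
apply: (subset_measure0 mA mN _ N0) => x Ax; apply: sN => /= /(_ Ax)/eqP.
by rewrite eqe => /eqP sx; have := s0 x; rewrite sx ltxx.
Qed.

Lemma integral_sqrt_lty s : measurable_fun setT s -> (forall x, 0 <= s x) ->
  (mu A < +oo)%E -> (\int[mu]_(x in A) (s x)%:E < +oo)%E ->
  (\int[mu]_(x in A) (s x `^ 2^-1)%:E < +oo)%E.
Proof.
move=> ms s0 Af sf.
apply: (@le_lt_trans _ _ (\int[mu]_(x in A) (cst 1%:E x + (s x)%:E))%E).
  apply: ge0_le_integral_nm => x _; first by rewrite lee_fin powR_ge0.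
  rewrite lee_fin; have [s1|/ltW s1] := leP (s x) 1.
    apply: (@le_trans _ _ 1); last by rewrite lerDl.
    have : s x `^ 2^-1 <= 1 `^ 2^-1 by exact: ler_powRl.
    by rewrite powR1.
  apply: (@le_trans _ _ (s x)); last by rewrite lerDr.
  by apply: ler1_powR => //; lra.
rewrite ge0_integralD//.
- by rewrite integral_cst// mul1e lte_add_pinfty.
- by move=> x _; rewrite lee_fin.
- exact/measurable_EFinP/measurable_funTS.
Qed.

(** A two-case substitute for Young's inequality. The parameter [c] stays free in order to be chosen
    after integration. *)
Lemma young_split (p c t : R) : 1 < p -> 0 < c -> 0 <= t ->
  t <= c + c `^ (1 - p) * t `^ p.
Proof.
move=> p1 c0 t0; have [tc|ct] := leP t c.
  by rewrite -[leLHS]addr0 lerD// mulr_ge0 ?powR_ge0.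
rewrite -[leLHS]add0r lerD ?(ltW c0)//.
rewrite -(@mulr_powRB1 _ t p)//; last by lra.
rewrite mulrCA ler_peMr// -[1 - p]opprB powRN ler_pdivlMl ?powR_gt0// mulr1.
by rewrite ler_powRl//; [lra|exact: ltW|exact: ltW].
Qed.

Lemma integral_young (p c : R) s g : 1 < p -> 0 < c ->
  measurable_fun setT s -> measurable_fun setT g ->
  (forall x, 0 <= s x) -> (forall x, 0 <= g x) ->
  (\int[mu]_(x in A) (g x * s x)%:E <= c%:E * \int[mu]_(x in A) (s x)%:E +
    (c `^ (1 - p))%:E * \int[mu]_(x in A) (g x `^ p * s x)%:E)%E.
Proof.
move=> p1 c0 ms mg s0 g0.
have mgp : measurable_fun setT (fun x => g x `^ p).
  exact: (measurableT_comp (measurable_powR p) mg).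
have gps0 x : 0 <= g x `^ p * s x by rewrite mulr_ge0// powR_ge0.
have mgps : measurable_fun setT (fun x => g x `^ p * s x) by exact: measurable_funM.
have cp0 : 0 <= c `^ (1 - p) by exact: powR_ge0.
rewrite -(integral_scale (ltW c0) ms s0) -(integral_scale cp0 mgps gps0).
rewrite -ge0_integralD//; last 4 first.
- by move=> x _; rewrite lee_fin mulr_ge0// ltW.
- by apply/measurable_EFinP/measurable_funTS; exact: measurable_funM.
- by move=> x _; rewrite lee_fin mulr_ge0.
- by apply/measurable_EFinP/measurable_funTS; exact: measurable_funM.
apply: ge0_le_integral_nm => x _; first by rewrite lee_fin mulr_ge0.
rewrite -EFinD lee_fin mulrA -mulrDl ler_wpM2r//.
exact: young_split.
Qed.

(** Jensen's inequality for the measure with density [s], up to the factor [2 ^ p]: [young_split] is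
    integrated and its parameter chosen to balance the two terms. The second clause makes averages
    over sets of zero [s]-mass harmless. *)
Lemma integral_split (p : R) s g : 1 < p ->
  measurable_fun setT s -> measurable_fun setT g ->
  (forall x, 0 <= s x) -> (forall x, 0 <= g x) ->
  (\int[mu]_(x in A) (s x)%:E < +oo)%E ->
  (\int[mu]_(x in A) (g x `^ p * s x)%:E < +oo)%E ->
  let S := fine (\int[mu]_(x in A) (s x)%:E)%E in
  let u := fine (\int[mu]_(x in A) (g x * s x)%:E)%E in
  let N := fine (\int[mu]_(x in A) (g x `^ p * s x)%:E)%E in
  [/\ (\int[mu]_(x in A) (g x * s x)%:E < +oo)%E,
      (S = 0 -> u = 0) & (u / S) `^ p * S <= 2 `^ p * N].
Proof.
move=> p1 ms mg s0 g0 sf Nf S u N.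
have gs0 x : 0 <= g x * s x by rewrite mulr_ge0.
have gps0 x : 0 <= g x `^ p * s x by rewrite mulr_ge0// powR_ge0.
have SE := integral_ge0_lty_fine s0 sf; rewrite -/S in SE.
have NE := integral_ge0_lty_fine gps0 Nf; rewrite -/N in NE.
have Y c : 0 < c -> (\int[mu]_(x in A) (g x * s x)%:E <=
    (c * S + c `^ (1 - p) * N)%:E)%E.
  move=> c0; rewrite EFinD !EFinM -SE -NE.
  exact: integral_young.
have uf : (\int[mu]_(x in A) (g x * s x)%:E < +oo)%E.
  by apply: le_lt_trans (Y 1 ltr01) _; rewrite ltry.
have {}Y c : 0 < c -> u <= c * S + c `^ (1 - p) * N.
  by move=> /Y; rewrite (integral_ge0_lty_fine gs0 uf) lee_fin.
have u0 : 0 <= u by exact: ge0_fine_integral.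
have S0 : 0 <= S by exact: ge0_fine_integral.
have N0 : 0 <= N by exact: ge0_fine_integral.
have p0 : 0 < p by lra.
split => //.
  move=> Se; apply/eqP; rewrite eq_le u0 andbT leNgt; apply/negP => up.
  have [Ne|Np] := eqVneq N 0.
    by have := Y 1 ltr01; rewrite Se Ne !mulr0 addr0 leNgt up.
  have {}Np : 0 < N by rewrite lt_neqAle eq_sym Np.
  have k0 : 0 < u / (2 * N) by rewrite divr_gt0// mulr_gt0.
  (* The parameter for which [c ^ (1 - p) * N] is [u / 2]; the other term vanishes with [S]. *)
  have := Y _ (powR_gt0 (1 - p)^-1 k0).
  rewrite Se mulr0 add0r powRVK; [|exact: ltW|]; last by rewrite lt_eqF//; lra.
  have -> : u / (2 * N) * N = u / 2 by field; rewrite gt_eqF.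
  by move: up; lra.
move: S0; rewrite le_eqVlt => /predU1P[<-|S0].
  by rewrite mulr0 mulr_ge0// powR_ge0.
move: N0; rewrite le_eqVlt => /predU1P[Ne|N0].
  have -> : u = 0.
    apply/eqP; rewrite eq_le u0 andbT leNgt; apply/negP => up.
    have k0 : 0 < u / (2 * S) by rewrite divr_gt0// mulr_gt0.
    have := Y _ k0; rewrite -Ne mulr0 addr0.
    have -> : u / (2 * S) * S = u / 2 by field; rewrite gt_eqF.
    by move: up; lra.
  by rewrite mul0r powR0 ?gt_eqF// mul0r mulr_ge0 ?powR_ge0// -Ne.
(* At this parameter the two terms are equal, whence [u <= 2 * c * S]. *)
pose c := (N / S) `^ p^-1.
have c0 : 0 < c by rewrite powR_gt0// divr_gt0.
have cp : c `^ p = N / S by rewrite powRVK ?gt_eqF// divr_ge0 ?ltW.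
have := Y _ c0.
have -> : c `^ (1 - p) * N = c * S.
  rewrite powRB ?(gt_eqF c0) ?implybT// powRr1 ?ltW// cp.
  by field; rewrite !gt_eqF.
move=> uS.
have -> : 2 `^ p * N = (2 * c) `^ p * S.
  by rewrite powRM ?ltW// cp; field; rewrite gt_eqF.
rewrite ler_wpM2r ?(ltW S0)// ler_powRl ?divr_ge0 ?(ltW S0) ?(ltW p0)// ler_pdivrMr//.
by move: uS; lra.
Qed.

(** Hoelder's inequality up to the factor [n]: [prod_powR_le_sum] is applied to the normalized
    functions [s m / S m], each of integral 1. If some [S m] is 0 then [A] is null, because [s m] is
    positive everywhere. *)
Lemma integral_prod_powR (n : nat) (th : 'I_n -> R) (s : 'I_n -> T -> R) :
  (forall m, 0 < th m) -> \sum_m th m = 1 ->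
  (forall m, measurable_fun setT (s m)) ->
  (forall m x, 0 < s m x) ->
  (forall m, \int[mu]_(x in A) (s m x)%:E < +oo)%E ->
  (\int[mu]_(x in A) (\prod_m s m x `^ th m)%:E <=
   (n%:R * \prod_m fine (\int[mu]_(x in A) (s m x)%:E)%E `^ th m)%:E)%E.
Proof.
move=> th0 th1 ms s0 sf; pose S m := fine (\int[mu]_(x in A) (s m x)%:E)%E.
have s0' m x : 0 <= s m x by exact: ltW.
have SE m := integral_ge0_lty_fine (s0' m) (sf m).
have S0 m : 0 <= S m by exact: ge0_fine_integral.
have pm : measurable_fun setT (fun x => \prod_m s m x `^ th m).
  apply: measurable_prod => m _.
  exact: (measurableT_comp (measurable_powR _) (ms m)).
have P0 x : 0 <= \prod_m s m x `^ th m.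
  by apply: prodr_ge0 => m _; exact: powR_ge0.
have [/existsP[m /eqP Sm0]|] := boolP [exists m, S m == 0].
  have A0 : mu A = 0%E.
    apply/eqP; rewrite -measure_le0 leNgt; apply/negP => A0.
    by have := fine_integral_gt0 (ms m) (s0 m) A0 (sf m); rewrite -/(S m) Sm0 ltxx.
  rewrite null_set_integral//.
    by rewrite lee_fin mulr_ge0// prodr_ge0// => k _; exact: powR_ge0.
  by apply/measurable_EFinP; exact: measurable_funTS.
rewrite negb_exists => /forallP Sn0.
have Sp m : 0 < S m by rewrite lt_neqAle eq_sym Sn0 S0.
apply: (@le_trans _ _ (\int[mu]_(x in A)
  ((\prod_m S m `^ th m)%:E * \sum_m ((S m)^-1%:E * (s m x)%:E)))%E).
  apply: ge0_le_integral_nm => x _; first by rewrite lee_fin.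
  have -> : (\sum_m ((S m)^-1%:E * (s m x)%:E) =
      (\sum_m (S m)^-1 * s m x)%:E)%E.
    by rewrite -sumEFin; apply: eq_bigr => m _; rewrite EFinM.
  rewrite -EFinM lee_fin.
  have := @prod_powR_le_sum R 'I_n th (fun m => (S m)^-1 * s m x) th0 th1.
  have y0 m : 0 <= (S m)^-1 * s m x by rewrite mulr_ge0// invr_ge0.
  move=> /(_ y0) H; have PS0 : 0 <= \prod_m S m `^ th m.
    by apply: prodr_ge0 => m _; exact: powR_ge0.
  apply: le_trans (ler_wpM2l PS0 H); rewrite -big_split/=.
  apply: ler_prod => m _; rewrite powR_ge0/= -powRM//.
  by rewrite mulrA divff ?mul1r ?gt_eqF.
have mS m : measurable_fun A (fun x => (s m x)%:E).
  by apply/measurable_EFinP; exact: measurable_funTS.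
rewrite ge0_integralZl_EFin//; first last.
- by apply: prodr_ge0 => m _; exact: powR_ge0.
- by apply: emeasurable_sum => m; exact: measurable_funeM.
- by move=> x _; apply: sume_ge0 => m _; rewrite mule_ge0// lee_fin ?invr_ge0.
rewrite ge0_integral_sum//; first last.
- by move=> m x _; rewrite mule_ge0// lee_fin ?invr_ge0.
- by move=> m; exact: measurable_funeM.
rewrite (eq_bigr (fun=> 1%E)) => [|m _].
  by rewrite sumEFin sumr_const card_ord -EFinM mulrC lee_fin.
under eq_integral do rewrite -EFinM.
rewrite (integral_scale _ (ms m) (s0' m)) ?invr_ge0//.
by rewrite SE -/(S m) -EFinM mulVf ?gt_eqF.
Qed.

End integral_inequalities.

(** * From finite families of cubes to finite sets *)

Section atoms.
Context {d0 : measure_display} {T : measurableType d0} {R : realType}.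
Variable mu : {measure set T -> \bar R}.
Context {I : finType}.
Variable C : I -> set T.
Hypothesis mC : forall i, measurable (C i).
Local Notation X := {ffun I -> bool}.
Implicit Types (phi : X) (s : T -> R) (B : I -> R) (P : pred I).

Definition atom phi : set T := [set x | forall i, phi i = `[< C i x >]].
Definition code (x : T) : X := [ffun i => `[< C i x >]].
(** Some membership vectors are realized by no point. Requiring a nonempty atom makes inclusion of
    these predicates equivalent to inclusion of the sets [C i]. *)
Definition cubeQ i phi : bool := phi i && `[< atom phi !=set0 >].
Definition cint s i : R := fine (\int[mu]_(x in C i) (s x)%:E)%E.
Definition live phi : bool := [exists i, cubeQ i phi].
(** The atom outside all the sets may have infinite mass; it receives mass 0, and the functions
    integrated below vanish there. *)
Definition amass s phi : R :=
  if live phi then fine (\int[mu]_(x in atom phi) (s x)%:E)%E else 0.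
Definition cubemax P B x := \big[Num.max/0]_(i | P i && `[< C i x >]) B i.
Definition subC j i : bool := `[< C i `<=` C j >].

Lemma atom_code phi x : atom phi x -> code x = phi.
Proof. by move=> Ax; apply/ffunP => i; rewrite ffunE Ax. Qed.

Lemma code_atom x : atom (code x) x.
Proof. by move=> i; rewrite ffunE. Qed.

Lemma cubeQ_code i x : cubeQ i (code x) = `[< C i x >].
Proof.
rewrite /cubeQ ffunE; have -> : `[< atom (code x) !=set0 >].
  by apply/asboolP; exists x; exact: code_atom.
by rewrite andbT.
Qed.

Lemma cubeQ_atom i phi x : atom phi x -> C i x -> cubeQ i phi.
Proof. by move=> /atom_code <- Cx; rewrite cubeQ_code; exact/asboolP. Qed.

Lemma atom_cubeQ i phi : cubeQ i phi -> atom phi `<=` C i.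
Proof. by move=> /andP[phii _] x /(_ i); rewrite phii => /esym/asboolP. Qed.

Lemma measurable_atom phi : measurable (atom phi).
Proof.
rewrite (_ : atom phi = \bigcap_(i in [set: I]) (if phi i then C i else ~` C i)).
  apply: fin_bigcap_measurable => // i _.
  by case: (phi i) => //; exact: measurableC.
apply/seteqP; split => x /=.
  by move=> Ax i _; rewrite Ax; case: asboolP.
by move=> H i; move: (H i Logic.I); case: (phi i) => h; apply/esym; [exact/asboolP|
  exact/asboolPn].
Qed.

Lemma trivIset_atom (D : set X) : trivIset D atom.
Proof.
apply/trivIsetP => phi psi _ _ /eqP ne; apply/seteqP; split => // x [/= A1 A2].
by apply: ne; rewrite -(atom_code A1) (atom_code A2).
Qed.

Lemma subQ_cubeQ i j : subQ cubeQ i j = subC j i.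
Proof.
apply/subQP/asboolP => [h x Cx|h phi].
  have /h : cubeQ i (code x) by rewrite cubeQ_code; exact/asboolP.
  by rewrite cubeQ_code => /asboolP.
move=> /andP[phii /asboolP[x Ax]]; apply: (cubeQ_atom Ax); apply: h.
by move/asboolP : (phii); rewrite (Ax i) => /asboolP/asboolP.
Qed.

Lemma laminar_cubeQ :
  (forall i j, [\/ C i `<=` C j, C j `<=` C i | C i `&` C j = set0]) ->
  laminar cubeQ.
Proof.
move=> lamC i j; rewrite !subQ_cubeQ.
case: (lamC i j) => [h|h|h]; apply/or3P.
- by apply: Or31; exact/asboolP.
- by apply: Or32; exact/asboolP.
- apply: Or33; apply/forallP => phi; apply/negP.
  move=> /andP[/[dup] ci /andP[_ /asboolP[x Ax]] cj].
  have : (C i `&` C j) x by split; [exact: (atom_cubeQ ci)|exact: (atom_cubeQ cj)].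
  by rewrite h.
Qed.

Lemma cube_atoms i : C i = \big[setU/set0]_(phi <- enum (cubeQ i)) atom phi.
Proof.
rewrite -bigcup_seq; apply/seteqP; split => x /=.
  move=> Cx; exists (code x); last exact: code_atom.
  by rewrite /= mem_enum; change (cubeQ i (code x)); rewrite cubeQ_code; exact/asboolP.
by move=> [phi /=]; rewrite mem_enum => Qi Ax; exact: (atom_cubeQ Qi Ax).
Qed.

Lemma setT_atoms : [set: T] = \big[setU/set0]_(phi <- enum [set: X]%SET) atom phi.
Proof.
rewrite -bigcup_seq; apply/seteqP; split => // x _.
by exists (code x); [rewrite /= mem_enum inE|exact: code_atom].
Qed.

Lemma integral_cube (f : T -> \bar R) i : measurable_fun setT f ->
  (forall x, 0 <= f x)%E ->
  (\int[mu]_(x in C i) f x = \sum_(phi | cubeQ i phi) \int[mu]_(x in atom phi) f x)%E.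
Proof.
move=> mf f0; rewrite {1}(cube_atoms i) ge0_integral_bigsetU//.
- by rewrite big_enum.
- exact: measurable_atom.
- exact: enum_uniq.
- exact: trivIset_atom.
- exact: measurable_funTS.
Qed.

Lemma integral_setT (f : T -> \bar R) : measurable_fun setT f ->
  (forall x, 0 <= f x)%E ->
  (\int[mu]_x f x = \sum_phi \int[mu]_(x in atom phi) f x)%E.
Proof.
move=> mf f0; rewrite {1}setT_atoms ge0_integral_bigsetU//.
- by rewrite big_enum/=; apply: eq_bigl => phi; rewrite inE.
- exact: measurable_atom.
- exact: enum_uniq.
- exact: trivIset_atom.
- exact: measurable_funTS.
Qed.

Lemma measurable_code (h : X -> R) : measurable_fun setT (fun x => h (code x)).
Proof.
rewrite (_ : (fun x => _) = fun x => \sum_phi h phi * \1_(atom phi) x).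
  apply: measurable_sum => phi; apply: measurable_funM => //.
  exact/measurable_indic/measurable_atom.
apply/funext => x; rewrite (bigD1 (code x))//= indicE mem_set; last exact: code_atom.
rewrite mulr1 big1 ?addr0// => phi ne; rewrite indicE memNset ?mulr0//.
by move=> /atom_code e; rewrite e eqxx in ne.
Qed.

Section masses.
Variable s : T -> R.
Hypothesis ms : measurable_fun setT s.
Hypothesis s0 : forall x, 0 <= s x.
Hypothesis sf : forall i, (\int[mu]_(x in C i) (s x)%:E < +oo)%E.

Lemma ms_EFin : measurable_fun setT (fun x => (s x)%:E).
Proof. exact/measurable_EFinP. Qed.

Lemma atom_lty phi : live phi -> (\int[mu]_(x in atom phi) (s x)%:E < +oo)%E.
Proof.
move=> /existsP[i Qi]; apply: le_lt_trans (sf i).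
apply: ge0_subset_integral => //; first exact: measurable_atom.
- exact: measurable_funTS ms_EFin.
- by move=> x _; rewrite lee_fin.
- exact: atom_cubeQ.
Qed.

Lemma amassE phi : live phi ->
  (\int[mu]_(x in atom phi) (s x)%:E)%E = (amass s phi)%:E.
Proof.
move=> l; rewrite /amass l integral_ge0_lty_fine//; exact: atom_lty.
Qed.

Lemma amass_ge0 phi : 0 <= amass s phi.
Proof. by rewrite /amass; case: ifP => // _; exact: ge0_fine_integral. Qed.

Lemma cubeQ_live i phi : cubeQ i phi -> live phi.
Proof. by move=> Qi; apply/existsP; exists i. Qed.

Lemma mass_amass i : mass cubeQ (amass s) i = cint s i.
Proof.
apply: EFin_inj; rewrite /cint -integral_ge0_lty_fine// integral_cube//.
- rewrite /mass -sumEFin; apply: eq_bigr => phi Qi.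
  by rewrite amassE//; exact: cubeQ_live Qi.
- exact: ms_EFin.
Qed.

Lemma cint_ge0 i : 0 <= cint s i.
Proof. exact: ge0_fine_integral. Qed.

Lemma integral_code_atom (h : X -> R) phi : (forall psi, 0 <= h psi) ->
  (\int[mu]_(x in atom phi) (h (code x) * s x)%:E =
   (h phi)%:E * \int[mu]_(x in atom phi) (s x)%:E)%E.
Proof.
move=> h0; rewrite -integral_scale//; last exact: measurable_atom.
by apply: eq_integral => x; rewrite inE => /atom_code ->.
Qed.

Lemma integral_code_cube (h : X -> R) i : (forall psi, 0 <= h psi) ->
  (\int[mu]_(x in C i) (h (code x) * s x)%:E =
   (\sum_(phi | cubeQ i phi) h phi * amass s phi)%:E)%E.
Proof.
move=> h0; rewrite integral_cube//.
- rewrite -sumEFin; apply: eq_bigr => phi Qi.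
  by rewrite integral_code_atom// amassE ?EFinM//; exact: cubeQ_live Qi.
- by apply/measurable_EFinP; apply: measurable_funM => //; exact: measurable_code.
- by move=> x; rewrite lee_fin mulr_ge0.
Qed.

Lemma integral_code_setT (h : X -> R) : (forall psi, 0 <= h psi) ->
  (forall phi, ~~ live phi -> h phi = 0) ->
  (\int[mu]_x (h (code x) * s x)%:E = (\sum_phi amass s phi * h phi)%:E)%E.
Proof.
move=> h0 hd; rewrite integral_setT//.
- rewrite -sumEFin; apply: eq_bigr => phi _.
  rewrite integral_code_atom//; have [l|nl] := boolP (live phi).
    by rewrite amassE// -EFinM mulrC.
  by rewrite hd// mul0e mulr0.
- by apply/measurable_EFinP; apply: measurable_funM => //; exact: measurable_code.
- by move=> x; rewrite lee_fin mulr_ge0.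
Qed.

Lemma sum_amass_le : (\int[mu]_x (s x)%:E < +oo)%E ->
  \sum_phi amass s phi <= fine (\int[mu]_x (s x)%:E)%E.
Proof.
move=> sfT; rewrite -lee_fin -integral_ge0_lty_fine//.
rewrite integral_setT//; last exact: ms_EFin.
rewrite -sumEFin; apply: lee_sum => phi _.
have [l|nl] := boolP (live phi); first by rewrite amassE.
by rewrite /amass (negbTE nl) integral_ge0// => x _; rewrite lee_fin.
Qed.

End masses.

Lemma cubemax_code B x : cubemax predT B x = maxQ cubeQ B (code x).
Proof. by apply: eq_bigl => i; rewrite cubeQ_code. Qed.

Lemma cubemax_in_code B j x : cubemax (subC j) B x = maxQ_in cubeQ B j (code x).
Proof. by apply: eq_bigl => i; rewrite cubeQ_code subQ_cubeQ andbC. Qed.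

Lemma maxQ_dead B phi : ~~ live phi -> maxQ cubeQ B phi = 0.
Proof.
move=> nl; apply: big_pred0 => i; apply/negP => Qi; move/negP: nl; apply.
by apply/existsP; exists i.
Qed.

End atoms.

(** * Bounds for finite laminar families of measurable sets *)

Section laminar_bounds.
Context {d0 : measure_display} {T : measurableType d0} {R : realType}.
Variable mu : {measure set T -> \bar R}.
Context {I : finType}.
Variable C : I -> set T.
Hypothesis mC : forall i, measurable (C i).
Hypothesis lamC : forall i j, [\/ C i `<=` C j, C j `<=` C i | C i `&` C j = set0].
Hypothesis muC : forall i, (0 < mu (C i) < +oo)%E.
Local Notation X := {ffun I -> bool}.
Local Notation Q := (cubeQ C).
Local Notation "''M' s" := (amass mu C s) (at level 8, s at level 2).

Let one : T -> R := fun=> 1.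
Let m1 : measurable_fun setT one. Proof. exact: measurable_cst. Qed.
Let one0 x : 0 <= one x. Proof. exact: ler01. Qed.
Let oneE i : (\int[mu]_(x in C i) (one x)%:E = mu (C i))%E.
Proof. by rewrite -[RHS]mul1e -integral_cst. Qed.
Let onef i : (\int[mu]_(x in C i) (one x)%:E < +oo)%E.
Proof. by rewrite oneE; case/andP: (muC i). Qed.

Definition cvol i : R := fine (mu (C i)).

Lemma cvol_gt0 i : 0 < cvol i.
Proof. by rewrite /cvol fine_gt0//; case/andP: (muC i) => -> ->. Qed.

Lemma mass_one i : mass Q 'M one i = cvol i.
Proof. by rewrite mass_amass// /cint oneE. Qed.

(** The conditional expectation of [g] on the atoms for the measure with density [s]; it is 0 on
    atoms where ['M s] is 0. *)
Definition atom_avg (g s : T -> R) (phi : X) : R :=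
  'M (fun x => g x * s x) phi / 'M s phi.

Section atom_average.
Variables (p : R) (g s : T -> R).
Hypothesis p1 : 1 < p.
Hypothesis ms : measurable_fun setT s.
Hypothesis mg : measurable_fun setT g.
Hypothesis s0 : forall x, 0 <= s x.
Hypothesis g0 : forall x, 0 <= g x.
Hypothesis sf : forall i, (\int[mu]_(x in C i) (s x)%:E < +oo)%E.
Hypothesis gf : forall i, (\int[mu]_(x in C i) (g x `^ p * s x)%:E < +oo)%E.

Let gs0 x : 0 <= g x * s x. Proof. exact: mulr_ge0. Qed.
Let mgs : measurable_fun setT (fun x => g x * s x).
Proof. exact: measurable_funM. Qed.
Let gps0 x : 0 <= g x `^ p * s x. Proof. by rewrite mulr_ge0// powR_ge0. Qed.
Let mgps : measurable_fun setT (fun x => g x `^ p * s x).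
Proof.
by apply: measurable_funM => //; exact: (measurableT_comp (measurable_powR p) mg).
Qed.

Lemma gs_lty i : (\int[mu]_(x in C i) (g x * s x)%:E < +oo)%E.
Proof. by have [] := integral_split (mC i) p1 ms mg s0 g0 (sf i) (gf i). Qed.

Lemma atom_avg_ge0 phi : 0 <= atom_avg g s phi.
Proof. by rewrite divr_ge0// amass_ge0. Qed.

Lemma atom_avg_mul phi : atom_avg g s phi * 'M s phi = 'M (fun x => g x * s x) phi.
Proof.
rewrite /atom_avg; have [l|nl] := boolP (live C phi); last first.
  by rewrite /amass (negbTE nl) !mul0r.
have [S0|S0] := eqVneq ('M s phi) 0; last by rewrite divfK.
rewrite S0 mulr0; apply/esym; move: S0; rewrite /amass l => S0.
have [] // := @integral_split _ _ _ mu _ (measurable_atom mC phi) p s g.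
- exact: (atom_lty mC ms s0 sf l).
- exact: (atom_lty mC mgps gps0 gf l).
- by move=> _ /(_ S0) ->.
Qed.

Lemma atom_avg_powR phi :
  atom_avg g s phi `^ p * 'M s phi <= 2 `^ p * 'M (fun x => g x `^ p * s x) phi.
Proof.
rewrite /atom_avg; have [l|nl] := boolP (live C phi); last first.
  by rewrite /amass (negbTE nl) !mulr0.
rewrite /amass l.
have [] // := @integral_split _ _ _ mu _ (measurable_atom mC phi) p s g.
- exact: (atom_lty mC ms s0 sf l).
- exact: (atom_lty mC mgps gps0 gf l).
Qed.

Lemma sum_atom_avg i : \sum_(phi | Q i phi) atom_avg g s phi * 'M s phi =
  cint mu C (fun x => g x * s x) i.
Proof.
rewrite -mass_amass//; last exact: gs_lty.
by apply: eq_bigr => phi _; exact: atom_avg_mul.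
Qed.

End atom_average.

Lemma packing_code (B : I -> R) j : (forall i, 0 <= B i) ->
  (\int[mu]_(x in C j) (cubemax C (subC C j) B x)%:E =
   (\sum_(phi | Q j phi) 'M one phi * maxQ_in Q B j phi)%:E)%E.
Proof.
move=> B0.
under eq_integral do rewrite cubemax_in_code -[X in X%:E](mulr1 (maxQ_in _ _ _ _)).
rewrite (@integral_code_cube _ _ _ mu _ _ mC one m1 one0 onef (maxQ_in Q B j)).
  by congr EFin; apply: eq_bigr => phi _; rewrite mulrC.
by move=> phi; apply/bigmax_geP; left.
Qed.

(* Geometric means are dominated by averages of square roots, for which the
   packing condition is the L^2 maximal inequality. *)
Lemma sqrt_packing (s : T -> R) j : measurable_fun setT s ->
  (forall x, 0 <= s x) -> (forall i, \int[mu]_(x in C i) (s x)%:E < +oo)%E ->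
  (\int[mu]_(x in C j) (cubemax C (subC C j)
    (fun i => (cint mu C (fun x => s x `^ 2^-1) i / cvol i) `^ 2) x)%:E <=
   (doob_const 2 * 2 `^ 2 * cint mu C s j)%:E)%E.
Proof.
move=> ms s0 sf.
pose g x := s x `^ 2^-1.
have g0 x : 0 <= g x by exact: powR_ge0.
have mg : measurable_fun setT g.
  exact: (measurableT_comp (measurable_powR _) ms).
have g2 : (fun x => g x `^ 2 * one x) = s.
  by apply/funext => x; rewrite mulr1 powRVK.
have g1 : (fun x => g x * one x) = g by apply/funext => x; rewrite mulr1.
have lt12 : 1 < 2 :> R by lra.
have gf i : (\int[mu]_(x in C i) (g x `^ 2 * one x)%:E < +oo)%E.
  by have := sf i; rewrite -{1}g2.
have gif i : (\int[mu]_(x in C i) (g x)%:E < +oo)%E.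
  have := gs_lty lt12 m1 mg one0 g0 onef gf i.
  by under eq_integral do rewrite /one mulr1.
rewrite packing_code => [|i]; last exact: powR_ge0.
(* Both functions are cut off to the sets inside [j], which localizes the maximal inequality: its
   right side then only involves atoms of [C j]. *)
pose f phi := if Q j phi then atom_avg g one phi else 0.
pose lam i := if subQ Q i j then cint mu C g i / cvol i else 0.
have lam0 i : 0 <= lam i.
  rewrite /lam; case: ifP => // _; rewrite divr_ge0 ?(ltW (cvol_gt0 _))//.
  exact: cint_ge0.
have f0 phi : 0 <= f phi by rewrite /f; case: ifP => // _; exact: atom_avg_ge0.
have M0 phi : 0 <= 'M one phi by exact: amass_ge0.
have D i : lam i * mass Q 'M one i <= \sum_(phi | Q i phi) f phi * 'M one phi.
  rewrite mass_one /lam; case: ifPn => [ij|_]; last first.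
    by rewrite mul0r sumr_ge0// => phi _; exact: mulr_ge0.
  rewrite divfK ?gt_eqF ?cvol_gt0//.
  have := sum_atom_avg lt12 m1 mg one0 g0 onef gf i; rewrite g1 => <-.
  rewrite le_eqVlt; apply/orP; left; apply/eqP; apply: eq_bigr => phi Qi.
  by rewrite /f; move/subQP: ij => /(_ _ Qi) ->.
have := doob (laminar_cubeQ lamC) lt12 M0 f0 lam0 D => H.
rewrite lee_fin; apply: (@le_trans _ _ (\sum_phi maxQ Q lam phi `^ 2 * 'M one phi)).
  apply: (@le_trans _ _ (\sum_(phi | Q j phi) maxQ Q lam phi `^ 2 * 'M one phi)).
    apply: ler_sum => phi _; rewrite mulrC ler_wpM2r//.
    apply/bigmax_leP; split => [|i /andP[Qi ij]]; first exact: powR_ge0.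
    apply: ler_powRl => //.
      by rewrite divr_ge0 ?(ltW (cvol_gt0 _))//; exact: cint_ge0.
    by apply: le_trans (maxQ_ge lam Qi); rewrite /lam ij.
  by apply: ler_sum_sub => // phi; rewrite mulr_ge0// powR_ge0.
apply: le_trans H _; rewrite -mulrA ler_wpM2l ?(ltW (doob_const_gt0 lt12))//.
rewrite -mass_amass// /mass mulr_sumr.
rewrite [leLHS](bigID (Q j))/= [X in _ + X]big1 ?addr0 => [|phi nQ]; last first.
  by rewrite /f (negbTE nQ) powR0// mul0r.
apply: ler_sum => phi Qj; rewrite /f Qj.
by have := atom_avg_powR lt12 m1 mg one0 g0 onef gf phi; rewrite g2.
Qed.

Section bounds.
Variable (n : nat) (w : T -> R) (s g : 'I_n -> T -> R) (beta q : R) (p : 'I_n -> R).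
Hypothesis mw : measurable_fun setT w.
Hypothesis ms : forall m, measurable_fun setT (s m).
Hypothesis mg : forall m, measurable_fun setT (g m).
Hypothesis w0 : forall x, 0 <= w x.
Hypothesis s0 : forall m x, 0 < s m x.
Hypothesis g0 : forall m x, 0 <= g m x.
Hypothesis wf : forall i, (\int[mu]_(x in C i) (w x)%:E < +oo)%E.
Hypothesis sf : forall m i, (\int[mu]_(x in C i) (s m x)%:E < +oo)%E.
Hypothesis gf : forall m, (\int[mu]_x (g m x `^ p m * s m x)%:E < +oo)%E.
Hypothesis beta_gt0 : 0 < beta.
Hypothesis beta_le : beta <= n%:R.
Hypothesis q_gt0 : 0 < q.
Hypothesis p_gt1 : forall m, 1 < p m.
Hypothesis q_ge : 1 <= \sum_m q / p m.

Definition Lam i : R := cvol i `^ (- beta) *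
  \prod_m cint mu C (fun x => g m x * s m x) i.
Definition Gam i : R := cvol i `^ (- beta) * \prod_m cint mu C (s m) i.
Definition gnorm m : R := fine (\int[mu]_x (g m x `^ p m * s m x)%:E)%E.

Let s0' m x : 0 <= s m x. Proof. exact: ltW. Qed.

Let mgps m : measurable_fun setT (fun x => g m x `^ p m * s m x).
Proof.
by apply: measurable_funM => //; exact: (measurableT_comp (measurable_powR _) (mg m)).
Qed.

Let gps0 m x : 0 <= g m x `^ p m * s m x.
Proof. by rewrite mulr_ge0// powR_ge0. Qed.

Let gfi m i : (\int[mu]_(x in C i) (g m x `^ p m * s m x)%:E < +oo)%E.
Proof.
apply: le_lt_trans (gf m); apply: ge0_subset_integral => //.
- exact/measurable_EFinP.
- by move=> x _; rewrite lee_fin.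
Qed.

Lemma cint_gt0 m i : 0 < cint mu C (s m) i.
Proof.
by apply: fine_integral_gt0 => //; case/andP: (muC i).
Qed.

Let fX m := atom_avg (g m) (s m).

Let mass_w i : mass Q 'M w i = cint mu C w i.
Proof. exact: mass_amass. Qed.
Let mass_s m i : mass Q 'M (s m) i = cint mu C (s m) i.
Proof. exact: mass_amass. Qed.

(** Averaging over the atoms changes no integral over a set of the family. *)
Lemma Lcube_Lam i : Lcube Q 'M one (fun m => 'M (s m)) fX beta i = Lam i.
Proof.
rewrite /Lcube mass_one; congr (_ * _); apply: eq_bigr => m _.
exact: (@sum_atom_avg (p m)).
Qed.

Lemma Gcube_Gam i : Gcube Q 'M one (fun m => 'M (s m)) beta i = Gam i.
Proof.
by rewrite /Gcube mass_one; congr (_ * _); apply: eq_bigr => m _; rewrite mass_s.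
Qed.

Lemma integral_maxC : (\int[mu]_x (cubemax C predT Lam x `^ q * w x)%:E =
  (\sum_phi 'M w phi *
    maxQ Q (Lcube Q 'M one (fun m => 'M (s m)) fX beta) phi `^ q)%:E)%E.
Proof.
have -> : Lcube Q 'M one (fun m => 'M (s m)) fX beta = Lam.
  by apply/funext => i; exact: Lcube_Lam.
under eq_integral do rewrite cubemax_code.
rewrite (@integral_code_setT _ _ _ mu _ _ mC w mw w0 wf (fun phi => maxQ Q Lam phi `^ q))//.
  by move=> phi; exact: powR_ge0.
by move=> phi /maxQ_dead ->; rewrite powR0 ?gt_eqF.
Qed.

Lemma prod_gnorm : \prod_m (\sum_phi fX m phi `^ p m * 'M (s m) phi) `^ (q / p m) <=
  \prod_m (2 `^ p m * gnorm m) `^ (q / p m).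
Proof.
apply: ler_prod => m _; rewrite powR_ge0/=; have pm0 : 0 < p m.
  exact: lt_trans (p_gt1 m).
apply: ler_powRl; first by rewrite divr_ge0 ?ltW.
  by apply: sumr_ge0 => phi _; rewrite mulr_ge0 ?powR_ge0 ?amass_ge0.
apply: (@le_trans _ _ (\sum_phi 2 `^ p m * 'M (fun x => g m x `^ p m * s m x) phi)).
  by apply: ler_sum => phi _; exact: atom_avg_powR.
rewrite -mulr_sumr ler_wpM2l ?powR_ge0//.
exact: sum_amass_le.
Qed.

Lemma bound_split (K : R) (A : 'I_n -> R) (B : 'I_n -> I -> R) :
  0 <= K -> (forall m, 0 <= A m) -> (forall m i, 0 <= B m i) ->
  (forall i, cint mu C w i * Gam i `^ q <=
     K * \prod_m (cvol i * B m i) `^ (q / p m)) ->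
  (forall m j, \int[mu]_(x in C j) (cubemax C (subC C j) (B m) x)%:E <=
     (A m * cint mu C (s m) j)%:E)%E ->
  (\int[mu]_x (cubemax C predT Lam x `^ q * w x)%:E <=
  (disc_const beta q p * (K * \prod_m A m `^ (q / p m) *
    \prod_m (2 `^ p m * gnorm m) `^ (q / p m)))%:E)%E.
Proof.
move=> K0 A0 B0 H1 H2; rewrite integral_maxC lee_fin.
have := @discrete_bound_split R X I Q n 'M one 'M w (fun m => 'M (s m)) fX beta q p
  (laminar_cubeQ lamC) (amass_ge0 _ _ one0) (amass_ge0 _ _ w0)
  (fun m => amass_ge0 _ _ (s0' m)).
have f0 m phi : 0 <= fX m phi by exact: atom_avg_ge0.
have V0 i : 0 < mass Q 'M one i by rewrite mass_one cvol_gt0.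
have S0 m i : 0 < mass Q 'M (s m) i by rewrite mass_s cint_gt0.
move=> /(_ f0 V0 S0 beta_gt0 beta_le q_gt0 p_gt1 q_ge K A B K0 A0 B0).
move=> H; apply: le_trans (H _ _) _.
- move=> i; rewrite Gcube_Gam mass_w; apply: le_trans (H1 i) _.
  by under [X in _ <= _ * X]eq_bigr do rewrite mass_one.
- by move=> m j; rewrite mass_s -lee_fin -packing_code//; exact: H2.
apply: ler_wpM2l.
  rewrite !mulr_ge0 ?powR_ge0//; apply: prodr_ge0 => m _; exact: powR_ge0.
apply: ler_wpM2l; last exact: prod_gnorm.
by rewrite mulr_ge0//; apply: prodr_ge0 => m _; exact: powR_ge0.
Qed.

(** The measure used in the joint embedding has density [\prod_m s m ^ (p0 / p m)]. By
    [integral_prod_powR] its mass on an atom is at most [n] times the product of the powers of the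
    masses, so the constant [Cnu] is [n]. *)
Lemma bound_joint (p0 K A : R) (B : I -> R) :
  0 < p0 -> \sum_m p0 / p m = 1 ->
  0 <= K -> 0 <= A -> (forall i, 0 <= B i) ->
  (forall i, cint mu C w i * Gam i `^ q <= K * (cvol i * B i)) ->
  (forall j, \int[mu]_(x in C j) (cubemax C (subC C j) B x)%:E <=
     (A * cint mu C (fun x => \prod_m s m x `^ (p0 / p m)) j `^ (q / p0))%:E)%E ->
  (\int[mu]_x (cubemax C predT Lam x `^ q * w x)%:E <=
  (disc_const_joint beta q p p0 * (K * A * n%:R `^ (q / p0) *
    \prod_m (2 `^ p m * gnorm m) `^ (q / p m)))%:E)%E.
Proof.
move=> p00 p01 K0 A0 B0 H1 H2; rewrite integral_maxC lee_fin.
pose rho x : R := \prod_m s m x `^ (p0 / p m).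
have th0 m : 0 < p0 / p m by rewrite divr_gt0//; exact: lt_trans (p_gt1 m).
have rho0 x : 0 <= rho x by apply: prodr_ge0 => m _; exact: powR_ge0.
have mrho : measurable_fun setT rho.
  apply: measurable_prod => m _.
  exact: (measurableT_comp (measurable_powR _) (ms m)).
have rhof i : (\int[mu]_(x in C i) (rho x)%:E < +oo)%E.
  by apply: le_lt_trans (integral_prod_powR (mC i) th0 p01 ms s0 (sf^~ i)) _; rewrite ltry.
have := @discrete_bound_joint R X I Q n 'M one 'M w (fun m => 'M (s m)) fX beta q p
  (laminar_cubeQ lamC) (amass_ge0 _ _ one0) (amass_ge0 _ _ w0)
  (fun m => amass_ge0 _ _ (s0' m)).
have f0 m phi : 0 <= fX m phi by exact: atom_avg_ge0.
have V0 i : 0 < mass Q 'M one i by rewrite mass_one cvol_gt0.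
have S0 m i : 0 < mass Q 'M (s m) i by rewrite mass_s cint_gt0.
move=> /(_ f0 V0 S0 beta_gt0 beta_le q_gt0 p_gt1 q_ge p0 K A n%:R B 'M rho).
move=> /(_ p00 p01 K0 A0 (ler0n _ _) B0 (amass_ge0 _ _ rho0)).
move=> H; apply: le_trans (H _ _ _) _.
- by move=> i; rewrite Gcube_Gam mass_w mass_one; exact: H1.
- move=> j; rewrite -lee_fin -packing_code// (mass_amass mC mrho rho0 rhof).
  exact: H2.
- move=> phi; have [l|nl] := boolP (live C phi); last first.
    rewrite {1}/amass (negbTE nl) mulr_ge0//.
    by apply: prodr_ge0 => m _; exact: powR_ge0.
  rewrite -lee_fin -(amassE mC mrho rho0 rhof l) /amass l.
  apply: integral_prod_powR => //; first exact: measurable_atom.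
  by move=> m; exact: atom_lty.
have D0 : 0 <= disc_const_joint beta q p p0.
  rewrite /disc_const_joint mulr_ge0 ?powR_ge0// mulr_ge0// mulr_ge0 ?powR_ge0//.
  by rewrite divr_ge0 ?ltW.
apply: ler_wpM2l => //; apply: ler_wpM2l; last exact: prod_gnorm.
by rewrite mulr_ge0 ?powR_ge0// mulr_ge0.
Qed.

End bounds.
End laminar_bounds.

(** The index count of [one_third], with [v = 2 ^ l]: at most [2 v] steps to reach the point, one
    more, and at most [v] for the shifted origin. *)
Lemma index_bound (m u v : nat) : (m <= 2 * v)%N -> (u <= v)%N -> (0 < v)%N ->
  (m.+1 + u < 9 * v)%N.
Proof. lia. Qed.

(** * Cubes and grids *)

Section half_open_cubes.
Context {R : realType} {d : nat}.
Local Notation E := 'rV[R]_d.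
Local Notation mu := (leb R d).
Implicit Types (a : E) (l : R).

(** Closed cells of a grid meet along their faces and would not be laminar; half-open ones are, and
    they differ from closed cubes by a null set. *)
Definition hcube a l : set E :=
  [set x | forall i, a ord0 i <= x ord0 i < a ord0 i + l].
Definition ccube a l : set E := box a (a + const_mx l).

Lemma measurable_hcube a l : measurable (hcube a l).
Proof.
rewrite (_ : hcube a l = \bigcap_(i in [set: 'I_d])
    ((fun v : E => v ord0 i) @^-1` `[a ord0 i, a ord0 i + l[)).
  apply: fin_bigcap_measurable => // i _.
  by rewrite -[X in measurable X]setTI; exact: measurable_coor.
by apply/seteqP; split => x xab i /=; [move=> _|]; move: (xab i);
  rewrite /= in_itv/=; [|exact].
Qed.

Lemma measurable_ccube a l : measurable (ccube a l).
Proof. exact: measurable_box. Qed.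

Lemma ccubeP a l x :
  ccube a l x <-> forall i, a ord0 i <= x ord0 i <= a ord0 i + l.
Proof.
by split => h i; move: (h i); rewrite !mxE.
Qed.

Lemma hcube_sub a l : hcube a l `<=` ccube a l.
Proof.
by move=> x h; apply/ccubeP => i; case/andP: (h i) => -> /ltW ->.
Qed.

Lemma leb_ccube a l : 0 <= l -> mu (ccube a l) = (l ^+ d)%:E.
Proof.
move=> l0; rewrite leb_box => [|i]; last by rewrite !mxE lerDl.
congr EFin; rewrite -[X in l ^+ X]card_ord -prodr_const; apply: eq_bigr => i _.
by rewrite !mxE [a ord0 i + _]addrC addrK.
Qed.

Lemma negligible_boundary a l : 0 <= l ->
  mu.-negligible (ccube a l `\` hcube a l).
Proof.
move=> l0.
(* A point lost in passing to the half-open cube has a coordinate at its upper end. [F] lists these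
   upper faces, which are degenerate boxes, along the natural numbers. *)
pose F (k : nat) : set E := if insub k is Some i then
  box (\row_j (if j == i then a ord0 j + l else a ord0 j)) (a + const_mx l) else set0.
apply: (@negligibleS _ _ _ _ (\bigcup_k F k)); last first.
  apply: negligible_bigcup => k; rewrite /F; case: insubP => [i _ _|_].
    apply/negligibleP; first exact: measurable_box.
    apply: etrans (leb_box _) _ => [j|].
      by rewrite !mxE; case: ifP => //; rewrite lerDl.
    by rewrite (bigD1 i)//= !mxE eqxx subrr mul0r.
  exact: negligible_set0.
move=> x [/ccubeP cx /= hx].
have /existsNP[i hi] := hx.
exists (i : nat) => //; rewrite /F valK => j; rewrite !mxE.
have /andP[h1 h2] := cx j; rewrite h2 andbT.
have [->|//] := eqVneq j i; have /andP[h3 h4] := cx i.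
by rewrite leNgt; apply/negP => h5; apply: hi; rewrite h3 h5.
Qed.

Lemma integral_hcube (f : E -> \bar R) a l : 0 <= l ->
  (\int[mu]_(x in hcube a l) f x = \int[mu]_(x in ccube a l) f x)%E.
Proof.
move=> l0; rewrite integral_mkcond [RHS]integral_mkcond.
apply: ae_eq_integral_nm; apply: negligibleS (negligible_boundary a l0).
move=> x /= nx; split.
  apply: contrapT => cx; apply: nx => _.
  by rewrite /patch !memNset// => /hcube_sub.
move=> hx; apply: nx => _; rewrite /patch !mem_set//; exact: hcube_sub.
Qed.

Lemma leb_hcube a l : 0 <= l -> mu (hcube a l) = (l ^+ d)%:E.
Proof.
move=> l0; rewrite -(leb_ccube a l0).
rewrite (measureDI mu (measurable_ccube a l) (measurable_hcube a l)).
rewrite measure_negligible//; last exact: negligible_boundary.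
  rewrite add0e; congr (mu _); apply/seteqP; split => [x hx|x []//].
  by split => //; exact: hcube_sub.
by apply: measurableD; [exact: measurable_ccube|exact: measurable_hcube].
Qed.

Lemma cubes_ccube a l : 0 < l -> cubes (ccube a l).
Proof. by move=> l0; exists a, l. Qed.

End half_open_cubes.

Section grids.
Context {R : realType} {d : nat}.
Local Notation E := 'rV[R]_d.
Implicit Types (N l : nat) (t : {ffun 'I_d -> bool}).

Definition grid_side N l : R := 2 ^+ N / 2 ^+ l.

(* Modulo the grid of step [grid_side N l], with [l] arbitrary, the second
   origin is one or two thirds of a step away from the first one. *)
Definition grid_orig N (b : bool) : R := - 2 ^+ N - (if b then 2 ^+ N / 3 else 0).

(** The scales [0 <= l <= 2 N] give sides from [2^N] down to [2^-N]. One range of positions per axis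
    serves all of them: [9 * 2^l] suffice at the scale [l], and this is at most [9 * 4^N]. *)
Definition grid_idx N := ('I_(N.*2.+1) * {ffun 'I_d -> 'I_(9 * 4 ^ N)})%type.

Definition corner N t (k : grid_idx N) : E :=
  \row_i (grid_orig N (t i) + grid_side N k.1 * (k.2 i)%:R).

Definition cell N t (k : grid_idx N) : set E := hcube (corner t k) (grid_side N k.1).

Lemma grid_side_gt0 N l : 0 < grid_side N l.
Proof. by rewrite divr_gt0// exprn_gt0. Qed.

(** Measured from [o] in units of [e], all end points are integers. A common point gives
    [c m < m' + 1] and [m' < c (m + 1)], which for integers mean [c m <= m'] and
    [m' + 1 <= c (m + 1)]. *)
Lemma nested_itv (o e x y : R) (c m m' : nat) : 0 < e ->
  o + e * c%:R * m%:R <= x < o + e * c%:R * m%:R + e * c%:R ->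
  o + e * m'%:R <= x < o + e * m'%:R + e ->
  o + e * m'%:R <= y < o + e * m'%:R + e ->
  o + e * c%:R * m%:R <= y < o + e * c%:R * m%:R + e * c%:R.
Proof.
move=> e0 /andP[h1 h2] /andP[h3 h4] /andP[h5 h6].
have E1 : e * (c * m)%:R < e * m'.+1%:R.
  by rewrite natrM -[m'.+1%:R]natr1 mulrDr mulrA mulr1; lra.
have E2 : e * m'%:R < e * (c * m.+1)%:R.
  by rewrite natrM -[m.+1%:R]natr1 [c%:R * _]mulrDr mulr1 mulrDr mulrA; lra.
move: E1 E2; rewrite !ltr_pM2l// !ltr_nat ltnS => E1 E2.
have {}E1 : e * c%:R * m%:R <= e * m'%:R.
  by rewrite -mulrA -natrM ler_pM2l// ler_nat.
have {}E2 : e * m'%:R + e <= e * c%:R * m%:R + e * c%:R.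
  have : e * m'.+1%:R <= e * (c * m.+1)%:R by rewrite ler_pM2l// ler_nat.
  by rewrite natrM -!natr1 [c%:R * _]mulrDr !mulr1 !mulrDr mulrA mulr1.
by apply/andP; split; lra.
Qed.

Lemma cell_nested N t (k k' : grid_idx N) x : (k.1 <= k'.1)%N ->
  cell t k x -> cell t k' x -> cell t k' `<=` cell t k.
Proof.
move=> kk h h' y hy i; move: (h i) (h' i) (hy i); rewrite !mxE.
have -> : grid_side N k.1 = grid_side N k'.1 * (2 ^ (k'.1 - k.1))%:R.
  rewrite /grid_side natrX -{1}(subnK kk) exprD; field.
  by rewrite !expf_neq0.
exact/nested_itv/grid_side_gt0.
Qed.

Lemma cell_laminar N t (k k' : grid_idx N) :
  [\/ cell t k `<=` cell t k', cell t k' `<=` cell t k | cell t k `&` cell t k' = set0].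
Proof.
have [[x [h h']]|no] := pselect (cell t k `&` cell t k' !=set0); last first.
  by apply: Or33; apply/seteqP; split => // x hx; apply: no; exists x.
case: (leqP k.1 k'.1) => [kk|/ltnW kk].
  by apply: Or32; exact: cell_nested kk h h'.
by apply: Or31; exact: cell_nested kk h' h.
Qed.

Lemma measurable_cell N t (k : grid_idx N) : measurable (cell t k).
Proof. exact: measurable_hcube. Qed.

(* One-third trick: a short interval avoids the endpoints of one of two grids. *)
Lemma one_third N l (a r : R) : `|a| <= 2 ^+ N -> 0 < r -> 3 * r < grid_side N l ->
  exists (b : bool) (m : nat), [/\ (m < 9 * 2 ^ l)%N,
    grid_orig N b + grid_side N l * m%:R <= a &
    a + r < grid_orig N b + grid_side N l * m%:R + grid_side N l].
Proof.
move=> aN r0 r3; set e := grid_side N l.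
have e0 : 0 < e := grid_side_gt0 N l.
have eN : e * 2 ^+ l = 2 ^+ N by rewrite /e /grid_side divfK// expf_neq0.
have /andP[aN1 aN2] : - 2 ^+ N <= a <= 2 ^+ N by rewrite -ler_norml.
pose z := (a + 2 ^+ N) / e; have z0 : 0 <= z by rewrite divr_ge0 ?(ltW e0)//; lra.
have /andP[m1 m2] := truncn_itv z0; set m := Num.truncn z in m1 m2.
have {}m1 : e * m%:R <= a + 2 ^+ N by rewrite mulrC -ler_pdivlMr.
have {}m2 : a + 2 ^+ N < e * m%:R + e.
  by move: m2; rewrite ltr_pdivrMr// -[m.+1%:R]natr1 mulrDl mul1r mulrC.
have ml : (m <= 2 * 2 ^ l)%N.
  rewrite -(ler_nat R) natrM natrX -(ler_pM2l e0) mulrCA eN.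
  by apply: le_trans m1 _; lra.
have [h|h] := ltP (a + r) (- 2 ^+ N + e * m%:R + e).
  exists false, m; rewrite /grid_orig subr0; split => //; last by lra.
  by apply: leq_ltn_trans ml _; rewrite ltn_pmul2r// expn_gt0.
(* Here [a] is less than [r], hence less than a third of a step, away from the right end of its
   cell. The chosen cell of the shifted grid begins one or two thirds of a step before that end
   point; the index [m.+1 + c] compensates the [c] whole steps contained in the shift. *)
exists true, (m.+1 + 2 ^ l %/ 3)%N.
pose c := (2 ^ l %/ 3)%N; pose s := (2 ^ l %% 3)%N.
have cs : (2 ^ l)%N%:R = c%:R * 3 + s%:R :> R.
  by rewrite -natrM -natrD -divn_eq.
have s1 : 1 <= s%:R :> R.
  rewrite (ler_nat R 1) lt0n; apply/negP => /eqP s0.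
  have : (3 %| 2 ^ l)%N by apply/eqP.
  by rewrite Euclid_dvdX// => /andP[].
have s2 : s%:R <= 2 :> R by rewrite (ler_nat R _ 2) -ltnS ltn_pmod.
have eN3 : 2 ^+ N / 3 = e * c%:R + e * s%:R / 3.
  by rewrite -eN -natrX cs; field.
have es1 : e <= e * s%:R by rewrite ler_pMr.
have es2 : e * s%:R <= e * 2 by rewrite ler_pM2l.
have -> : e * (m.+1 + 2 ^ l %/ 3)%:R = e * m%:R + e + e * c%:R.
  by rewrite natrD -[m.+1%:R]natr1 -/c !mulrDr mulr1.
rewrite /grid_orig eN3; split.
- have u1 : (2 ^ l %/ 3 <= 2 ^ l)%N by exact: leq_div.
  have u2 : (0 < 2 ^ l)%N by rewrite expn_gt0.
  exact: index_bound ml u1 u2.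
- by move: h r3; rewrite -/e; lra.
- by move: h r3; rewrite -/e; lra.
Qed.

Lemma last_true (P : nat -> bool) M : P 0%N -> ~~ P M ->
  exists l, [/\ (l < M)%N, P l & ~~ P l.+1].
Proof.
elim: M => [->//|M IH P0 nM].
have [PM|nPM] := boolP (P M); first by exists M.
by have [l [lM Pl nPl]] := IH P0 nPM; exists l; rewrite (ltn_trans lM).
Qed.

(** The scale is the last one with [3 * r < side], so that [side <= 6 * r]. It exists once [2^N]
    exceeds [3 * r] and its inverse, and the grids reach the cube once [2^N] exceeds the coordinates
    of [a]. The one-third trick is applied on each axis separately, whence one bit of shift per
    axis. *)
Lemma cell_cover (a : E) (r : R) : 0 < r -> exists N0, forall N, (N0 <= N)%N ->
  exists t (k : grid_idx N), ccube a r `<=` cell t k /\ grid_side N k.1 <= 6 * r.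
Proof.
move=> r0.
pose B : R := \sum_i `|a ord0 i| + 3 * r + (3 * r)^-1.
have S0 : 0 <= \sum_i `|a ord0 i| by exact: sumr_ge0.
have V0 : 0 < (3 * r)^-1 by rewrite invr_gt0 mulr_gt0.
have B0 : 0 <= B by rewrite /B; move: (\sum_i _) S0 (_^-1) V0 => u u0 v v0; lra.
exists (Num.truncn B).+1 => N NB.
have BN : B < 2 ^+ N.
  have /andP[_ h] := truncn_itv B0; apply: (lt_le_trans h).
  rewrite -natrX ler_nat; apply: leq_trans NB _.
  exact/ltnW/ltn_expl.
pose P l := 3 * r < grid_side N l.
have P0 : P 0%N.
  rewrite /P /grid_side expr0 divr1; apply: le_lt_trans BN.
  by rewrite /B; move: (\sum_i _) S0 (_^-1) V0 => u u0 v v0; lra.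
have nP : ~~ P N.*2.
  rewrite /P -leNgt /grid_side -addnn exprD invfM mulrA divff ?expf_neq0// mul1r.
  rewrite -[leRHS]invrK lef_pV2 ?posrE ?exprn_gt0//.
  apply: le_trans (ltW BN).
  by rewrite /B; move: (\sum_i _) S0 (_^-1) V0 => u u0 v v0; lra.
have [l [lN Pl nPl]] := last_true P0 nP.
have aN i : `|a ord0 i| <= 2 ^+ N.
  apply: le_trans (ltW BN); rewrite /B (bigD1 i)//=.
  have : 0 <= \sum_(j < d | j != i) `|a ord0 j| by exact: sumr_ge0.
  by move: (\sum_(j < d | _) _) (_^-1) V0 => u v v0 u0; lra.
have H i : exists tm : bool * 'I_(9 * 4 ^ N),
    grid_orig N tm.1 + grid_side N l * (tm.2 : nat)%:R <= a ord0 i /\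
    a ord0 i + r < grid_orig N tm.1 + grid_side N l * (tm.2 : nat)%:R + grid_side N l.
  have [b [m [ml h1 h2]]] := one_third (aN i) r0 Pl.
  have mN : (m < 9 * 4 ^ N)%N.
    apply: leq_trans ml _; rewrite leq_pmul2l// (_ : 4 = 2 ^ 2)%N// -expnM mul2n.
    by rewrite leq_exp2l// ltnW.
  by exists (b, Ordinal mN).
have [tm tmP] := boolp.choice H.
have lN' : (l < N.*2.+1)%N by rewrite ltnW.
exists [ffun i => (tm i).1], (Ordinal lN', [ffun i => (tm i).2]); split.
  move=> x /ccubeP xa i; rewrite !mxE/= !ffunE; have [h1 h2] := tmP i.
  by have /andP[h3 h4] := xa i; rewrite (le_trans h1)//= (le_lt_trans h4).
move: nPl; rewrite /P -leNgt /grid_side/= exprS invfM.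
have : 0 < (2 ^+ l : R) by rewrite exprn_gt0.
by move: (2 ^+ N) => u v0; rewrite mulrCA; lra.
Qed.

End grids.

(** * The multilinear maximal function *)

Section limn_einf_bounds.
Local Open Scope ereal_scope.
Context {R : realType}.
Implicit Types (u : (\bar R)^nat) (c : \bar R).

Lemma limn_einf_supE u : limn_einf u = ereal_sup (range (einfs u)).
Proof.
rewrite limn_einf_lim; apply/cvg_lim => //.
exact/ereal_nondecreasing_cvgn/nondecreasing_einfs.
Qed.

Lemma limn_einf_ge u c N : (forall k, (N <= k)%N -> c <= u k) -> c <= limn_einf u.
Proof.
move=> cu; rewrite limn_einf_supE.
apply: (@le_trans _ _ (einfs u N)); last by apply: ereal_sup_ubound; exists N.
by apply: le_ereal_inf_tmp => _ [k /= Nk <-]; exact: cu.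
Qed.

Lemma limn_einf_le u c : (forall k, u k <= c) -> limn_einf u <= c.
Proof.
move=> uc; rewrite limn_einf_supE; apply: ge_ereal_sup => _ [k _ <-].
by apply: le_trans (uc k); apply: ereal_inf_lbound; exists k => /=.
Qed.

End limn_einf_bounds.

Section maximal_function.
Context {R : realType} {d n : nat}.
Local Notation E := 'rV[R]_d.
Local Notation mu := (leb R d).

(** The index from which [h N] dominates depends on the element of [S], hence the lower limit. If it
    is infinite nothing is to be proved; otherwise it gives a finite bound on all of [S], and the
    bound on [Psi] applies to the supremum. *)
Lemma sup_power_le (S : set (\bar R)) (h : nat -> R) (Psi : R -> R) (C q lam w : R) :
  S !=set0 ->
  (forall y, S y -> exists t : R, [/\ 0 <= t, y = t%:E &
     exists N0, forall N, (N0 <= N)%N -> t `^ q <= h N]) ->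
  0 < C -> 0 < q -> 0 < lam -> 0 < w ->
  (forall t, 0 <= t -> Psi t <= C * t `^ q) ->
  (er_map Psi (`|ereal_sup S| / lam%:E) * w%:E <=
   limn_einf (fun N => (C / lam `^ q * (h N * w))%:E))%E.
Proof.
move=> S0 SP C0 q0 lam0 w0 PsiC; set L := limn_einf _.
have c0 : 0 < C / lam `^ q * w by rewrite mulr_gt0// divr_gt0// powR_gt0.
have SL t : 0 <= t -> (exists N0, forall N, (N0 <= N)%N -> t `^ q <= h N) ->
    ((C / lam `^ q * w * t `^ q)%:E <= L)%E.
  move=> t0 [N0 tN]; apply: (limn_einf_ge (N := N0)) => N /tN tq; rewrite lee_fin.
  by rewrite -mulrA ler_pM2l ?divr_gt0 ?powR_gt0// mulrC ler_pM2r.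
have [y0 Sy0] := S0; have [t0 [t00 y0E /(SL _ t00) L0]] := SP _ Sy0.
have {}L0 : (0 <= L)%E.
  by apply: le_trans L0; rewrite lee_fin mulr_ge0 ?powR_ge0 ?(ltW c0).
case: L L0 SL => [l l0 SL|_ _|//]; last by rewrite leey.
pose b := (l / (C / lam `^ q * w)) `^ q^-1.
have Sb : (ereal_sup S <= b%:E)%E.
  apply: ge_ereal_sup => y /SP[t [tt -> /(SL _ tt)]]; rewrite !lee_fin => tl.
  rewrite -[leLHS](powRrK tt (lt0r_neq0 q0)) /b ler_powRl ?invr_ge0 ?powR_ge0 ?(ltW q0)//.
  by rewrite ler_pdivlMr// mulrC.
have Spos : (0 <= ereal_sup S)%E.
  by apply: (@le_trans _ _ y0); [rewrite y0E lee_fin|exact: ereal_sup_ubound].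
move: Sb Spos; case: (ereal_sup S) => [m|//|//]; rewrite !lee_fin => mb m0.
rewrite abse_EFin ger0_norm// inver gt_eqF//= -EFinM lee_fin.
apply: (@le_trans _ _ (C * (m / lam) `^ q * w)).
  by rewrite ler_pM2r// PsiC// divr_ge0// ltW.
rewrite powRM ?invr_ge0 ?(ltW lam0)// -powR_inv1 ?(ltW lam0)// -powRrM mulN1r powRN.
have -> : C * (m `^ q * (lam `^ q)^-1) * w = C / lam `^ q * w * m `^ q by ring.
rewrite -ler_pdivlMl// mulrC.
have lc0 : 0 <= l / (C / lam `^ q * w).
  by rewrite divr_ge0 ?(ltW c0)//; move: l0; rewrite lee_fin.
rewrite -(powRVK lc0 (lt0r_neq0 q0)).
by apply: ler_powRl => //; exact: ltW.
Qed.

Variables (alpha q : R) (w : E -> R) (s g : 'I_n -> E -> R) (f : 'I_n -> E -> R[i]).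
Hypothesis n_gt0 : (0 < n)%N.
Hypothesis d_gt0 : (0 < d)%N.
Hypothesis alpha_lt : alpha < n%:R * d%:R.
Hypothesis q_gt0 : 0 < q.
Hypothesis mw : measurable_fun setT w.
Hypothesis w_gt0 : forall x, 0 < w x.
Hypothesis gs0 : forall m x, 0 <= g m x * s m x.
Hypothesis mgs : forall m, measurable_fun setT (fun x => g m x * s m x).
Hypothesis gsf : forall m a l, 0 < l ->
  (\int[mu]_(x in ccube a l) (g m x * s m x)%:E < +oo)%E.
Hypothesis fE : forall m, {ae mu, forall x, modulus (f m) x = (g m x * s m x)%:E}.

Definition beta_exp : R := n%:R - alpha / d%:R.

Lemma beta_exp_gt0 : 0 < beta_exp.
Proof. by rewrite subr_gt0 ltr_pdivrMr// ltr0n. Qed.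

Definition LamN N (t : {ffun 'I_d -> bool}) : grid_idx N -> R :=
  Lam mu (@cell R d N t) s g beta_exp.

(** Summing over the [2^d] shifted grids avoids choosing one, since the right grid depends on the
    cube. *)
Definition HN N x : R :=
  \sum_(t : {ffun 'I_d -> bool}) cubemax (@cell R d N t) predT (LamN t) x `^ q.

(** A cell covering a cube has side at most 6 times larger, hence a volume at most [6^d] times
    larger. *)
Definition cover_const : R := (6 ^+ d) `^ beta_exp.

Lemma cvol_cell N t (k : grid_idx N) :
  cvol mu (@cell R d N t) k = grid_side N k.1 ^+ d.
Proof.
have H := leb_hcube (@corner R d N t k) (ltW (grid_side_gt0 N k.1)).
exact: (congr1 fine H).
Qed.

(** When [x] is in the cube, the term is the [Lam] of the closed cube. Enlarging the cube to a grid
    cell increases the integrals and costs [cover_const] in the power of the volume. *)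
Lemma cube_term_le a l x : 0 < l -> exists t : R, [/\ 0 <= t,
  (((vol (ccube a l) `^ (alpha / d%:R))%:E *
    \prod_(m < n) ((\1_(ccube a l) x)%:E / (vol (ccube a l))%:E *
      \int[mu]_(y in ccube a l) modulus (f m) y))%E = t%:E) &
  exists N0, forall N, (N0 <= N)%N -> t `^ q <= cover_const `^ q * HN N x].
Proof.
move=> l0; set Q := ccube a l.
have HN0 N : 0 <= HN N x by apply: sumr_ge0 => t _; exact: powR_ge0.
have cc0 : 0 <= cover_const by exact: powR_ge0.
have volE : vol Q = l ^+ d by rewrite /vol leb_ccube// ltW.
have V0 : 0 < l ^+ d by rewrite exprn_gt0.
rewrite volE inver (gt_eqF V0).
pose u m := fine (\int[mu]_(y in Q) (g m y * s m y)%:E)%E.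
have u0 m : 0 <= u m by exact: ge0_fine_integral.
have uE m : (\int[mu]_(y in Q) modulus (f m) y)%E = (u m)%:E.
  rewrite -integral_ge0_lty_fine//; last exact: gsf.
  by apply: ae_eq_integral_nm; apply: filterS (fE m) => y ->.
have [xQ|nxQ] := pselect (Q x); last first.
  exists 0; split => //.
    rewrite (bigD1 (Ordinal n_gt0))//= indicE memNset// mul0e mul0e mul0e mule0//.
  by exists 0%N => N _; rewrite powR0 ?gt_eqF// mulr_ge0 ?powR_ge0.
exists ((l ^+ d) `^ (- beta_exp) * \prod_m u m); split.
- by rewrite mulr_ge0 ?powR_ge0// prodr_ge0.
- rewrite (eq_bigr (fun m => ((l ^+ d)^-1 * u m)%:E)) => [|m _]; last first.
    by rewrite uE indicE mem_set// mul1e -EFinM.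
  rewrite prodEFin -EFinM; congr EFin; rewrite big_split/= mulrA; congr (_ * _).
  rewrite prodr_const card_ord -(powR_inv1 (ltW V0)).
  rewrite -(powR_mulrn n (powR_ge0 (l ^+ d) (-1))).
  rewrite -powRrM -powRD; last by rewrite (gt_eqF V0) implybT.
  by congr (_ `^ _); rewrite /beta_exp mulN1r opprB addrC.
have [N0 cov] := cell_cover a l0; exists N0 => N /cov[t [k [Qk side]]].
have LQ : (l ^+ d) `^ (- beta_exp) * \prod_m u m <= cover_const * LamN t k.
  rewrite /LamN /Lam cvol_cell mulrA; apply: ler_pM => //.
  - exact: powR_ge0.
  - exact: prodr_ge0.
  - have S0 : 0 < (grid_side N k.1 : R) ^+ d by rewrite exprn_gt0// grid_side_gt0.
    rewrite /cover_const !powRN ler_pdivlMr ?powR_gt0//.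
    rewrite ler_pdivrMl ?powR_gt0// -(powRM _ (ltW V0) (exprn_ge0 d _))// -exprMn.
    apply: ler_powRl; [exact: ltW beta_exp_gt0|exact: ltW|].
    by rewrite mulrC lerXn2r// nnegrE ?mulr_ge0 ?(ltW l0)// ltW// grid_side_gt0.
  - apply: ler_prod => m _; rewrite u0/= /cint.
    have side0 : 0 <= (grid_side N k.1 : R) by rewrite ltW// grid_side_gt0.
    apply: fine_le.
    + rewrite ge0_fin_numE; first exact: gsf.
      by apply: integral_ge0 => y _; rewrite lee_fin.
    + rewrite ge0_fin_numE; last by apply: integral_ge0 => y _; rewrite lee_fin.
      by rewrite /cell integral_hcube// gsf// grid_side_gt0.
    apply: ge0_subset_integral => //; [exact: measurable_ccube|exact: measurable_cell| |].
      by apply/measurable_EFinP/measurable_funTS.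
    by move=> y _; rewrite lee_fin.
apply: (@le_trans _ _ ((cover_const * LamN t k) `^ q)).
  by apply: ler_powRl => //; [exact: ltW|rewrite mulr_ge0 ?powR_ge0// prodr_ge0].
have L0 j : 0 <= LamN t j.
  by rewrite mulr_ge0 ?powR_ge0// prodr_ge0// => m _; exact: ge0_fine_integral.
rewrite powRM// ler_wpM2l ?powR_ge0// /HN (bigD1 t)//=.
rewrite -[leLHS]addr0 lerD//; last by apply: sumr_ge0 => j _; exact: powR_ge0.
apply: ler_powRl => //; first exact: ltW.
apply: (le_bigmax_cond _ (LamN t) (j := k)); rewrite /=.
by apply/asboolP; exact: Qk.
Qed.

Lemma measurable_cubemaxN N t : measurable_fun setT
  (cubemax (@cell R d N t) predT (LamN t)).
Proof.
rewrite (_ : cubemax _ _ _ = fun x => maxQ (cubeQ (@cell R d N t)) (LamN t)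
  (code (@cell R d N t) x)); last by apply/funext => x; rewrite cubemax_code.
apply: measurable_code => k; exact: measurable_cell.
Qed.

Lemma integral_Malpha (C lam D : R) (Psi : R -> R) : 0 < C -> 0 < lam -> 0 <= D ->
  (forall t, 0 <= t -> Psi t <= C * t `^ q) ->
  (forall N t, \int[mu]_x
     (cubemax (@cell R d N t) predT (LamN t) x `^ q * w x)%:E <= D%:E)%E ->
  (\int[mu]_x (er_map Psi (`|Malpha alpha f x| / lam%:E) * (w x)%:E) <=
   (C * cover_const `^ q * (#|{ffun 'I_d -> bool}|%:R * D) / lam `^ q)%:E)%E.
Proof.
move=> C0 lam0 D0 PsiC HD; set K := C / lam `^ q.
have K0 : 0 < K by rewrite divr_gt0// powR_gt0.
pose h N x := cover_const `^ q * HN N x.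
have HN0 N x : 0 <= HN N x by apply: sumr_ge0 => t _; exact: powR_ge0.
have mcm N t : measurable_fun setT
    (fun x => cubemax (@cell R d N t) predT (LamN t) x `^ q).
  apply: (measurableT_comp (measurable_powR q)); exact: measurable_cubemaxN.
have mHN N : measurable_fun setT (HN N) by exact: measurable_sum.
pose G N x := (K * (h N x * w x))%:E.
apply: (@le_trans _ _ (\int[mu]_x limn_einf (G ^~ x))%E).
  apply: ae_le_integral_nm; apply: aeW => x _; apply: sup_power_le => //.
    eexists; exists (@ccube R d 0 1); last by reflexivity.
    exact: cubes_ccube.
  by move=> _ [_ [a [l [l0 ->]]] <-]; exact: cube_term_le.
have mG N : measurable_fun setT (G N).
  apply/measurable_EFinP; apply: measurable_funM => //.
  by apply: measurable_funM => //; exact: measurable_funM.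
have G0 N x : (0 <= G N x)%E.
  by rewrite lee_fin mulr_ge0 ?(ltW K0)// mulr_ge0 ?(ltW (w_gt0 _))// mulr_ge0// powR_ge0.
apply: le_trans (fatou mu measurableT mG (fun N x _ => G0 N x)) _.
apply: limn_einf_le => N.
have -> : (C * cover_const `^ q * (#|{ffun 'I_d -> bool}|%:R * D) / lam `^ q) =
  K * cover_const `^ q * (#|{ffun 'I_d -> bool}|%:R * D) by rewrite /K; ring.
have -> : G N = fun x => ((K * cover_const `^ q) *
    \sum_(t : {ffun 'I_d -> bool})
      (cubemax (@cell R d N t) predT (LamN t) x `^ q * w x))%:E.
  by apply/funext => x; rewrite /G /h /HN -mulr_suml !mulrA.
have w0 x : 0 <= w x by exact: ltW.
rewrite integral_scale//; last 3 first.
- by rewrite mulr_ge0 ?(ltW K0)// powR_ge0.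
- by apply: measurable_sum => t; exact: measurable_funM.
- by move=> x; apply: sumr_ge0 => t _; rewrite mulr_ge0 ?powR_ge0.
rewrite [leRHS]EFinM; apply: lee_wpmul2l; first by rewrite lee_fin mulr_ge0 ?(ltW K0)// powR_ge0.
under eq_integral do rewrite -sumEFin.
rewrite ge0_integral_sum//; last 2 first.
- by move=> t; apply/measurable_EFinP; exact: measurable_funM.
- by move=> t x _; rewrite lee_fin mulr_ge0 ?powR_ge0.
apply: (@le_trans _ _ (\sum_(t : {ffun 'I_d -> bool}) D%:E)%E).
  by apply: lee_sum => t _; exact: HD.
by rewrite sumEFin sumr_const -[D *+ _]mulr_natl.
Qed.

End maximal_function.

(** * Growth functions comparable to powers *)

Section power_like.
Context {R : realType}.
Implicit Types (f Phi Psi : R -> R) (p q : R).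

Lemma powR_invl t p : 0 <= t -> t^-1 `^ p = (t `^ p)^-1.
Proof. by move=> t0; rewrite -(powR_inv1 t0) -powRrM mulN1r powRN. Qed.

Definition power_like f p := exists c C, [/\ 0 < c, 0 < C &
  forall t, 0 <= t -> c * t `^ p <= f t <= C * t `^ p].

(* The condition [Delta'] turns the two upper bounds defining the class into a
   lower bound, so that the class only contains functions comparable to powers. *)
Lemma classUt_power_like q Phi : classUt_ q Phi -> power_like Phi q.
Proof.
move=> [[q1 [Phi0 _ _ mono surj] [C1 C10 up] _] [C2 C20 D'] [C3 C30 low]].
have q0 : 0 < q by lra.
have Phi00 : Phi 0 = 0.
  have [t /= t0 tE] := surj 0 (lexx 0); apply/eqP; rewrite eq_le Phi0// andbT.
  by rewrite -[leRHS]tE mono.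
pose C := C1 * Phi 1 + C3 * Phi 1.
have F1 : 0 <= Phi 1 by exact: Phi0.
have upper t : 0 < t -> Phi t <= C * t `^ q.
  move=> t0; have tq0 : 0 <= t `^ q by exact: powR_ge0.
  have [t1|t1] := leP 1 t.
    have := up 1 t ltr01 t1; rewrite mul1r => /le_trans; apply.
    rewrite /C mulrDl mulrAC lerDl.
    by rewrite !mulr_ge0// ltW.
  have V1 : 1 <= t^-1 by rewrite invf_ge1// ltW.
  have := low 1 t^-1 (lexx 1) V1; rewrite invrK mul1r => /le_trans; apply.
  rewrite (powR_invl _ (ltW t0)) invrK mulrA.
  by rewrite ler_wpM2r// /C lerDr mulr_ge0// ltW.
have F1p : 0 < Phi 1.
  rewrite lt_neqAle F1 andbT; apply/eqP => e.
  have [t /= t0 tE] := surj 1 ler01.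
  have [te|te] := eqVneq t 0.
    by move: tE; rewrite te Phi00 => /eqP; rewrite eq_sym oner_eq0.
  have := upper t; rewrite lt_neqAle eq_sym te t0 => /(_ isT).
  by rewrite tE /C -e !mulr0 addr0 mul0r leNgt ltr01.
have Cp : 0 < C by rewrite /C addr_gt0// mulr_gt0.
exists (Phi 1 / (C2 * C)), C; split => //; first by rewrite divr_gt0// mulr_gt0.
move=> t; rewrite le_eqVlt => /predU1P[<-|t0].
  by rewrite Phi00 powR0 ?gt_eqF// !mulr0 lexx.
rewrite upper// andbT.
have tq0 : 0 < t `^ q by exact: powR_gt0.
have tV : 0 < t^-1 by rewrite invr_gt0.
have := D' t t^-1 t0 tV; rewrite divff ?gt_eqF// => h.
have h2 := upper _ tV.
rewrite (powR_invl _ (ltW t0)) in h2.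
rewrite mulrAC ler_pdivrMr ?mulr_gt0// -ler_pdivlMr//.
apply: le_trans h _.
have -> : Phi t * (C2 * C) / t `^ q = C2 * Phi t * (C / t `^ q) by ring.
by rewrite ler_wpM2l// mulr_ge0 ?(ltW C20)// Phi0// ltW.
Qed.

Lemma ginvK Phi y : set_surj (@Rplus R) (@Rplus R) Phi -> 0 <= y ->
  0 <= ginv Phi y /\ Phi (ginv Phi y) = y.
Proof.
move=> surj y0; split.
  by apply: (@surjpinv_image_sub _ _ (fun=> 0) (@Rplus R) (@Rplus R) Phi surj);
    exists y.
by rewrite /ginv (surjpK (fun=> 0) surj)// inE.
Qed.

Lemma ginv_power_like Phi p : 0 < p -> set_surj (@Rplus R) (@Rplus R) Phi ->
  power_like Phi p -> power_like (ginv Phi) p^-1.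
Proof.
move=> p0 surj [c [C [c0 C0 H]]].
have pV : 0 <= p^-1 by rewrite invr_ge0 ltW.
exists (C `^ (- p^-1)), (c `^ (- p^-1)); split; try exact: powR_gt0.
move=> y y0; have [g0 gE] := ginvK surj y0.
have /andP[h1 h2] := H _ g0; rewrite gE in h1 h2.
have K := powRrK g0 (lt0r_neq0 p0).
have V k : 0 < k -> k `^ (- p^-1) * y `^ p^-1 = (y / k) `^ p^-1.
  by move=> k0; rewrite powRM ?invr_ge0 ?(ltW k0)// mulrC (powR_invl _ (ltW k0)) powRN.
rewrite !V// -K; apply/andP; split; apply: ler_powRl => //.
- by rewrite divr_ge0// ltW.
- by rewrite ler_pdivrMr// mulrC.
- exact: powR_ge0.
- by rewrite ler_pdivlMr// mulrC.
Qed.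

Lemma power_like_prod (n : nat) (f : 'I_n -> R -> R) (p : 'I_n -> R) :
  (forall i, power_like (f i) (p i)) -> 0 < \sum_i p i -> (forall i, 0 < p i) ->
  power_like (fun t => \prod_i f i t) (\sum_i p i).
Proof.
move=> H s0 p0; have [c Hc] := boolp.choice H; have [C HC] := boolp.choice Hc.
have c0 i : 0 < c i by case: (HC i).
have C0 i : 0 < C i by case: (HC i).
exists (\prod_i c i), (\prod_i C i); split; try exact: prodr_gt0.
move=> t t0.
have E : t `^ (\sum_i p i) = \prod_i t `^ p i.
  move: t0; rewrite le_eqVlt => /predU1P[<-|t0]; last by rewrite powR_sum_exp.
  rewrite powR0 ?gt_eqF//; case: n f p H s0 p0 c Hc C HC c0 C0 => [|n] f p H s0 p0 *.
    by move: s0; rewrite big_ord0 ltxx.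
  by rewrite big_ord_recl powR0 ?mul0r// gt_eqF.
rewrite E -!big_split/=; apply/andP; split; apply: ler_prod => i _;
  have [_ _ /(_ t t0)/andP[h1 h2]] := HC i.
  by rewrite h1 mulr_ge0 ?powR_ge0// ltW.
by rewrite h2 andbT (le_trans _ h1)// mulr_ge0 ?powR_ge0// ltW.
Qed.

(** This recovers the growth of a function known only through its inverse, as [Phi0] is; by
    injectivity [ginv] is a left inverse too, so the bounds can be solved back. *)
Lemma ginv_bij_power_like Phi p : 0 < p -> set_bij (@Rplus R) (@Rplus R) Phi ->
  power_like (ginv Phi) p^-1 -> power_like Phi p.
Proof.
move=> p0 [fun_ inj surj] [c [C [c0 C0 H]]].
exists (C `^ (- p)), (c `^ (- p)); split; try exact: powR_gt0.
move=> t t0; have P0 : 0 <= Phi t by apply: fun_.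
have gE : ginv Phi (Phi t) = t.
  have [g0 gE] := ginvK surj P0.
  by apply: inj gE; rewrite inE.
have /andP[h1 h2] := H _ P0; rewrite gE in h1 h2.
have K := powRVK P0 (lt0r_neq0 p0).
have V k : 0 < k -> k `^ (- p) * t `^ p = (t / k) `^ p.
  by move=> k0; rewrite powRM ?invr_ge0 ?(ltW k0)// mulrC (powR_invl _ (ltW k0)) powRN.
rewrite !V// -{1 2}K; apply/andP; split; apply: ler_powRl; rewrite ?(ltW p0)//.
- by rewrite divr_ge0// ltW.
- by rewrite ler_pdivrMr// mulrC.
- exact: powR_ge0.
- by rewrite ler_pdivlMr// mulrC.
Qed.

(** If [q < p], the quotient [Psi t / Phi t] is at most a multiple of [t^(q - p)] and tends to 0 at
    infinity, although it stays above its positive value at 1. *)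
Lemma ratio_exponents Phi Psi p q : power_like Phi p -> power_like Psi q ->
  (forall t u, 0 < t -> t <= u -> Psi t / Phi t <= Psi u / Phi u) -> p <= q.
Proof.
move=> [c [C [c0 C0 H]]] [c' [C' [c'0 C'0 H']]] mono.
rewrite leNgt; apply/negP => qp.
have pq0 : 0 < p - q by rewrite subr_gt0.
have Phi_gt0 t : 0 < t -> 0 < Phi t.
  move=> t0; have /andP[h _] := H _ (ltW t0); apply: lt_le_trans h.
  by rewrite mulr_gt0// powR_gt0.
have Psi1 : 0 < Psi 1.
  have /andP[h _] := H' 1 ler01; apply: lt_le_trans h.
  by rewrite mulr_gt0// powR_gt0.
pose k := Psi 1 / Phi 1; have k0 : 0 < k by rewrite divr_gt0// Phi_gt0.
have B t : 1 <= t -> k * c * t `^ (p - q) <= C'.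
  move=> t1; have t0 : 0 < t by lra.
  have h := mono 1 t ltr01 t1; rewrite -/k in h.
  rewrite ler_pdivlMr ?Phi_gt0// in h.
  have /andP[h1 _] := H _ (ltW t0); have /andP[_ h2] := H' _ (ltW t0).
  rewrite -(ler_pM2r (powR_gt0 q t0)) -(mulrA (k * c)) -powRD; last by rewrite (gt_eqF t0) implybT.
  rewrite subrK -mulrA; apply: le_trans h2; apply: le_trans h.
  by rewrite ler_wpM2l// ltW.
(* At this point [k * c * t ^ (p - q)] equals [C' + k * c], which exceeds the bound [C']. *)
pose t := ((C' + k * c) / (k * c)) `^ (p - q)^-1.
have kc : 0 < k * c by rewrite mulr_gt0.
have b1 : 1 <= (C' + k * c) / (k * c).
  by rewrite ler_pdivlMr// mul1r lerDr ltW.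
have t1 : 1 <= t.
  have : 1 `^ (p - q)^-1 <= t by apply: ler_powRl => //; rewrite invr_ge0 ltW.
  by rewrite powR1.
have := B t t1; rewrite powRVK ?gt_eqF//; last exact: le_trans ler01 b1.
rewrite mulrCA divff ?gt_eqF// mulr1; lra.
Qed.

(** Divergence of the integral of 1/s at 0: each of the intervals ]t/2, t], ]t/4, t/2], ...
    contributes at least [c / 2]. *)
Lemma integral_inv_ge (c : R) (N : nat) (t : R) : 0 < c -> 0 < t ->
  ((c / 2 * N%:R)%:E <=
   \int[lebesgue_measure]_(s in `]0%R, t]) (c * s `^ (-1))%:E)%E.
Proof.
move=> c0; elim: N t => [|N IH] t t0.
  rewrite mulr0; apply: integral_ge0 => s /=; rewrite in_itv/= => /andP[s0 _].
  by rewrite lee_fin mulr_ge0 ?powR_ge0 ?ltW.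
have t20 : 0 < t / 2 by lra.
have mV : measurable_fun setT (fun s : R => (c * s `^ (-1))%:E).
  by apply/measurable_EFinP; apply: measurable_funM => //; exact: measurable_powR.
rewrite (_ : `]0%R, t]%classic = `]0%R, t / 2]%classic `|` `]t / 2, t]%classic); last first.
  apply/seteqP; split => s /=; rewrite !in_itv/=.
    move=> /andP[s0 st]; have [h|h] := leP s (t / 2); first by left; rewrite s0.
    by right.
  by move=> [|] /andP[h1 h2]; apply/andP; split; lra.
rewrite ge0_integral_setU//=; last 3 first.
- exact: measurable_funTS.
- move=> s [|] /=; rewrite in_itv/= => /andP[h _]; by rewrite lee_fin mulr_ge0 ?powR_ge0 ?(ltW c0).
- apply/disj_setPS => s [/=]; rewrite !in_itv/= => /andP[_ h1] /andP[h2 _]; lra.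
rewrite -[N.+1%:R]natr1 mulrDr mulr1 EFinD; apply: leeD; first exact: IH.
apply: (@le_trans _ _ (\int[lebesgue_measure]_(s in `](t / 2)%R, t]) (cst (c / t)%:E s))%E).
  rewrite integral_cst//= lebesgue_measure_itv/= lte_fin ifT; last by lra.
  rewrite -EFinB -EFinM lee_fin le_eqVlt; apply/orP; left; apply/eqP.
  by field; rewrite gt_eqF.
apply: ge0_le_integral_nm => s /=; rewrite in_itv/= => /andP[h1 h2].
  by rewrite lee_fin divr_ge0 ?ltW.
have s0 : 0 < s by lra.
by rewrite (powR_inv1 (ltW s0)) lee_fin ler_pM2l// lef_pV2.
Qed.

(** For [p = 1] the integrand [Phi s / s ^ 2] is at least [c / s], whose integral diverges at 0,
    against the finite bound at [t = 1]. *)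
Lemma nabla2_exponent Phi p : 1 <= p -> power_like Phi p -> nabla2 Phi -> 1 < p.
Proof.
rewrite le_eqVlt => /predU1P[<-|//] [c [C [c0 C0 H]]] [_ _ _ [K K0 /(_ 1 ltr01)]].
rewrite divr1 => h; exfalso.
have L N : c / 2 * N%:R <= K * Phi 1.
  rewrite -lee_fin; apply: le_trans h; apply: le_trans (integral_inv_ge N c0 ltr01) _.
  apply: ge0_le_integral_nm => s /=; rewrite in_itv/= => /andP[s0 _].
    by rewrite lee_fin mulr_ge0 ?powR_ge0 ?ltW.
  have /andP[hs _] := H s (ltW s0); rewrite powRr1 ?(ltW s0)// in hs.
  rewrite (powR_inv1 (ltW s0)) lee_fin ler_pdivlMr ?exprn_gt0//.
  by rewrite expr2 mulrA divfK ?gt_eqF.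
have KP : 0 <= K * Phi 1 by have := L 0%N; rewrite mulr0.
have c20 : 0 < c / 2 by lra.
have /andP[_ ] := truncn_itv (divr_ge0 KP (ltW c20)).
by rewrite ltNge ler_pdivlMr// mulrC L.
Qed.

(** * Complementary functions of power-like functions *)

Section complementary_function.
Variables (Phi : R -> R) (p c C : R).
Hypothesis p1 : 1 < p.
Hypothesis c0 : 0 < c.
Hypothesis C0 : 0 < C.
Hypothesis H : forall t, 0 <= t -> c * t `^ p <= Phi t <= C * t `^ p.

Let p0 : 0 < p. Proof. exact: lt_trans ltr01 p1. Qed.
Let r0 : 0 < p - 1. Proof. by rewrite subr_gt0. Qed.
Let rV0 : 0 <= (p - 1)^-1. Proof. by rewrite invr_ge0 ltW. Qed.
(** From [thr s] on, [c * t ^ p] is at least [s * t], so values of [t] beyond it cannot improve on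
    [t = 0] in the supremum defining the complementary function. *)
Let thr s := (s / c) `^ (p - 1)^-1.

Lemma compl_large s t : 0 <= s -> 0 <= t -> thr s <= t -> s * t - Phi t <= 0.
Proof.
move=> s0 t0 h; have /andP[h1 _] := H t0; rewrite subr_le0; apply: le_trans h1.
rewrite -(@mulr_powRB1 _ t p)// [t * _]mulrC mulrA ler_wpM2r//.
rewrite mulrC -ler_pdivrMr//.
rewrite -(@powRVK _ (s / c) (p - 1)) ?gt_eqF ?divr_ge0 ?(ltW c0)//.
by apply: ler_powRl => //; [exact: ltW|exact: powR_ge0].
Qed.

Lemma compl_le s t : 0 <= s -> 0 <= t -> s * t - Phi t <= s * thr s.
Proof.
move=> s0 t0; have st0 : 0 <= s * thr s by rewrite mulr_ge0 ?powR_ge0.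
have [h|h] := leP (thr s) t; first exact: le_trans (compl_large s0 t0 h) _.
have /andP[h1 _] := H t0.
have : s * t <= s * thr s by rewrite ler_wpM2l// ltW.
have : 0 <= c * t `^ p by rewrite mulr_ge0 ?powR_ge0// ltW.
by lra.
Qed.

Lemma compl_has_sup s : 0 <= s -> has_sup [set s * t - Phi t | t in @Rplus R].
Proof.
move=> s0; split; first by exists (s * 0 - Phi 0); exists 0 => //; exact: lexx.
by exists (s * thr s) => _ [t /= t0 <-]; exact: compl_le.
Qed.

Lemma compl_ub s t : 0 <= s -> 0 <= t -> s * t - Phi t <= complementary Phi s.
Proof.
by move=> s0 t0; apply: (sup_upper_bound (compl_has_sup s0)); exists t.
Qed.

Lemma compl_lub s b : 0 <= s -> (forall t, 0 <= t -> s * t - Phi t <= b) ->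
  complementary Phi s <= b.
Proof.
move=> s0 h; apply: ge_sup; first by case: (compl_has_sup s0).
by move=> _ [t /= t0 <-]; exact: h.
Qed.

Lemma Phi_zero : Phi 0 = 0.
Proof.
by have := H (lexx 0); rewrite powR0 ?gt_eqF// !mulr0 => h; apply/le_anti; rewrite andbC.
Qed.

Lemma compl_ge0 s : 0 <= s -> 0 <= complementary Phi s.
Proof. by move=> s0; have := compl_ub s0 (lexx 0); rewrite mulr0 Phi_zero subr0. Qed.

Lemma conjugate_exponent_ge0 s : 0 <= s ->
  s * s `^ (p - 1)^-1 = s `^ (p / (p - 1)).
Proof.
have -> : p / (p - 1) = 1 + (p - 1)^-1 by field; rewrite gt_eqF.
rewrite le_eqVlt => /predU1P[<-|s0].
  by rewrite mul0r powR0// gt_eqF// addr_gt0// invr_gt0.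
by rewrite powRD ?(gt_eqF s0) ?implybT// powRr1// ltW.
Qed.

Lemma complementary_power_like : power_like (complementary Phi) (p / (p - 1)).
Proof.
exists (2^-1 * (2 * C)^-1 `^ (p - 1)^-1), (c^-1 `^ (p - 1)^-1).
have C20 : 0 < 2 * C by rewrite mulr_gt0.
split; [by rewrite mulr_gt0// powR_gt0// invr_gt0|by rewrite powR_gt0// invr_gt0|].
move=> s s0; rewrite -conjugate_exponent_ge0//; apply/andP; split.
  (* The choice of [t] makes [C * t ^ p] equal to [s * t / 2]. *)
  pose t := (s / (2 * C)) `^ (p - 1)^-1; have t0 : 0 <= t by exact: powR_ge0.
  apply: le_trans (compl_ub s0 t0); have /andP[_ h] := H t0.
  have tp : t `^ p = t * (s / (2 * C)).
    rewrite -(@mulr_powRB1 _ t p)// powRVK ?gt_eqF//.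
    by rewrite divr_ge0// ltW.
  have tE : t = (2 * C)^-1 `^ (p - 1)^-1 * s `^ (p - 1)^-1.
    by rewrite /t mulrC powRM// invr_ge0 ltW.
  have -> : 2^-1 * (2 * C)^-1 `^ (p - 1)^-1 * (s * s `^ (p - 1)^-1) = s * t / 2.
    by rewrite tE; field.
  have : C * t `^ p = s * t / 2 by rewrite tp; field; rewrite gt_eqF.
  by move: h; lra.
apply: compl_lub => // t t0; apply: le_trans (compl_le s0 t0) _.
rewrite /thr powRM ?invr_ge0 ?(ltW c0)// le_eqVlt; apply/orP; left; apply/eqP; ring.
Qed.

(** On [0, b] only [t <= thr b] matter in the supremum, and there the affine functions of [s] have
    slope at most [thr b]. This supplies the continuity for the intermediate value theorem in
    [complementary_surj]. *)
Lemma compl_lipschitz b s s' : 0 <= s -> s <= s' -> s' <= b ->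
  complementary Phi s <= complementary Phi s' <=
  complementary Phi s + thr b * (s' - s).
Proof.
move=> s0 ss sb; have s'0 : 0 <= s' by lra.
have thr0 : 0 <= thr b by exact: powR_ge0.
apply/andP; split; apply: compl_lub => // t t0.
  apply: le_trans (compl_ub s'0 t0); rewrite lerD2r ler_wpM2r//.
have d0 : 0 <= s' - s by rewrite subr_ge0.
have [h|h] := leP (thr b) t.
  have h' : thr s' <= t.
    apply: le_trans h; apply: ler_powRl => //; first by rewrite divr_ge0 ?(ltW c0).
    by rewrite ler_pM2r// invr_gt0.
  apply: le_trans (compl_large s'0 t0 h') _.
  by rewrite addr_ge0 ?compl_ge0// mulr_ge0.
have -> : s' * t - Phi t = (s * t - Phi t) + t * (s' - s) by ring.
by rewrite lerD ?compl_ub// ler_wpM2r// ltW.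
Qed.

Lemma complementary_surj : set_surj (@Rplus R) (@Rplus R) (complementary Phi).
Proof.
move=> y /= y0; rewrite /Rplus/= in y0.
have [c' [C' [c'0 C'0 H']]] := complementary_power_like.
have q0 : 0 < p / (p - 1) by rewrite divr_gt0.
(* The point where the lower power bound of the complementary function equals [y]. *)
pose b := (y / c') `^ (p / (p - 1))^-1; have b0 : 0 <= b by exact: powR_ge0.
have yb : y <= complementary Phi b.
  have /andP[h _] := H' _ b0; apply: le_trans h.
  by rewrite powRVK ?gt_eqF// ?divr_ge0 ?(ltW c'0)// mulrC divfK ?gt_eqF.
have z0 : complementary Phi 0 = 0.
  have := H' _ (lexx 0); rewrite powR0 ?gt_eqF// !mulr0 => h.
  by apply/le_anti; rewrite andbC.
(* Clamping the argument to [0, b] gives a function that is Lipschitz, hence continuous, on the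
   whole line. *)
pose cl (s : R) := Num.min (Num.max s 0) b.
have cl_itv s : 0 <= cl s <= b.
  by rewrite /cl ge_min lexx orbT andbT le_min le_max lexx orbT b0.
have cl_mono s s' : s <= s' -> cl s <= cl s'.
  by move=> ss; rewrite /cl le_min2// ge_max !le_max ss lexx orbT.
have cl_lip s s' : s <= s' -> cl s' - cl s <= s' - s.
  move=> ss; rewrite /cl.
  have A : Num.max s 0 <= Num.max s' 0 <= Num.max s 0 + (s' - s).
    by case: (leP s 0) => h1; case: (leP s' 0) => h2; apply/andP; split; lra.
  move: (Num.max s 0) (Num.max s' 0) A => u v /andP[h1 h2].
  by case: (leP u b) => h3; case: (leP v b) => h4; lra.
have T0 : 0 <= thr b by exact: powR_ge0.
have lip s s' : `|complementary Phi (cl s) - complementary Phi (cl s')| <=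
    thr b * `|s - s'|.
  wlog ss : s s' / s <= s'.
    move=> W; have [h|/ltW h] := leP s s'; first exact: W.
    by rewrite distrC [`|s - s'|]distrC; exact: W.
  have /andP[h1 h2] := cl_itv s; have /andP[h3 h4] := cl_itv s'.
  have /andP[k1 k2] := compl_lipschitz h1 (cl_mono _ _ ss) h4.
  rewrite distrC [`|s - s'|]distrC !ger0_norm ?subr_ge0//.
  rewrite lerBlDl; apply: le_trans k2 _; rewrite lerD2l ler_wpM2l//.
  exact: cl_lip.
have cont : continuous (fun s => complementary Phi (cl s)).
  move=> s; apply/cvgrPdist_lt => e e0; near=> s'.
  apply: le_lt_trans (lip s s') _.
  apply: (@le_lt_trans _ _ ((thr b + 1) * `|s - s'|)).
    by rewrite ler_wpM2r// lerDl.
  rewrite mulrC -ltr_pdivlMr ?ltr_wpDl//.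
  near: s'; exists (e / (thr b + 1)) => /=; first by rewrite divr_gt0// ltr_wpDl.
  by move=> x.
have clE s : 0 <= s <= b -> cl s = s.
  by move=> /andP[h1 h2]; rewrite /cl (max_idPl h1) (min_idPl h2).
have [|x] := @IVT R (fun s => complementary Phi (cl s)) 0 b y b0
  (continuous_subspaceT cont).
  by rewrite !clE ?lexx ?b0// z0 (min_idPl _) ?(max_idPr _) ?compl_ge0// y0.
rewrite in_itv/= => xb; rewrite clE// => xE; exists x => //=.
by case/andP: xb.
Unshelve. all: by end_near.
Qed.

End complementary_function.
End power_like.

(** * From cubes to Luxemburg norms *)

Section ereal_products.
Local Open Scope ereal_scope.
Context {R : realType}.

Lemma er_map_ge (f : R -> R) (c p r : R) (x : \bar R) : (0 <= c)%R -> (0 <= p)%R ->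
  (forall t, 0 <= t -> c * t `^ p <= f t)%R -> (0 <= r)%R -> r%:E <= x ->
  (c * r `^ p)%:E <= er_map f x.
Proof.
move=> c0 p0 H r0; case: x => [x|_|//]; last exact: leey.
rewrite !lee_fin => rx; apply: (@le_trans _ _ (c * x `^ p)%R).
  by rewrite ler_wpM2l// ler_powRl.
by apply: H; exact: le_trans rx.
Qed.

(** The factors on the right may be infinite, but nonnegative finite lower bounds can still be
    multiplied. Only such bounds are drawn from the terms of the weight constants. *)
Lemma prod_ereal_ge (J : finType) (r : J -> R) (x : J -> \bar R) :
  (forall i, 0 <= r i)%R -> (forall i, (r i)%:E <= x i) ->
  (\prod_i r i)%:E <= \prod_i x i.
Proof.
move=> r0 rx; suff : (0 <= \prod_i r i)%R /\ (\prod_i r i)%:E <= \prod_i x i by case.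
apply: (big_ind2 (fun (a : R) (b : \bar R) => (0 <= a)%R /\ a%:E <= b)) => //.
move=> a1 b1 a2 b2 [a10 h1] [a20 h2]; split; first exact: mulr_ge0.
by rewrite EFinM; apply: lee_pmul; rewrite ?lee_fin.
Qed.

Lemma inve_ge (r : R) (x : \bar R) : (0 < r)%R -> 0 <= x -> x <= r%:E ->
  (r^-1)%:E <= x^-1.
Proof.
move=> r0 x0 xr; have -> : (r^-1)%:E = (r%:E)^-1 by rewrite inver gt_eqF.
by rewrite lee_pV2// inE/= lee_fin ltW.
Qed.

End ereal_products.

Section representatives.
Context {R : realType} {d : nat}.
Local Notation E := 'rV[R]_d.
Local Notation mu := (leb R d).

Lemma compact_ccube (a : E) (l : R) : compact (ccube a l).
Proof.
have -> : ccube a l =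
    [set v : E | forall i, `[a ord0 i, a ord0 i + l]%classic (v ord0 i)].
  apply/seteqP; split => x.
    by move=> /ccubeP h i; rewrite /= in_itv/= h.
  by move=> h; apply/ccubeP => i; have := h i; rewrite /= in_itv.
apply: (@rV_compact R d (fun i => `[a ord0 i, a ord0 i + l]%classic)) => i.
exact: segment_compact.
Qed.

(** The Borel representative is set to 1 on the null set where it fails to be positive, so that it
    is positive everywhere; local integrability makes its integral over each closed cube finite. *)
Lemma weight_borel (s : E -> R) : weight s -> exists h : E -> R,
  [/\ measurable_fun setT h, forall x, 0 < h x, {ae mu, forall x, s x = h x} &
    forall a l, (\int[mu]_(x in ccube a l) (h x)%:E < +oo)%E].
Proof.
move=> [[[h mh sh] lint] spos].
exists (fun x => if 0 < h x then h x else 1).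
have E1 : {ae mu, forall x, s x = if 0 < h x then h x else 1}.
  by move: sh spos; apply: filterS2 => x <- ->.
split => //.
- apply: measurable_fun_ifT => //; apply: measurable_fun_ltr => //.
- by move=> x; case: ifP.
- move=> a l; apply: le_lt_trans _ (lint _ (@compact_ccube a l)).
  apply: ae_le_integral_nm; move: E1; apply: filterS => x <- _.
  by rewrite lee_fin ler_norm.
Qed.

Lemma inL_borel (f : E -> R[i]) : leb_measurableC f -> exists g : E -> R,
  [/\ measurable_fun setT g, forall x, 0 <= g x &
    {ae mu, forall x, Normc.normc (f x) = g x}].
Proof.
move=> [[h1 mh1 e1] [h2 mh2 e2]].
exists (fun x => (h1 x ^+ 2 + h2 x ^+ 2) `^ 2^-1); split.
- apply: (measurableT_comp (measurable_powR _)).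
  by apply: measurable_funD; exact: measurable_funX.
- by move=> x; exact: powR_ge0.
- move: e1 e2; apply: filterS2 => x e1 e2.
  rewrite powR12_sqrt ?addr_ge0 ?sqr_ge0// -e1 -e2.
  by case: (f x).
Qed.

(** The infimum is approached along [kappa ^ q^-1 + e], since [kappa] may be 0 while the competitors
    in the norm are positive. *)
Lemma luxnorm_le (Psi : R -> R) (w : E -> R) (M : E -> \bar R) (kappa q : R) :
  0 <= kappa -> 0 < q ->
  (forall lam : R, (0 < lam)%R ->
    \int[mu]_x (er_map Psi (`|M x| / lam%:E) * (w x)%:E) <=
      (kappa / lam `^ q)%:E)%E ->
  (luxnorm Psi w M <= (kappa `^ q^-1)%:E)%E.
Proof.
move=> k0 q0 H; apply/lee_addgt0Pr => e e0.
apply: ereal_inf_lbound; exists (kappa `^ q^-1 + e); last by rewrite EFinD.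
have l0 : 0 < kappa `^ q^-1 + e by rewrite ltr_wpDl// powR_ge0.
split => //; apply: le_trans (H _ l0) _; rewrite lee_fin.
rewrite ler_pdivrMr ?powR_gt0// mul1r -[leLHS](powRVK k0 (lt0r_neq0 q0)).
apply: ler_powRl; [exact: ltW|exact: powR_ge0|by rewrite lerDl ltW].
Qed.

Lemma luxnorm_lt_integral (Phi : R -> R) (c p lam : R) (s h g : E -> R)
    (f : E -> R[i]) :
  0 < c -> 0 < p -> (forall t, 0 <= t -> c * t `^ p <= Phi t) ->
  measurable_fun setT h -> measurable_fun setT g ->
  (forall x, 0 < h x) -> (forall x, 0 <= g x) ->
  {ae mu, forall x, s x = h x} -> {ae mu, forall x, Normc.normc (f x) = g x} ->
  (luxnorm Phi s (modulus f) < lam%:E)%E ->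
  (\int[mu]_x (g x `^ p * h x)%:E <= (c^-1 * lam `^ p)%:E)%E.
Proof.
move=> c0 p0 H mh mg h0 g0 sh fg /ereal_inf_lt[_ [l [l0 int1] <-]].
rewrite lte_fin => llam.
have k0 : 0 <= c * (l `^ p)^-1 by rewrite mulr_ge0 ?(ltW c0)// invr_ge0 powR_ge0.
have gp0 x : 0 <= g x `^ p * h x by rewrite mulr_ge0 ?powR_ge0// ltW.
have mgp : measurable_fun setT (fun x => g x `^ p * h x).
  by apply: measurable_funM => //; exact: (measurableT_comp (measurable_powR _)).
have : (\int[mu]_x (c * (l `^ p)^-1 * (g x `^ p * h x))%:E <= 1)%E.
  apply: le_trans int1; apply: ae_le_integral_nm.
  move: sh fg; apply: filterS2 => x -> fx _.
  rewrite /modulus fx abse_EFin (ger0_norm (g0 x)) inver gt_eqF//= -EFinM lee_fin.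
  rewrite mulrA ler_pM2r//.
  have := H (g x / l) (divr_ge0 (g0 x) (ltW l0)).
  rewrite powRM ?invr_ge0 ?(ltW l0)// (powR_invl _ (ltW l0)).
  by rewrite [g x `^ p * _]mulrC mulrA.
rewrite integral_scale//.
have lp : 0 < l `^ p by rewrite powR_gt0.
have : (0 <= \int[mu]_x (g x `^ p * h x)%:E)%E.
  by apply: integral_ge0 => x _; rewrite lee_fin.
case: (\int[mu]_x _)%E => [r|_|//]; last first.
  by rewrite gt0_muley// lte_fin mulr_gt0// invr_gt0.
rewrite !lee_fin => r0 h1.
apply: (@le_trans _ _ (c^-1 * l `^ p)).
  move: h1; rewrite mulrAC ler_pdivrMr// mul1r => h1.
  by rewrite ler_pdivlMl.
by rewrite ler_wpM2l ?invr_ge0 ?(ltW c0)// ler_powRl ?ltW.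
Qed.

End representatives.

(** This lets numbers above the norms tend to them. Norms may vanish, so the perturbation is
    additive; the product is a polynomial in it, continuous at 0. *)
Lemma prod_addr_eps {R : realType} (n : nat) (N : 'I_n -> R) (eta : R) : 0 < eta ->
  exists2 e, 0 < e & \prod_i (N i + e) <= \prod_i N i + eta.
Proof.
move=> eta0; pose P : {poly R} := \prod_i ((N i)%:P + 'X).
have PE x : P.[x] = \prod_i (N i + x).
  by rewrite /P horner_prod; apply: eq_bigr => i _; rewrite hornerD hornerC hornerX.
have /cvgrPdist_le/(_ _ eta0) := @continuous_horner R P 0.
move=> [e /= e0 He]; have e20 : 0 < e / 2 by lra.
exists (e / 2) => //.
have := He (e / 2); rewrite /= sub0r normrN (gtr0_norm e20) => h.
have {}h : `|P.[0] - P.[e / 2]| <= eta by apply: h; lra.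
rewrite -PE (_ : \prod_i N i = P.[0]); last by rewrite PE; apply: eq_bigr => i _; rewrite addr0.
by move: h; rewrite ler_norml => /andP[]; lra.
Qed.

Section from_cubes_to_norms.
Context {R : realType} {d n : nat}.
Local Notation E := 'rV[R]_d.
Local Notation mu := (leb R d).
Variables (alpha q : R) (p cPhi : 'I_n -> R) (CPsi Ccore : R).
Hypothesis n_gt0 : (0 < n)%N.
Hypothesis d_gt0 : (0 < d)%N.
Hypothesis alpha_lt : alpha < n%:R * d%:R.
Hypothesis q_gt0 : 0 < q.
Hypothesis p_gt1 : forall i, 1 < p i.
Hypothesis cPhi_gt0 : forall i, 0 < cPhi i.
Hypothesis CPsi_gt0 : 0 < CPsi.
Hypothesis Ccore_ge0 : 0 <= Ccore.

Definition final_const : R :=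
  (CPsi * @cover_const R d n alpha `^ q * (#|{ffun 'I_d -> bool}|%:R * Ccore)) `^ q^-1 *
  \prod_m (2 * (cPhi m)^-1 `^ (p m)^-1).

(** The common end of the three bounds, which differ only through [Z] and [Ccore]. Any [lam m] above
    the norm of [f m] bounds the integral of the [p m]-th power of its representative; the product
    of the [lam m] then descends to the product of the norms. *)
Lemma luxnorm_of_cubes (Phi : 'I_n -> R -> R) (Psi : R -> R) (Z : R)
    (s h : 'I_n -> E -> R) (w v : E -> R) (f : 'I_n -> E -> R[i]) :
  (forall i t, 0 <= t -> cPhi i * t `^ p i <= Phi i t) ->
  (forall t, 0 <= t -> Psi t <= CPsi * t `^ q) ->
  0 <= Z ->
  (forall m, measurable_fun setT (h m)) -> (forall m x, 0 < h m x) ->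
  (forall m, {ae mu, forall x, s m x = h m x}) ->
  (forall m a l, \int[mu]_(x in ccube a l) (h m x)%:E < +oo)%E ->
  measurable_fun setT v -> (forall x, 0 < v x) -> {ae mu, forall x, w x = v x} ->
  (forall i, inL (Phi i) (s i) (f i)) ->
  (forall g : 'I_n -> E -> R, (forall m, measurable_fun setT (g m)) ->
    (forall m x, 0 <= g m x) ->
    (forall m, \int[mu]_x (g m x `^ p m * h m x)%:E < +oo)%E ->
    forall N t, (\int[mu]_x
     (cubemax (@cell R d N t) predT (LamN alpha h g t) x `^ q * v x)%:E <=
     (Ccore * (Z * \prod_m (2 `^ p m * gnorm mu h g p m) `^ (q / p m)))%:E)%E) ->
  (luxnorm Psi w (Malpha alpha (fun i x => ((s i x)%:C%C * f i x)%R)) <=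
   (final_const * Z `^ q^-1)%:E *
     \prod_(i < n) luxnorm (Phi i) (s i) (modulus (f i)))%E.
Proof.
move=> HPhi HPsi Z0 mh h0 sh hf mv v0 wv fL H.
have [g Hg] := boolp.choice (fun m => inL_borel (fL m).1).
have mg m : measurable_fun setT (g m) by case: (Hg m).
have g0 m x : 0 <= g m x by case: (Hg m).
have fg m : {ae mu, forall x, Normc.normc (f m x) = g m x} by case: (Hg m).
have p0 m : 0 < p m by exact: lt_trans (p_gt1 m).
pose N m := fine (luxnorm (Phi m) (s m) (modulus (f m))).
have lux0 m : (0 <= luxnorm (Phi m) (s m) (modulus (f m)))%E.
  by apply: le_ereal_inf_tmp => _ [l [l0 _] <-]; rewrite lee_fin ltW.
have NE m : luxnorm (Phi m) (s m) (modulus (f m)) = (N m)%:E.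
  by rewrite /N fineK// ge0_fin_numE//; case: (fL m).
have N0 m : 0 <= N m by rewrite -lee_fin -NE.
under eq_bigr do rewrite NE; rewrite prodEFin -EFinM.
have FC0 : 0 <= final_const.
  rewrite mulr_ge0 ?powR_ge0// prodr_ge0// => m _.
  by rewrite mulr_ge0// powR_ge0.
have G lam : (forall m, N m < lam m) ->
    (luxnorm Psi w (Malpha alpha (fun i x => ((s i x)%:C%C * f i x)%R)) <=
     (final_const * Z `^ q^-1 * \prod_m lam m)%:E)%E.
  move=> Nlam; have lam0 m : 0 < lam m by exact: le_lt_trans (N0 m) (Nlam m).
  have gp m : (\int[mu]_x (g m x `^ p m * h m x)%:E <=
      ((cPhi m)^-1 * lam m `^ p m)%:E)%E.
    apply: (luxnorm_lt_integral (cPhi_gt0 m) (p0 m) (HPhi m) (mh m) (mg m) (h0 m)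
      (g0 m) (sh m) (fg m)).
    by rewrite NE lte_fin.
  have gpf m : (\int[mu]_x (g m x `^ p m * h m x)%:E < +oo)%E.
    by apply: le_lt_trans (gp m) _; rewrite ltry.
  have gph0 m x : 0 <= g m x `^ p m * h m x.
    by rewrite mulr_ge0 ?powR_ge0// ltW.
  have gn0 m : 0 <= gnorm mu h g p m by exact: ge0_fine_integral.
  have gn m : gnorm mu h g p m <= (cPhi m)^-1 * lam m `^ p m.
    by rewrite -lee_fin /gnorm -integral_ge0_lty_fine.
  pose D := Ccore * (Z * \prod_m (2 `^ p m * gnorm mu h g p m) `^ (q / p m)).
  have D0 : 0 <= D.
    by rewrite mulr_ge0// mulr_ge0// prodr_ge0// => m _; exact: powR_ge0.
  have gh0 m x : 0 <= g m x * h m x by rewrite mulr_ge0// ltW.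
  have mgh m : measurable_fun setT (fun x => g m x * h m x) by exact: measurable_funM.
  have ghf m a l : 0 < l -> (\int[mu]_(x in ccube a l) (g m x * h m x)%:E < +oo)%E.
    move=> l0; have [] // := @integral_split _ _ _ mu _ (measurable_ccube a l) (p m)
      (h m) (g m) (p_gt1 m) (mh m) (mg m) (fun x => ltW (h0 m x)) (g0 m) (hf m a l).
    apply: le_lt_trans (gpf m); apply: ge0_subset_integral => //.
    - exact: measurable_ccube.
    - apply/measurable_EFinP; apply: measurable_funM => //.
      exact: (measurableT_comp (measurable_powR _)).
    - by move=> x _; rewrite lee_fin.
  have fE m : {ae mu, forall x, modulus (fun x => ((s m x)%:C%C * f m x)%R) x =
      (g m x * h m x)%:E}.
    move: (sh m) (fg m); apply: filterS2 => x sx fx.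
    rewrite /modulus Normc.normcM fx sx mulrC; congr (_ * _)%:E.
    by rewrite /= expr0n/= addr0 sqrtr_sqr gtr0_norm.
  pose kappa := CPsi * @cover_const R d n alpha `^ q * (#|{ffun 'I_d -> bool}|%:R * D).
  have k0 : 0 <= kappa.
    apply: mulr_ge0; last exact: mulr_ge0.
    by rewrite mulr_ge0 ?powR_ge0// ltW.
  have L : (luxnorm Psi w (Malpha alpha (fun i x => ((s i x)%:C%C * f i x)%R)) <=
      (kappa `^ q^-1)%:E)%E.
    apply: luxnorm_le => // l l0.
    have := @integral_Malpha R d n alpha q v h g (fun i x => ((s i x)%:C%C * f i x)%R)
      n_gt0 d_gt0 alpha_lt q_gt0 mv v0 gh0 mgh ghf fE CPsi l D Psi CPsi_gt0 l0 D0 HPsi.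
    move=> /(_ (H g mg g0 gpf)) K; apply: le_trans K.
    by apply: ae_le_integral_nm; move: wv; apply: filterS => x ->.
  apply: le_trans L _; rewrite lee_fin.
  have -> : kappa = CPsi * @cover_const R d n alpha `^ q *
     (#|{ffun 'I_d -> bool}|%:R * Ccore) * Z *
     \prod_m (2 `^ p m * gnorm mu h g p m) `^ (q / p m) by rewrite /kappa /D; ring.
  have P0 : 0 <= CPsi * @cover_const R d n alpha `^ q * (#|{ffun 'I_d -> bool}|%:R * Ccore).
    apply: mulr_ge0; last exact: mulr_ge0.
    by rewrite mulr_ge0 ?powR_ge0// ltW.
  have Q0 : 0 <= \prod_m (2 `^ p m * gnorm mu h g p m) `^ (q / p m).
    by apply: prodr_ge0 => m _; exact: powR_ge0.
  rewrite (powRM _ (mulr_ge0 P0 Z0) Q0) (powRM _ P0 Z0) /final_const.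
  have -> : forall a b c e : R, a * b * c * e = a * c * (b * e) by move=> *; ring.
  rewrite ler_wpM2l ?mulr_ge0 ?powR_ge0// -big_split/=.
  rewrite powR_prod => [|m _]; last exact: powR_ge0.
  apply: ler_prod => m _; rewrite powR_ge0/=.
  have pn0 := lt0r_neq0 (p0 m).
  have -> : 2 * (cPhi m)^-1 `^ (p m)^-1 * lam m =
      (2 `^ p m * ((cPhi m)^-1 * lam m `^ p m)) `^ (p m)^-1.
    rewrite powRM ?powR_ge0// ?mulr_ge0 ?invr_ge0 ?powR_ge0 ?(ltW (cPhi_gt0 m))//.
    rewrite powRM ?powR_ge0// ?invr_ge0 ?(ltW (cPhi_gt0 m))//.
    by rewrite !powRrK ?(ltW (lam0 m))// mulrA.
  rewrite -powRrM (_ : q / p m * q^-1 = (p m)^-1); last by field; rewrite pn0 gt_eqF.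
  apply: ler_powRl; first by rewrite invr_ge0 ltW.
    by rewrite mulr_ge0 ?powR_ge0.
  by rewrite ler_wpM2l ?powR_ge0.
apply/lee_addgt0Pr => e e0.
set K := final_const * Z `^ q^-1 in G *.
have K0 : 0 <= K by rewrite mulr_ge0 ?powR_ge0.
have eK : 0 < e / (K + 1) by rewrite divr_gt0// ltr_wpDl.
have [eps eps0 Heps] := prod_addr_eps N eK.
apply: le_trans (G (fun m => N m + eps) _) _; first by move=> m; rewrite ltrDl.
rewrite -EFinD lee_fin; apply: le_trans (ler_wpM2l K0 Heps) _.
rewrite mulrDr lerD2l mulrCA ger_pMr//.
by rewrite ler_pdivrMr ?mul1r ?lerDl// ltr_wpDl.
Qed.

End from_cubes_to_norms.

Section closed_cubes.
Context {R : realType} {d n : nat}.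
Local Notation E := 'rV[R]_d.
Local Notation mu := (leb R d).
Implicit Types (a : E) (l : R).

Definition Sq (h : E -> R) a l : R := fine (\int[mu]_(x in ccube a l) (h x)%:E)%E.

Lemma vol_ccube a l : 0 < l -> vol (ccube a l) = l ^+ d.
Proof. by move=> l0; rewrite /vol leb_ccube// ltW. Qed.

Lemma mu_ccube a l : 0 <= l ->
  (mu : {measure set E -> \bar R}) (ccube a l) = (l ^+ d)%:E.
Proof. exact: leb_ccube. Qed.

Section one_weight.
Variables (s h : E -> R).
Hypothesis mh : measurable_fun setT h.
Hypothesis h0 : forall x, 0 < h x.
Hypothesis sh : {ae mu, forall x, s x = h x}.
Hypothesis hf : forall a l, (\int[mu]_(x in ccube a l) (h x)%:E < +oo)%E.

Lemma wmeas_Sq a l : wmeas s (ccube a l) = (Sq h a l)%:E.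
Proof.
rewrite /Sq -integral_ge0_lty_fine//; last by move=> x; exact: ltW.
by apply: ae_eq_integral_nm; move: sh; apply: filterS => x ->.
Qed.

Lemma Sq_gt0 a l : 0 < l -> 0 < Sq h a l.
Proof.
move=> l0; apply: fine_integral_gt0 => //; first exact: measurable_ccube.
by rewrite mu_ccube ?(ltW l0)// lte_fin exprn_gt0.
Qed.

Lemma cint_cell N t (k : grid_idx N) :
  cint mu (@cell R d N t) h k = Sq h (corner t k) (grid_side N k.1).
Proof. by rewrite /cint /cell integral_hcube// ltW// grid_side_gt0. Qed.

Lemma integral_affine (g : E -> R) (c1 c2 : R) a l : 0 < l ->
  measurable_fun setT g -> (forall x, 0 <= g x) ->
  (\int[mu]_(x in ccube a l) (g x)%:E < +oo)%E ->
  (\int[mu]_(x in ccube a l) (c1 * g x + c2)%:E =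
   (c1 * Sq g a l + c2 * l ^+ d)%:E)%E.
Proof.
move=> l0 mg g0 gf; have mC := @measurable_ccube R d a l.
have Cf : (mu (ccube a l) < +oo)%E by rewrite mu_ccube ?ltry// ltW.
have ig : mu.-integrable (ccube a l) (EFin \o g).
  apply/integrableP; split; first exact/measurable_EFinP/measurable_funTS.
  by under eq_integral do rewrite /= ger0_norm//.
have ig1 : mu.-integrable (ccube a l) (EFin \o (fun x => c1 * g x)).
  by have := integrableZl mC c1 ig.
have ic2 : mu.-integrable (ccube a l) (EFin \o (fun x : E => c2)).
  apply/integrableP; split; first exact: measurable_cst.
  by rewrite integral_cst// lte_mul_pinfty.
under eq_integral do rewrite EFinD.
rewrite (integralD mC ig1 ic2) EFinD; congr (_ + _)%E.
  rewrite [RHS]EFinM /Sq -integral_ge0_lty_fine//.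
  exact: (integralZl mC ig c1).
by rewrite (integral_cst mu mC c2%:E) EFinM mu_ccube// ltW.
Qed.

(* Jensen's inequality, from [ln u <= u - 1]. *)
Lemma geometric_mean_ge a l : 0 < l ->
  ((((Sq (fun x => h x `^ 2^-1) a l / l ^+ d) `^ 2)^-1)%:E <=
   expeR ((l ^+ d)%:E^-1 * \int[mu]_(x in ccube a l) (ln (s x)^-1)%:E))%E.
Proof.
move=> l0; set g := fun x => h x `^ 2^-1; set V := l ^+ d.
have V0 : 0 < V by rewrite exprn_gt0.
have g0 x : 0 < g x by exact: powR_gt0.
have mg : measurable_fun setT g by exact: (measurableT_comp (measurable_powR _) mh).
have gf : (\int[mu]_(x in ccube a l) (g x)%:E < +oo)%E.
  apply: integral_sqrt_lty => //; first exact: measurable_ccube.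
    by move=> x; exact: ltW.
  by rewrite mu_ccube ?ltry// ltW.
have S0 : 0 < Sq g a l.
  apply: fine_integral_gt0 => //; first exact: measurable_ccube.
  by rewrite mu_ccube ?(ltW l0)// lte_fin exprn_gt0.
set m := Sq g a l / V; have m0 : 0 < m by rewrite divr_gt0.
have L : ((- (2 * V * ln m))%:E <= \int[mu]_(x in ccube a l) (ln (s x)^-1)%:E)%E.
  (* The tangent to the logarithm at the mean [m] of [g] gives the affine minorant
     [- 2 (g / m - 1) - 2 ln m] of [ln (1 / h)]; its integral is exactly [- 2 V ln m]. *)
  have -> : - (2 * V * ln m) = - 2 / m * Sq g a l + (2 - 2 * ln m) * V.
    by rewrite /m; field; rewrite !gt_eqF.
  rewrite -(integral_affine (- 2 / m) (2 - 2 * ln m) l0 mg (fun x => ltW (g0 x)) gf).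
  apply: ae_le_integral_nm; move: sh; apply: filterS => x -> _.
  have hE : h x = g x `^ 2 by rewrite /g powRVK// ltW.
  rewrite lee_fin lnV ?posrE// hE ln_powR.
  have := @le_ln1Dx R (g x / m - 1).
  have gm : 0 < g x / m by rewrite divr_gt0.
  have -> : 1 + (g x / m - 1) = g x / m by ring.
  rewrite lnM ?posrE ?invr_gt0// lnV ?posrE// => H.
  have -> : - 2 / m * g x + (2 - 2 * ln m) = - 2 * (g x / m - 1) - 2 * ln m by ring.
  have : ln (g x) - ln m <= g x / m - 1 by apply: H; lra.
  lra.
apply: (@le_trans _ _ (expeR (- (2 * ln m))%:E)).
  by rewrite /= lee_fin expRN /powR (gt_eqF m0).
rewrite lee_expeR inver gt_eqF//.
apply: le_trans (lee_wpmul2l _ L); last by rewrite lee_fin invr_ge0 ltW.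
rewrite -EFinM lee_fin le_eqVlt; apply/orP; left; apply/eqP.
by field; rewrite gt_eqF.
Qed.

End one_weight.
End closed_cubes.

Lemma ereal_divr {R : realType} (x r : R) : r != 0 -> (x%:E / r%:E = (x / r)%:E)%E.
Proof. by move=> r0; rewrite inver (negbTE r0). Qed.

Lemma ereal_sup_fin {R : realType} (S : set (\bar R)) (y : \bar R) :
  S y -> (0 <= y)%E -> (ereal_sup S < +oo)%E ->
  exists2 B, 0 <= B & ereal_sup S = B%:E.
Proof.
move=> Sy y0 Sf; have S0 : (0 <= ereal_sup S)%E.
  by apply: le_trans y0 _; exact: ereal_sup_ubound.
by move: S0 Sf; case: (ereal_sup S) => [r|//|//]; rewrite lee_fin => r0 _; exists r.
Qed.

Lemma disc_const_ge0 {R : realType} (n : nat) (beta q : R) (p : 'I_n -> R) :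
  0 <= disc_const beta q p.
Proof.
rewrite /disc_const mulr_ge0 ?mulr_ge0 ?powR_ge0// prodr_ge0// => m _.
exact: powR_ge0.
Qed.

Lemma disc_const_joint_ge0 {R : realType} (n : nat) (beta q : R) (p : 'I_n -> R)
  (p0 : R) : 0 <= q -> 0 <= p0 -> 0 <= disc_const_joint beta q p p0.
Proof.
move=> q0 p00; rewrite /disc_const_joint mulr_ge0 ?powR_ge0// mulr_ge0//.
by rewrite mulr_ge0 ?powR_ge0// divr_ge0.
Qed.

(** The lower power bound on the inverse of [Psi] turns [Z ^ q^-1] into its value at [b]. The added
    1 ensures that the constant is positive. *)
Lemma insert_inverse_bound {R : realType} (q FC k Z b c : R) (gP : R -> R)
    (P L : \bar R) : 0 < q -> 0 <= FC -> 0 <= k -> 0 <= b -> 0 < c -> (0 <= P)%E ->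
  0 <= Z -> Z <= k * b -> (forall t, 0 <= t -> c * t `^ q^-1 <= gP t) ->
  (L <= (FC * Z `^ q^-1)%:E * P)%E ->
  (L <= (FC * k `^ q^-1 * c^-1 + 1)%:E * (gP b)%:E * P)%E.
Proof.
move=> q0 FC0 k0 b0 c0 P0 Z0 Zb H; move=> /le_trans; apply.
have qV : 0 <= q^-1 by rewrite invr_ge0 ltW.
have Hb := H _ b0; have bq : 0 <= b `^ q^-1 by exact: powR_ge0.
have g0 : 0 <= gP b by apply: le_trans Hb; rewrite mulr_ge0// ltW.
rewrite -EFinM; apply: lee_wpmul2r => //; rewrite lee_fin.
apply: (@le_trans _ _ (FC * k `^ q^-1 * c^-1 * gP b)); last first.
  by rewrite ler_wpM2r// lerDl.
rewrite -!mulrA ler_wpM2l//.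
apply: (@le_trans _ _ (k `^ q^-1 * b `^ q^-1)).
  by rewrite -powRM// ler_powRl.
by rewrite ler_wpM2l ?powR_ge0// ler_pdivlMl.
Qed.

(** * The three weighted bounds *)

Section three_bounds.
Context {R : realType} {d n : nat}.
Local Notation E := 'rV[R]_d.
Local Notation mu := (leb R d).
Implicit Types (a : E) (l : R).
Variables (alpha q p0 : R) (p : 'I_n -> R).
Variables (Phi : 'I_n -> R -> R) (Phi0 Psi : R -> R).
Variables (cPhi cG cF : 'I_n -> R) (cPsi CPsi cPhi0 cG0 cGPsi : R).
Hypothesis n_gt0 : (0 < n)%N.
Hypothesis d_gt0 : (0 < d)%N.
Hypothesis alpha_ge0 : 0 <= alpha.
Hypothesis alpha_lt : alpha < n%:R * d%:R.
Hypothesis p_gt1 : forall m, 1 < p m.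
Hypothesis p0_gt0 : 0 < p0.
Hypothesis p0E : \sum_m p0 / p m = 1.
Hypothesis p0_le : p0 <= q.
Hypothesis cPhi_gt0 : forall m, 0 < cPhi m.
Hypothesis HPhi : forall m t, 0 <= t -> cPhi m * t `^ p m <= Phi m t.
Hypothesis cG_gt0 : forall m, 0 < cG m.
Hypothesis HG : forall m t, 0 <= t ->
  cG m * t `^ (p m)^-1 <= ginv (Phi m) t.
Hypothesis cPsi_gt0 : 0 < cPsi.
Hypothesis CPsi_gt0 : 0 < CPsi.
Hypothesis HPsi : forall t, 0 <= t -> cPsi * t `^ q <= Psi t <= CPsi * t `^ q.
Hypothesis cGPsi_gt0 : 0 < cGPsi.
Hypothesis HGPsi : forall t, 0 <= t -> cGPsi * t `^ q^-1 <= ginv Psi t.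
Hypothesis cPhi0_gt0 : 0 < cPhi0.
Hypothesis HPhi0 : forall t, 0 <= t -> cPhi0 * t `^ p0 <= Phi0 t.
Hypothesis cG0_gt0 : 0 < cG0.
Hypothesis HG0 : forall t, 0 <= t -> cG0 * t `^ p0^-1 <= ginv Phi0 t.
Hypothesis cF_gt0 : forall m, 0 < cF m.
Hypothesis HF : forall m t, 0 <= t ->
  cF m * t `^ (1 - (p m)^-1) <= ginv (complementary (Phi m)) t.

Let p_gt0 m : 0 < p m. Proof. exact: lt_trans (p_gt1 m). Qed.
Let q_gt0 : 0 < q. Proof. exact: lt_le_trans p0_le. Qed.
Let HPsil t : 0 <= t -> cPsi * t `^ q <= Psi t.
Proof. by move=> /HPsi/andP[]. Qed.
Let HPsiu t : 0 <= t -> Psi t <= CPsi * t `^ q.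
Proof. by move=> /HPsi/andP[]. Qed.
Let pV m : 0 <= (p m)^-1. Proof. by rewrite invr_ge0 ltW. Qed.
Let q_ge : 1 <= \sum_m q / p m.
Proof.
rewrite -p0E; apply: ler_sum => m _.
by rewrite ler_pM2r// invr_gt0.
Qed.

Local Notation beta := (@beta_exp R d n alpha).

Lemma beta_le : beta <= n%:R.
Proof. by rewrite /beta_exp lerBlDr lerDl divr_ge0. Qed.

Section weights.
Variables (s h : 'I_n -> E -> R) (w v : E -> R).
Hypothesis mh : forall m, measurable_fun setT (h m).
Hypothesis h0 : forall m x, 0 < h m x.
Hypothesis sh : forall m, {ae mu, forall x, s m x = h m x}.
Hypothesis hf : forall m a l, (\int[mu]_(x in ccube a l) (h m x)%:E < +oo)%E.
Hypothesis mv : measurable_fun setT v.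
Hypothesis v0 : forall x, 0 < v x.
Hypothesis wv : {ae mu, forall x, w x = v x}.
Hypothesis vf : forall a l, (\int[mu]_(x in ccube a l) (v x)%:E < +oo)%E.

Definition gq a l : R := (l ^+ d) `^ (- beta) * \prod_m Sq (h m) a l.

Let S0 m a l : 0 < l -> 0 < Sq (h m) a l.
Proof. exact: Sq_gt0. Qed.

Lemma gq_gt0 a l : 0 < l -> 0 < gq a l.
Proof.
move=> l0; rewrite mulr_gt0 ?powR_gt0 ?exprn_gt0// prodr_gt0// => m _; exact: S0.
Qed.

(** The [n] exponents [1 - alpha / (n d)] of the volume add up to [beta], so the argument of [Psi]
    is exactly [gq a l]. *)
Lemma Psi_gq_ge a l : 0 < l -> ((cPsi * gq a l `^ q)%:E <=
  er_map Psi (\prod_(m < n) (wmeas (s m) (ccube a l) /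
    (vol (ccube a l) `^ (1 - alpha / (n%:R * d%:R)))%:E)))%E.
Proof.
move=> l0; have V0 : 0 < l ^+ d by rewrite exprn_gt0.
apply: er_map_ge => //; [exact: ltW|exact: ltW|exact/ltW/gq_gt0|].
rewrite vol_ccube//; set e := (l ^+ d) `^ _.
have e0 : 0 < e by rewrite powR_gt0.
rewrite (eq_bigr (fun m => (Sq (h m) a l / e)%:E)) => [|m _]; last first.
  by rewrite (wmeas_Sq (h0 m) (sh m) (hf m)) ereal_divr// gt_eqF.
rewrite prodEFin lee_fin big_split/= /gq mulrC prodr_const card_ord.
rewrite ler_wpM2l//; first by apply: prodr_ge0 => m _; exact/ltW/S0.
rewrite exprVn -(powR_mulrn n (ltW e0)) /e -powRrM -powRN le_eqVlt.
apply/orP; left; apply/eqP; congr (_ `^ - _); rewrite /beta_exp.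
by field; rewrite !pnatr_eq0 -!lt0n n_gt0 d_gt0.
Qed.

(** Shared by the classes A and B, which differ only in the arguments [Y m] of the inverses of the
    [Phi m]; [y m] is a finite lower bound for such an argument. *)
Lemma A_term_ge (y : 'I_n -> R) (Y : 'I_n -> \bar R) a l : 0 < l ->
  (forall m, 0 < y m) -> (forall m, (y m)%:E <= Y m)%E ->
  ((Sq v a l * (cPsi * gq a l `^ q) *
    (cPsi * (\prod_m (cG m * y m `^ (p m)^-1)) `^ q))%:E <=
  wmeas w (ccube a l) * er_map Psi (\prod_(m < n) (wmeas (s m) (ccube a l) /
    (vol (ccube a l) `^ (1 - alpha / (n%:R * d%:R)))%:E)) *
  er_map Psi (\prod_(m < n) er_map (ginv (Phi m)) (Y m)))%E.
Proof.
move=> l0 y0 yY; have W0 := Sq_gt0 mv v0 vf a l0.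
have P0 : 0 <= \prod_m (cG m * y m `^ (p m)^-1).
  by apply: prodr_ge0 => m _; rewrite mulr_ge0 ?powR_ge0// ltW.
rewrite 2!EFinM; apply: lee_pmul.
- by rewrite -EFinM lee_fin mulr_ge0 ?(ltW W0)// mulr_ge0 ?powR_ge0// ltW.
- by rewrite lee_fin mulr_ge0 ?powR_ge0// ltW.
- rewrite (wmeas_Sq v0 wv vf); apply: lee_wpmul2l; first by rewrite lee_fin ltW.
  exact: Psi_gq_ge.
- apply: er_map_ge => //; [exact: ltW|exact: ltW|].
  apply: prod_ereal_ge => m; first by rewrite mulr_ge0 ?powR_ge0// ltW.
  by apply: er_map_ge => //; [exact: ltW|exact: HG|exact: ltW].
Qed.

Definition kA : R := (cPsi * (cPsi * (\prod_m cG m) `^ q))^-1.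

Lemma kA_gt0 : 0 < kA.
Proof.
by rewrite invr_gt0 mulr_gt0// mulr_gt0// powR_gt0// prodr_gt0.
Qed.

Lemma A_term_solve (y : 'I_n -> R) a l B : (forall m, 0 < y m) ->
  Sq v a l * (cPsi * gq a l `^ q) *
    (cPsi * (\prod_m (cG m * y m `^ (p m)^-1)) `^ q) <= B ->
  Sq v a l * gq a l `^ q <= kA * B * \prod_m (y m)^-1 `^ (q / p m).
Proof.
move=> y0; rewrite powR_prod => [|m _]; last by rewrite mulr_ge0 ?powR_ge0// ltW.
have -> : \prod_m (cG m * y m `^ (p m)^-1) `^ q =
    (\prod_m cG m) `^ q * (\prod_m (y m)^-1 `^ (q / p m))^-1.
  rewrite powR_prod => [|m _]; last exact: ltW.
  rewrite -prodfV -big_split/=; apply: eq_bigr => m _.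
  rewrite powRM ?powR_ge0 ?(ltW (cG_gt0 _))// -powRrM.
  by rewrite (powR_invl _ (ltW (y0 m))) invrK [(p m)^-1 * q]mulrC.
set Ey := \prod_m (y m)^-1 `^ (q / p m); have Ey0 : 0 < Ey.
  by apply: prodr_gt0 => m _; rewrite powR_gt0// invr_gt0.
have k0 : 0 < cPsi * (cPsi * (\prod_m cG m) `^ q).
  by rewrite mulr_gt0// mulr_gt0// powR_gt0// prodr_gt0.
move=> H; rewrite -mulrA -ler_pdivrMl ?kA_gt0// /kA invrK -ler_pdivrMr//.
apply: le_trans H; rewrite le_eqVlt; apply/orP; left; apply/eqP; ring.
Qed.

Lemma Sq_ge0 a l : 0 <= Sq v a l.
Proof. by apply: ge0_fine_integral => x; exact: ltW. Qed.

Lemma cubes0 : cubes (ccube (0 : E) 1).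
Proof. exact: cubes_ccube. Qed.

(** The geometric mean is bounded below through [geometric_mean_ge], so that the inverse of [y] is
    the volume times the squared average of the square root, the coefficient packed by
    [sqrt_packing]. *)
Lemma Bconst_cubes : (Bconst alpha Phi Psi s w < +oo)%E ->
  exists B, [/\ 0 <= B, Bconst alpha Phi Psi s w = B%:E & forall a l, 0 < l ->
    Sq v a l * gq a l `^ q <= kA * B * \prod_m
      (l ^+ d * (Sq (fun x => h m x `^ 2^-1) a l / l ^+ d) `^ 2) `^ (q / p m)].
Proof.
move=> Bf.
pose y a l m := (l ^+ d)^-1 * ((Sq (fun x => h m x `^ 2^-1) a l / l ^+ d) `^ 2)^-1.
have y0 a l m : 0 < l -> 0 < y a l m.
  move=> l0; have V0 : 0 < l ^+ d by rewrite exprn_gt0.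
  rewrite mulr_gt0 ?invr_gt0// powR_gt0// divr_gt0//.
  apply: fine_integral_gt0.
  - exact: measurable_ccube.
  - exact: (measurableT_comp (measurable_powR _) (mh m)).
  - by move=> x; exact: powR_gt0.
  - by rewrite mu_ccube ?(ltW l0)// lte_fin.
  - apply: integral_sqrt_lty => //; [exact: measurable_ccube| |].
      by move=> x; exact: ltW.
    by rewrite mu_ccube ?(ltW l0)// ltry.
have YP a l : 0 < l -> forall m, ((y a l m)%:E <= (vol (ccube a l))%:E^-1 *
    expeR ((vol (ccube a l))%:E^-1 *
         \int[mu]_(x in ccube a l) (ln (s m x)^-1)%:E))%E.
  move=> l0 m; rewrite vol_ccube// EFinM.
  have V0 : 0 < l ^+ d by rewrite exprn_gt0.
  rewrite [X in (_ <= X * _)%E]inver (gt_eqF V0).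
  apply: lee_wpmul2l; first by rewrite lee_fin invr_ge0 ltW.
  exact: (geometric_mean_ge (mh m) (h0 m) (sh m) (hf m)).
have T a l (l0 : 0 < l) := A_term_ge a l0 (fun m => y0 a l m l0) (YP a l l0).
have T1 := T (0 : E) 1 ltr01.
have [B B0 BE] : exists2 B, 0 <= B & Bconst alpha Phi Psi s w = B%:E.
  apply: ereal_sup_fin Bf; first by exists (ccube 0 1); [exact: cubes0|reflexivity].
  apply: le_trans T1; rewrite lee_fin mulr_ge0//.
    by rewrite mulr_ge0 ?Sq_ge0// mulr_ge0 ?powR_ge0// ltW.
  by rewrite mulr_ge0 ?powR_ge0// ltW.
exists B; split => // a l l0.
have := @A_term_solve (y a l) a l B (fun m => y0 a l m l0).
have -> : \prod_m (y a l m)^-1 `^ (q / p m) = \prod_m (l ^+ d *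
    (Sq (fun x => h m x `^ 2^-1) a l / l ^+ d) `^ 2) `^ (q / p m).
  by apply: eq_bigr => m _; rewrite /y invfM !invrK.
apply; rewrite -lee_fin -BE; apply: le_trans (T a l l0) _.
by apply: ereal_sup_ubound; exists (ccube a l) => //; exact: cubes_ccube.
Qed.

Lemma Aconst_cubes : (Aconst alpha Phi Psi s w < +oo)%E ->
  exists B, [/\ 0 <= B, Aconst alpha Phi Psi s w = B%:E & forall a l, 0 < l ->
    Sq v a l * gq a l `^ q <= kA * B * \prod_m Sq (h m) a l `^ (q / p m)].
Proof.
move=> Af; pose y a l m := (Sq (h m) a l)^-1.
have y0 a l m : 0 < l -> 0 < y a l m by move=> l0; rewrite invr_gt0 S0.
have YP a l : 0 < l -> forall m, ((y a l m)%:E <= (wmeas (s m) (ccube a l))^-1)%E.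
  move=> l0 m; rewrite (wmeas_Sq (h0 m) (sh m) (hf m)) inver gt_eqF//.
  exact: S0.
have T a l (l0 : 0 < l) := A_term_ge a l0 (fun m => y0 a l m l0) (YP a l l0).
have T1 := T (0 : E) 1 ltr01.
have [B B0 BE] : exists2 B, 0 <= B & Aconst alpha Phi Psi s w = B%:E.
  apply: ereal_sup_fin Af; first by exists (ccube 0 1); [exact: cubes0|reflexivity].
  apply: le_trans T1; rewrite lee_fin mulr_ge0//.
    by rewrite mulr_ge0 ?Sq_ge0// mulr_ge0 ?powR_ge0// ltW.
  by rewrite mulr_ge0 ?powR_ge0// ltW.
exists B; split => // a l l0.
have := @A_term_solve (y a l) a l B (fun m => y0 a l m l0).
have -> : \prod_m (y a l m)^-1 `^ (q / p m) = \prod_m Sq (h m) a l `^ (q / p m).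
  by apply: eq_bigr => m _; rewrite /y !invrK.
apply; rewrite -lee_fin -BE; apply: le_trans (T a l l0) _.
by apply: ereal_sup_ubound; exists (ccube a l) => //; exact: cubes_ccube.
Qed.

Definition kT : R := (cPsi * (\prod_m cF m) `^ q)^-1.

Lemma kT_gt0 : 0 < kT.
Proof. by rewrite invr_gt0 mulr_gt0// powR_gt0// prodr_gt0. Qed.

(** With [z] the averages of the weights, [gq] is [|Q|^(alpha/d)] times the product of the [z m],
    whereas the class controls the product of the [z m ^ (1 - 1 / p m)], the growth of the inverse
    complementary functions. The missing powers [z m ^ (1 / p m)] form the coefficient, and the
    volume comes from [w(Q) / |Q|]. *)
Lemma At_const_cubes :
  (At_const alpha (fun i => complementary (Phi i)) Psi s w < +oo)%E ->
  exists B, [/\ 0 <= B,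
    At_const alpha (fun i => complementary (Phi i)) Psi s w = B%:E &
    forall a l, 0 < l -> Sq v a l * gq a l `^ q <=
      kT * B * (l ^+ d * \prod_m (Sq (h m) a l / l ^+ d) `^ (q / p m))].
Proof.
move=> Af.
have pV1 m : 0 <= 1 - (p m)^-1.
  by rewrite subr_ge0 invf_le1// ltW.
pose z a l m := Sq (h m) a l / l ^+ d.
have z0 a l m : 0 < l -> 0 < z a l m.
  by move=> l0; rewrite divr_gt0 ?exprn_gt0// S0.
pose X a l := (l ^+ d) `^ (alpha / d%:R) *
  \prod_m (cF m * z a l m `^ (1 - (p m)^-1)).
have P0 a l : 0 < l -> 0 <= \prod_m (cF m * z a l m `^ (1 - (p m)^-1)).
  by move=> l0; apply: prodr_ge0 => m _; rewrite mulr_ge0 ?powR_ge0// ltW.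
have X0 a l : 0 < l -> 0 <= X a l.
  by move=> l0; rewrite mulr_ge0 ?powR_ge0// P0.
have T a l : 0 < l -> ((Sq v a l / l ^+ d * (cPsi * X a l `^ q))%:E <=
    wmeas w (ccube a l) / (vol (ccube a l))%:E *
    er_map Psi ((vol (ccube a l) `^ (alpha / d%:R))%:E *
      \prod_(i < n) er_map (ginv (complementary (Phi i)))
        (wmeas (s i) (ccube a l) / (vol (ccube a l))%:E)))%E.
  move=> l0; have V0 : 0 < l ^+ d by rewrite exprn_gt0.
  rewrite vol_ccube// (wmeas_Sq v0 wv vf) ereal_divr ?gt_eqF// EFinM.
  apply: lee_wpmul2l; first by rewrite lee_fin divr_ge0 ?Sq_ge0 ?(ltW V0).
  apply: er_map_ge => //; [exact: ltW|exact: ltW|exact: X0|].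
  rewrite EFinM; apply: lee_wpmul2l; first by rewrite lee_fin powR_ge0.
  apply: prod_ereal_ge => m; first by rewrite mulr_ge0 ?powR_ge0// ltW.
  rewrite (wmeas_Sq (h0 m) (sh m) (hf m)) ereal_divr ?gt_eqF//.
  by apply: er_map_ge => //; [exact: ltW|exact: HF|exact/ltW/z0].
have T1 := T (0 : E) 1 ltr01.
have [B B0 BE] : exists2 B, 0 <= B &
    At_const alpha (fun i => complementary (Phi i)) Psi s w = B%:E.
  apply: ereal_sup_fin Af; first by exists (ccube 0 1); [exact: cubes0|reflexivity].
  apply: le_trans T1; rewrite lee_fin mulr_ge0//.
    by rewrite divr_ge0 ?Sq_ge0// exprn_ge0.
  by rewrite mulr_ge0 ?powR_ge0// ltW.
exists B; split => // a l l0.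
have V0 : 0 < l ^+ d by rewrite exprn_gt0.
have : Sq v a l / l ^+ d * (cPsi * X a l `^ q) <= B.
  rewrite -lee_fin -BE; apply: le_trans (T a l l0) _.
  by apply: ereal_sup_ubound; exists (ccube a l) => //; exact: cubes_ccube.
rewrite mulrAC ler_pdivrMr// => H.
have gE : gq a l `^ q = X a l `^ q * (((\prod_m cF m) `^ q)^-1 *
    \prod_m z a l m `^ (q / p m)).
  have -> : gq a l = X a l * ((\prod_m cF m)^-1 * \prod_m z a l m `^ (p m)^-1).
    rewrite /gq /X -prodfV -!mulrA -!big_split/=.
    have -> : (l ^+ d) `^ (- beta) = (l ^+ d) `^ (alpha / d%:R) * \prod_(m < n) (l ^+ d)^-1.
      rewrite prodr_const card_ord -(powR_inv1 (ltW V0)).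
      rewrite -(powR_mulrn n (powR_ge0 (l ^+ d) (-1))) -powRrM -powRD.
        by congr (_ `^ _); rewrite /beta_exp mulN1r opprB addrC.
      by rewrite (gt_eqF V0) implybT.
    rewrite -mulrA -big_split/=; congr (_ * _); apply: eq_bigr => m _.
    have zE : z a l m `^ (1 - (p m)^-1) * z a l m `^ (p m)^-1 = z a l m.
      rewrite -powRD; last by rewrite (gt_eqF (z0 a l m l0)) implybT.
      by rewrite subrK powRr1// ltW// z0.
    have -> : cF m * z a l m `^ (1 - (p m)^-1) * ((cF m)^-1 * z a l m `^ (p m)^-1) =
      (cF m / cF m) * (z a l m `^ (1 - (p m)^-1) * z a l m `^ (p m)^-1) by ring.
    by rewrite zE divff ?gt_eqF// mul1r /z mulrC.
  have I0 : 0 <= (\prod_m cF m)^-1.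
    by rewrite invr_ge0 prodr_ge0// => m _; exact: ltW.
  have Z0 : 0 <= \prod_m z a l m `^ (p m)^-1.
    by apply: prodr_ge0 => m _; exact: powR_ge0.
  rewrite (powRM _ (X0 a l l0) (mulr_ge0 I0 Z0)) (powRM _ I0 Z0).
  rewrite (powR_invl q); last by rewrite prodr_ge0// => m _; exact: ltW.
  rewrite (@powR_prod R _ _ predT (fun m => z a l m `^ (p m)^-1) q) => [|m _]; last exact: powR_ge0.
  congr (_ * (_ * _)); apply: eq_bigr => m _.
  by rewrite -powRrM mulrC.
have c0 : 0 < cPsi * (\prod_m cF m) `^ q.
  by rewrite mulr_gt0// powR_gt0// prodr_gt0.
have cF0 : 0 < (\prod_m cF m) `^ q by rewrite powR_gt0// prodr_gt0.
rewrite gE /kT.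
have Z0 : 0 <= \prod_m z a l m `^ (q / p m).
  by apply: prodr_ge0 => m _; exact: powR_ge0.
have := ler_wpM2r (mulr_ge0 (ltW kT_gt0) Z0) H; rewrite /kT.
move: cF0; set cq := (\prod_m cF m) `^ q; set Zq := \prod_m _ => cF0 H2.
have -> : Sq v a l * (X a l `^ q * (cq^-1 * Zq)) =
    Sq v a l * (cPsi * X a l `^ q) * ((cPsi * cq)^-1 * Zq).
  by field; rewrite !gt_eqF.
have -> : (cPsi * cq)^-1 * B * (l ^+ d * Zq) = B * l ^+ d * ((cPsi * cq)^-1 * Zq).
  by ring.
exact: H2.
Qed.

Lemma HLmax_ge0 (g : E -> R) x : (0 <= HLmax g x)%E.
Proof.
apply: le_trans (ereal_sup_ubound _); last first.
  by exists (ccube 0 1); [exact: cubes0|reflexivity].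
rewrite vol_ccube// ereal_divr ?expr1n ?oner_eq0//.
rewrite mule_ge0 ?lee_fin ?divr_ge0 ?exprn_ge0//.
by apply: integral_ge0 => y _; rewrite lee_fin.
Qed.

(** Cells are nested as half-open cubes; the faces separating them from the closed cubes of [HLmax]
    are negligible. *)
Lemma HLmax_ge m a l a' l' x : 0 < l' -> hcube a' l' `<=` ccube a l ->
  ccube a' l' x ->
  ((Sq (h m) a' l' / l' ^+ d)%:E <=
   HLmax (fun y => (s m y * \1_(ccube a l) y)%R) x)%E.
Proof.
move=> l0 sub xQ; have V0 : 0 < l' ^+ d by rewrite exprn_gt0.
apply: le_trans (ereal_sup_ubound _); last first.
  by exists (ccube a' l'); [exact: cubes_ccube|reflexivity].
rewrite vol_ccube// ereal_divr ?gt_eqF// indicE mem_set// mulrC EFinM mul1r.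
apply: lee_wpmul2l; first by rewrite lee_fin invr_ge0 ltW.
rewrite -integral_hcube ?(ltW l0)// /Sq -integral_ge0_lty_fine//; last first.
  by move=> y; exact: ltW.
rewrite -[leLHS]integral_hcube ?(ltW l0)//.
apply: ae_le_integral_nm; apply: filterS (sh m) => y -> hy.
by rewrite lee_fin indicE mem_set ?mulr1 ?ler_norm//; exact: sub.
Qed.

(** Up to a constant this dominates [nu] almost everywhere, because [Phi0] and the inverses of the
    [Phi m] grow like powers. *)
Let rho x : R := \prod_m h m x `^ (p0 / p m).

Section cells.
Variables (N : nat) (t : {ffun 'I_d -> bool}).
Local Notation cel := (@cell R d N t).
Local Notation cc k := (ccube (@corner R d N t k) (grid_side N k.1)).

Lemma cint_cell_lty (g : E -> R) (k : grid_idx N) :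
  (forall a l, \int[mu]_(x in ccube a l) (g x)%:E < +oo)%E ->
  (\int[mu]_(x in cel k) (g x)%:E < +oo)%E.
Proof. by move=> gf; rewrite /cell integral_hcube// ltW// grid_side_gt0. Qed.

Lemma mu_cell (k : grid_idx N) :
  (0 < (mu : {measure set E -> \bar R}) (cel k) < +oo)%E.
Proof.
have H : (mu : {measure set E -> \bar R}) (cel k) = (grid_side N k.1 ^+ d)%:E.
  exact: (leb_hcube (@corner R d N t k) (ltW (grid_side_gt0 N k.1))).
by rewrite H lte_fin exprn_gt0 ?grid_side_gt0//= ltry.
Qed.

Lemma Gam_cell (k : grid_idx N) :
  Gam mu cel h beta k = gq (corner t k) (grid_side N k.1).
Proof.
rewrite /Gam cvol_cell; congr (_ * _); apply: eq_bigr => m _.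
exact: cint_cell.
Qed.

Definition cellavg m (k : grid_idx N) : R := cint mu cel (h m) k / cvol mu cel k.

Lemma cellavg_ge0 m k : 0 <= cellavg m k.
Proof.
rewrite divr_ge0//; first by apply: cint_ge0 => x; exact: ltW.
by rewrite cvol_cell exprn_ge0// ltW// grid_side_gt0.
Qed.

Lemma cellavg_le_HLmax m (j k : grid_idx N) x : cel k `<=` cel j -> cel k x ->
  ((cellavg m k)%:E <= HLmax (fun y => (s m y * \1_(cc j) y)%R) x)%E.
Proof.
move=> kj kx; rewrite /cellavg cvol_cell cint_cell.
apply: HLmax_ge; [exact: grid_side_gt0| |exact: hcube_sub].
exact: subset_trans (@hcube_sub _ _ _ _).
Qed.

Lemma cubemax_le_ereal (B : grid_idx N -> R) j x (M : \bar R) : (0 <= M)%E ->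
  (forall k, cel k `<=` cel j -> cel k x -> ((B k)%:E <= M)%E) ->
  ((cubemax cel (subC cel j) B x)%:E <= M)%E.
Proof.
case: M => [r|_ _|//]; last exact: leey.
rewrite !lee_fin => r0 H; apply/bigmax_leP; split => // k /andP[/asboolP kj /asboolP kx].
by rewrite -lee_fin; exact: H.
Qed.

Lemma cells_bound_split (g : 'I_n -> E -> R) (K : R) (A : 'I_n -> R)
    (B : 'I_n -> grid_idx N -> R) :
  (forall m, measurable_fun setT (g m)) -> (forall m x, 0 <= g m x) ->
  (forall m, \int[mu]_x (g m x `^ p m * h m x)%:E < +oo)%E ->
  0 <= K -> (forall m, 0 <= A m) -> (forall m k, 0 <= B m k) ->
  (forall k, Sq v (corner t k) (grid_side N k.1) *
      gq (corner t k) (grid_side N k.1) `^ q <=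
     K * \prod_m (grid_side N k.1 ^+ d * B m k) `^ (q / p m)) ->
  (forall m j, \int[mu]_(x in cel j) (cubemax cel (subC cel j) (B m) x)%:E <=
     (A m * Sq (h m) (corner t j) (grid_side N j.1))%:E)%E ->
  (\int[mu]_x (cubemax cel predT (LamN alpha h g t) x `^ q * v x)%:E <=
   (disc_const beta q p * (K * \prod_m A m `^ (q / p m) *
      \prod_m (2 `^ p m * gnorm mu h g p m) `^ (q / p m)))%:E)%E.
Proof.
move=> mg g0 gf K0 A0 B0 H1 H2.
pose I := (grid_idx (d:=d) N : finType).
have HH := @bound_split default_measure_display E R mu I cel (@measurable_cell R d N t).
have {}HH := HH (cell_laminar t) mu_cell n v h g beta q p mv mh mg (fun x => ltW (v0 x)) h0 g0.
have {}HH := HH (fun k => cint_cell_lty k vf).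
have {}HH := HH (fun m k => cint_cell_lty k (hf m)) gf (beta_exp_gt0 d_gt0 alpha_lt) beta_le q_gt0 p_gt1 q_ge K A B K0 A0 B0.
apply: HH.
  move=> k; rewrite Gam_cell cint_cell cvol_cell; exact: H1.
by move=> m j; rewrite cint_cell; exact: H2.
Qed.

Lemma cells_bound_joint (g : 'I_n -> E -> R) (K A : R) (B : grid_idx N -> R) :
  (forall m, measurable_fun setT (g m)) -> (forall m x, 0 <= g m x) ->
  (forall m, \int[mu]_x (g m x `^ p m * h m x)%:E < +oo)%E ->
  0 <= K -> 0 <= A -> (forall k, 0 <= B k) ->
  (forall k, Sq v (corner t k) (grid_side N k.1) *
      gq (corner t k) (grid_side N k.1) `^ q <=
     K * (grid_side N k.1 ^+ d * B k)) ->
  (forall j, \int[mu]_(x in cel j) (cubemax cel (subC cel j) B x)%:E <=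
     (A * Sq rho (corner t j) (grid_side N j.1) `^ (q / p0))%:E)%E ->
  (\int[mu]_x (cubemax cel predT (LamN alpha h g t) x `^ q * v x)%:E <=
   (disc_const_joint beta q p p0 * (K * A * n%:R `^ (q / p0) *
      \prod_m (2 `^ p m * gnorm mu h g p m) `^ (q / p m)))%:E)%E.
Proof.
move=> mg g0 gf K0 A0 B0 H1 H2.
pose I := (grid_idx (d:=d) N : finType).
have HH := @bound_joint default_measure_display E R mu I cel (@measurable_cell R d N t).
have {}HH := HH (cell_laminar t) mu_cell n v h g beta q p mv mh mg (fun x => ltW (v0 x)) h0 g0.
have {}HH := HH (fun k => cint_cell_lty k vf).
have {}HH := HH (fun m k => cint_cell_lty k (hf m)) gf (beta_exp_gt0 d_gt0 alpha_lt) beta_le q_gt0 p_gt1 q_ge p0 K A B p0_gt0 p0E K0 A0 B0.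
apply: HH.
  move=> k; rewrite Gam_cell cint_cell cvol_cell; exact: H1.
by move=> j; rewrite cint_cell; exact: H2.
Qed.

End cells.

Local Notation FC c := (final_const (d := d) alpha q p cPhi CPsi c).

Definition ki : R := kA * \prod_(m < n) (doob_const 2 * 2 `^ 2) `^ (q / p m).
Definition C_i : R := FC (disc_const beta q p) * ki `^ q^-1 * cGPsi^-1 + 1.

Lemma final_const_ge0 c : 0 <= c -> 0 <= FC c.
Proof.
move=> c0; rewrite mulr_ge0 ?powR_ge0// prodr_ge0// => m _.
by rewrite mulr_ge0// powR_ge0.
Qed.

Let fcd0 : 0 <= FC (disc_const beta q p).
Proof. exact/final_const_ge0/disc_const_ge0. Qed.

Lemma prod_luxnorm_ge0 (f : 'I_n -> E -> R[i]) :
  (0 <= \prod_(i < n) luxnorm (Phi i) (s i) (modulus (f i)))%E.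
Proof.
have := @prod_ereal_ge R 'I_n (fun=> 0) (fun i => luxnorm (Phi i) (s i) (modulus (f i))).
move=> H; apply: le_trans (H _ _) => //.
  by rewrite lee_fin prodr_ge0.
by move=> i; apply: le_ereal_inf_tmp => _ [l [l0 _] <-]; rewrite lee_fin ltW.
Qed.

Local Notation sf f := (fun i x => ((s i x)%:C%C * f i x)%R).

Lemma luxnorm_Malpha_B (f : 'I_n -> E -> R[i]) : (forall i, inL (Phi i) (s i) (f i)) ->
  (Bconst alpha Phi Psi s w < +oo)%E ->
  (luxnorm Psi w (Malpha alpha (sf f)) <=
   C_i%:E * er_map (ginv Psi) (Bconst alpha Phi Psi s w) *
   \prod_(i < n) luxnorm (Phi i) (s i) (modulus (f i)))%E.
Proof.
move=> fL /Bconst_cubes[B [B0 -> HB]] /=.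
have D0 : 0 <= doob_const 2 * 2 `^ 2 :> R.
  by rewrite mulr_ge0 ?powR_ge0// ltW// doob_const_gt0; lra.
have PD : 0 <= \prod_(m < n) (doob_const 2 * 2 `^ 2) `^ (q / p m) :> R.
  by apply: prodr_ge0 => m _; exact: powR_ge0.
have [Z ZE] : exists Z, Z = kA * B * \prod_(m < n) (doob_const 2 * 2 `^ 2) `^ (q / p m) by eexists.
have kA0 := ltW kA_gt0.
have Z0 : 0 <= Z by rewrite ZE mulr_ge0 ?mulr_ge0.
apply: (@insert_inverse_bound R q _ ki Z B cGPsi (ginv Psi)) => //.
- by rewrite mulr_ge0.
- exact: prod_luxnorm_ge0.
- by rewrite ZE /ki mulrAC.
apply: (luxnorm_of_cubes n_gt0 d_gt0 alpha_lt q_gt0 p_gt1 cPhi_gt0 CPsi_gt0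
  (disc_const_ge0 _ _ _) HPhi HPsiu Z0 mh h0 sh hf mv v0 wv fL).
move=> g mg g0 gf N t; rewrite ZE.
(* All weights have the same packing constant, that of [sqrt_packing]; it does not depend on the
   weights. *)
apply: (@cells_bound_split N t g (kA * B) (fun=> doob_const 2 * 2 `^ 2)
  (fun m k => (cint mu (@cell R d N t) (fun x => h m x `^ 2^-1) k /
     cvol mu (@cell R d N t) k) `^ 2)) => //.
- exact: mulr_ge0.
- by move=> m k; exact: powR_ge0.
- move=> k; apply: le_trans (HB _ _ (grid_side_gt0 N k.1)) _.
  rewrite le_eqVlt; apply/orP; left; apply/eqP; congr (_ * _).
  by apply: eq_bigr => m _; rewrite cvol_cell cint_cell.
- move=> m j; rewrite -cint_cell; apply: sqrt_packing.
  + exact: measurable_cell.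
  + exact: cell_laminar.
  + exact: mu_cell.
  + exact: mh.
  + by move=> x; exact: ltW.
  + by move=> k; apply: cint_cell_lty.
Qed.

Lemma Ainf_cubes m : (Ainf (s m) < +oo)%E -> exists A, [/\ 0 <= A,
  Ainf (s m) = A%:E & forall a l, 0 < l ->
  (\int[mu]_(x in ccube a l) HLmax (fun y => (s m y * \1_(ccube a l) y)%R) x <=
   (A * Sq (h m) a l)%:E)%E].
Proof.
move=> Af.
have T a l : 0 < l -> ((wmeas (s m) (ccube a l))^-1 = ((Sq (h m) a l)^-1)%:E)%E.
  by move=> l0; rewrite (wmeas_Sq (h0 m) (sh m) (hf m)) inver gt_eqF// S0.
have J0 a l : (0 <= \int[mu]_(x in ccube a l)
    HLmax (fun y => (s m y * \1_(ccube a l) y)%R) x)%E.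
  by apply: integral_ge0 => x _; exact: HLmax_ge0.
have [A A0 AE] : exists2 A, 0 <= A & Ainf (s m) = A%:E.
  apply: ereal_sup_fin Af; first by exists (ccube 0 1); [exact: cubes0|reflexivity].
  by rewrite T// mule_ge0// lee_fin invr_ge0 ltW// S0.
exists A; split => // a l l0.
have : ((Sq (h m) a l)^-1%:E * \int[mu]_(x in ccube a l)
    HLmax (fun y => (s m y * \1_(ccube a l) y)%R) x <= A%:E)%E.
  rewrite -AE -T//; apply: ereal_sup_ubound.
  by exists (ccube a l) => //; exact: cubes_ccube.
by rewrite lee_pdivrMl ?S0// -EFinM mulrC.
Qed.

Definition kii : R := kA * (cPsi * cG0 `^ q)^-1.
Definition C_ii : R := FC (disc_const beta q p) * kii `^ q^-1 * cGPsi^-1 + 1.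

Lemma Psi_ginv_Phi0_ge t : 0 <= t ->
  (cPsi * cG0 `^ q) * t `^ (q / p0) <= (Psi \o ginv Phi0) t.
Proof.
move=> t0 /=; have hG := HG0 t0.
have k0 : 0 <= cG0 * t `^ p0^-1 by rewrite mulr_ge0 ?powR_ge0// ltW.
apply: le_trans (HPsil (le_trans k0 hG)).
rewrite -mulrA ler_pM2l//.
apply: le_trans (ler_powRl (ltW q_gt0) k0 hG).
by rewrite powRM ?powR_ge0 ?(ltW cG0_gt0)// -powRrM [p0^-1 * q]mulrC.
Qed.

Lemma luxnorm_Malpha_A (f : 'I_n -> E -> R[i]) : (forall i, inL (Phi i) (s i) (f i)) ->
  (Aconst alpha Phi Psi s w < +oo)%E -> (forall i, Ainf (s i) < +oo)%E ->
  (luxnorm Psi w (Malpha alpha (sf f)) <=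
   C_ii%:E * er_map (ginv Psi) (Aconst alpha Phi Psi s w *
     \sum_(i < n) er_map (Psi \o ginv Phi0) (Ainf (s i))) *
   \prod_(i < n) luxnorm (Phi i) (s i) (modulus (f i)))%E.
Proof.
move=> fL /Aconst_cubes[B [B0 -> HB]] Af.
have [A HA] := boolp.choice (fun m => Ainf_cubes (Af m)).
have A0 m : 0 <= A m by case: (HA m).
have AE m : Ainf (s m) = (A m)%:E by case: (HA m).
have HA' m a l : 0 < l -> (\int[mu]_(x in ccube a l)
   HLmax (fun y => (s m y * \1_(ccube a l) y)%R) x <= (A m * Sq (h m) a l)%:E)%E.
  by case: (HA m) => _ _; exact.
under eq_bigr do rewrite AE /=.
rewrite sumEFin -EFinM /=.
set S := \sum_(i < n) Psi (ginv Phi0 (A i)).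
have kA0 := ltW kA_gt0.
have c0 : 0 < cPsi * cG0 `^ q by rewrite mulr_gt0// powR_gt0.
(* Since [q / p m = (q / p0) (p0 / p m)] and the [p0 / p m] have sum 1, the product is at most the
   sum of the [A m ^ (q / p0)], and the composition of [Psi] with the inverse of [Phi0] grows at
   least like that power. *)
have PA : \prod_m A m `^ (q / p m) <= (cPsi * cG0 `^ q)^-1 * S.
  rewrite ler_pdivlMl// /S.
  have th0 m : 0 < p0 / p m by rewrite divr_gt0.
  have := @prod_powR_le_sum R 'I_n (fun m => p0 / p m) (fun m => A m `^ (q / p0))
    th0 p0E (fun m => powR_ge0 _ _).
  have -> : \prod_i (A i `^ (q / p0)) `^ (p0 / p i) = \prod_m A m `^ (q / p m).
    apply: eq_bigr => m _; rewrite -powRrM; congr (_ `^ _).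
    by field; rewrite !gt_eqF.
  move=> H; apply: le_trans (ler_wpM2l (ltW c0) H) _.
  rewrite mulr_sumr; apply: ler_sum => m _.
  exact: Psi_ginv_Phi0_ge.
have PA0 : 0 <= \prod_m A m `^ (q / p m) by apply: prodr_ge0 => m _; exact: powR_ge0.
have [Z ZE] : exists Z, Z = kA * B * \prod_m A m `^ (q / p m) by eexists.
have Z0 : 0 <= Z by rewrite ZE mulr_ge0 ?mulr_ge0.
have S_ge0 : 0 <= S.
  have := le_trans PA0 PA; rewrite pmulr_rge0// invr_gt0//.
apply: (@insert_inverse_bound R q _ kii Z (B * S) cGPsi (ginv Psi)) => //.
- by rewrite mulr_ge0// invr_ge0 ltW.
- exact: mulr_ge0.
- exact: prod_luxnorm_ge0.
- rewrite ZE /kii -!mulrA ler_wpM2l// [leRHS]mulrCA ler_wpM2l//.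
apply: (luxnorm_of_cubes n_gt0 d_gt0 alpha_lt q_gt0 p_gt1 cPhi_gt0 CPsi_gt0
  (disc_const_ge0 _ _ _) HPhi HPsiu Z0 mh h0 sh hf mv v0 wv fL).
move=> g mg g0 gf N t; rewrite ZE.
(* The coefficient of a cell is its average of the weight. The maximum of these averages over the
   cells inside [j] is below the localized maximal function, whose integral is bounded by the
   A_infty constant times the mass. *)
apply: (@cells_bound_split N t g (kA * B) A (@cellavg N t)) => //.
- exact: mulr_ge0.
- by move=> m k; exact: cellavg_ge0.
- move=> k; apply: le_trans (HB _ _ (grid_side_gt0 N k.1)) _.
  rewrite le_eqVlt; apply/orP; left; apply/eqP; congr (_ * _).
  apply: eq_bigr => m _; rewrite /cellavg cvol_cell cint_cell [_ ^+ d * _]mulrC divfK//.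
  by rewrite gt_eqF// exprn_gt0// grid_side_gt0.
- move=> m j; apply: le_trans (HA' m _ _ (grid_side_gt0 N j.1)).
  rewrite -integral_hcube ?(ltW (grid_side_gt0 _ _))// -/(cell t j).
  apply: ge0_le_integral_nm => x xj.
    by rewrite lee_fin; apply/bigmax_geP; left.
  apply: cubemax_le_ereal; first exact: HLmax_ge0.
  by move=> k kj kx; exact: cellavg_le_HLmax kj kx.
Qed.

Definition cnu : R := (cPhi0 * (\prod_m cG m) `^ p0)^-1.

Let cGp_gt0 r : 0 < (\prod_m cG m) `^ r.
Proof. by rewrite powR_gt0// prodr_gt0. Qed.

Lemma cnu_gt0 : 0 < cnu.
Proof. by rewrite invr_gt0 mulr_gt0. Qed.

Let rho_gt0 x : 0 < rho x.
Proof. by rewrite prodr_gt0// => m _; rewrite powR_gt0. Qed.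

Let mrho : measurable_fun setT rho.
Proof.
apply: measurable_prod => m _.
exact: (measurableT_comp (measurable_powR _) (mh m)).
Qed.

Let rhof a l : (\int[mu]_(x in ccube a l) (rho x)%:E < +oo)%E.
Proof.
have th0 m : 0 < p0 / p m by rewrite divr_gt0.
apply: le_lt_trans (integral_prod_powR (measurable_ccube a l) th0 p0E mh h0
  (fun m => hf m a l)) _.
by rewrite ltry.
Qed.

Lemma prod_cG_powR (y : 'I_n -> R) r : (forall m, 0 <= y m) ->
  (\prod_m (cG m * y m `^ (p m)^-1)) `^ r =
  (\prod_m cG m) `^ r * \prod_m y m `^ (r / p m).
Proof.
move=> y0; rewrite big_split/= powRM; last first.
- by apply: prodr_ge0 => m _; exact: powR_ge0.
- by apply: prodr_ge0 => m _; exact: ltW.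
congr (_ * _); rewrite powR_prod => [|m _]; last exact: powR_ge0.
by apply: eq_bigr => m _; rewrite -powRrM mulrC.
Qed.

(** Only an upper bound is sought: the inverse of the mass of [nu] enters the W constant, which is
    to be bounded from below. *)
Lemma nu_bounds : {ae mu, forall x, 0 <= nu Phi Phi0 s x <= cnu * rho x}.
Proof.
have : {ae mu, forall x m, s m x = h m x} by exact: filter_forall.
apply: filterS => x sx; rewrite /nu.
under eq_bigr do rewrite sx.
have V0 m : 0 < (h m x)^-1 by rewrite invr_gt0.
set X := \prod_m ginv _ _.
have y0 : 0 < \prod_m (cG m * (h m x)^-1 `^ (p m)^-1).
  by rewrite prodr_gt0// => m _; rewrite mulr_gt0// powR_gt0.
have yX : \prod_m (cG m * (h m x)^-1 `^ (p m)^-1) <= X.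
  apply: ler_prod => m _; rewrite (HG m (ltW (V0 m))) andbT.
  by rewrite mulr_ge0 ?powR_ge0// ltW.
have L : (cnu * rho x)^-1 <= Phi0 X.
  have X0 := le_trans (ltW y0) yX.
  apply: le_trans (HPhi0 X0); rewrite /cnu invfM invrK -mulrA ler_pM2l//.
  have -> : (\prod_m cG m) `^ p0 * (rho x)^-1 =
      (\prod_m (cG m * (h m x)^-1 `^ (p m)^-1)) `^ p0.
    rewrite prod_cG_powR => [|m]; last exact: ltW.
    congr (_ * _); rewrite /rho -prodfV; apply: eq_bigr => m _.
    by rewrite powR_invl// ltW.
  by apply: ler_powRl => //; exact: ltW.
have c0 : 0 < cnu * rho x by rewrite mulr_gt0// cnu_gt0.
have P0 : 0 < Phi0 X by apply: lt_le_trans L; rewrite invr_gt0.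
by rewrite invr_ge0 (ltW P0)/= -[leRHS]invrK lef_pV2// posrE ?invr_gt0.
Qed.

Lemma wmeas_nu a l : 0 < l ->
  (0 <= wmeas (nu Phi Phi0 s) (ccube a l) <= (cnu * Sq rho a l)%:E)%E.
Proof.
move=> l0; apply/andP; split.
  rewrite -(integral0 mu (ccube a l)); apply: ae_le_integral_nm.
  by move: nu_bounds; apply: filterS => x /andP[].
rewrite EFinM /Sq -integral_ge0_lty_fine//; last by move=> x; exact: ltW.
rewrite -(integral_scale _ (measurable_ccube a l))//; last 2 first.
- exact/ltW/cnu_gt0.
- by move=> x; exact: ltW.
by apply: ae_le_integral_nm; move: nu_bounds; apply: filterS => x /andP[].
Qed.

Definition kW : R := (cPsi * cG0 `^ q)^-1 * cnu `^ (q / p0).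

Lemma kW_ge0 : 0 <= kW.
Proof. by rewrite mulr_ge0 ?powR_ge0// invr_ge0 mulr_ge0 ?powR_ge0// ltW. Qed.

Let Psi_HLmax a l x : \bar R := er_map Psi (\prod_(i < n)
  er_map (ginv (Phi i)) (HLmax (fun y => (s i y * \1_(ccube a l) y)%R) x)).

Lemma Psi_HLmax_ge a l x (y : 'I_n -> R) : (forall m, 0 <= y m) ->
  (forall m, ((y m)%:E <= HLmax (fun y => (s m y * \1_(ccube a l) y)%R) x)%E) ->
  ((cPsi * (\prod_m cG m) `^ q * \prod_m y m `^ (q / p m))%:E <= Psi_HLmax a l x)%E.
Proof.
move=> y0 yx; rewrite -mulrA -prod_cG_powR//.
have z0 m : 0 <= cG m * y m `^ (p m)^-1 by rewrite mulr_ge0 ?powR_ge0// ltW.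
apply: er_map_ge => //; [exact: ltW|exact: ltW|exact: prodr_ge0|].
apply: prod_ereal_ge => // m.
by apply: er_map_ge => //; [exact: ltW|exact: HG].
Qed.

(** The factor in front of the integral in the W constant is at least a multiple of
    [Sq rho a l ^ (- q / p0)]. Solving for the integral gives packing by the power [q / p0] of the
    measure [rho], the form required by the joint bound. *)
Lemma Wconst_cubes : (Wconst Phi Phi0 Psi s < +oo)%E ->
  exists W, [/\ 0 <= W, Wconst Phi Phi0 Psi s = W%:E & forall a l, 0 < l ->
  (\int[mu]_(x in ccube a l) Psi_HLmax a l x <=
   (kW * W * Sq rho a l `^ (q / p0))%:E)%E].
Proof.
move=> Wf; have q0 := q_gt0.
have rho0 a l : 0 < l -> 0 < Sq rho a l.
  by move=> l0; exact: (Sq_gt0 mrho rho_gt0 rhof).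
have c0 : 0 < cPsi * cG0 `^ q by rewrite mulr_gt0// powR_gt0.
have J0 a l : (0 <= \int[mu]_(x in ccube a l) Psi_HLmax a l x)%E.
  apply: integral_ge0 => x _.
  apply: le_trans (@Psi_HLmax_ge a l x (fun=> 0) _ _) => //; last first.
    by move=> m; exact: HLmax_ge0.
  rewrite lee_fin; apply: mulr_ge0; first by rewrite mulr_ge0// ltW.
  by apply: prodr_ge0 => m _; exact: powR_ge0.
pose D a l : R := cPsi * cG0 `^ q * (cnu * Sq rho a l)^-1 `^ (q / p0).
have D0 a l : 0 < l -> 0 < D a l.
  by move=> l0; rewrite mulr_gt0// powR_gt0// invr_gt0 mulr_gt0 ?cnu_gt0// rho0.
have T a l : 0 < l -> ((D a l)%:E * \int[mu]_(x in ccube a l) Psi_HLmax a l x <=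
   er_map (Psi \o ginv Phi0) (wmeas (nu Phi Phi0 s) (ccube a l))^-1 *
   \int[mu]_(x in ccube a l) Psi_HLmax a l x)%E.
  move=> l0; apply: lee_wpmul2r => //.
  have R0 : 0 < cnu * Sq rho a l by rewrite mulr_gt0 ?cnu_gt0// rho0.
  have /andP[w0 w1] := wmeas_nu a l0.
  apply: er_map_ge.
  - exact: ltW.
  - by rewrite divr_ge0// ltW.
  - by move=> r r0; exact: Psi_ginv_Phi0_ge.
  - by rewrite invr_ge0 ltW.
  - exact: inve_ge.
have [W W0 WE] : exists2 W, 0 <= W & Wconst Phi Phi0 Psi s = W%:E.
  apply: ereal_sup_fin Wf; first by exists (ccube 0 1); [exact: cubes0|reflexivity].
  apply: le_trans (T 0 1 ltr01).
  by rewrite mule_ge0// lee_fin ltW// D0.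
exists W; split => // a l l0.
have : ((D a l)%:E * \int[mu]_(x in ccube a l) Psi_HLmax a l x <= W%:E)%E.
  rewrite -WE; apply: le_trans (T a l l0) _; apply: ereal_sup_ubound.
  by exists (ccube a l) => //; exact: cubes_ccube.
rewrite -lee_pdivlMl ?D0// => /le_trans; apply.
rewrite -EFinM lee_fin le_eqVlt; apply/orP; left; apply/eqP.
rewrite /D /kW invfM powR_invl ?invrK; last first.
  by rewrite mulr_ge0 ?(ltW cnu_gt0)// ltW// rho0.
rewrite powRM ?(ltW cnu_gt0)// ?(ltW (rho0 _ _ l0))//.
ring.
Qed.

Definition kiii : R := kT * (kW / (cPsi * (\prod_m cG m) `^ q)) * n%:R `^ (q / p0).
Definition C_iii : R :=
  FC (disc_const_joint beta q p p0) * kiii `^ q^-1 * cGPsi^-1 + 1.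

Lemma luxnorm_Malpha_At_W (f : 'I_n -> E -> R[i]) : (forall i, inL (Phi i) (s i) (f i)) ->
  (At_const alpha (fun i => complementary (Phi i)) Psi s w < +oo)%E ->
  (Wconst Phi Phi0 Psi s < +oo)%E ->
  (luxnorm Psi w (Malpha alpha (sf f)) <=
   C_iii%:E * er_map (ginv Psi) (Wconst Phi Phi0 Psi s *
     At_const alpha (fun i => complementary (Phi i)) Psi s w) *
   \prod_(i < n) luxnorm (Phi i) (s i) (modulus (f i)))%E.
Proof.
move=> fL /At_const_cubes[B [B0 -> HB]] /Wconst_cubes[W [W0 -> HW]].
rewrite -EFinM /=.
have c0 : 0 < cPsi * (\prod_m cG m) `^ q by rewrite mulr_gt0.
have kT0 := ltW kT_gt0; have kW0 := kW_ge0.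
have K0 : 0 <= kT * B by exact: mulr_ge0.
have kWc0 : 0 <= kW / (cPsi * (\prod_m cG m) `^ q) by rewrite divr_ge0// ltW.
have A0 : 0 <= kW / (cPsi * (\prod_m cG m) `^ q) * W by exact: mulr_ge0.
have [Z ZE] : exists Z, Z = kT * B * (kW / (cPsi * (\prod_m cG m) `^ q) * W) *
  n%:R `^ (q / p0) by eexists.
have Z0 : 0 <= Z by rewrite ZE mulr_ge0 ?powR_ge0// mulr_ge0.
have dj0 : 0 <= disc_const_joint beta q p p0.
  by apply: disc_const_joint_ge0; exact: ltW.
apply: (@insert_inverse_bound R q _ kiii Z (W * B) cGPsi (ginv Psi)) => //.
- exact: final_const_ge0.
- by rewrite mulr_ge0 ?powR_ge0// mulr_ge0.
- exact: mulr_ge0.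
- exact: prod_luxnorm_ge0.
- by rewrite ZE /kiii le_eqVlt; apply/orP; left; apply/eqP; ring.
apply: (luxnorm_of_cubes n_gt0 d_gt0 alpha_lt q_gt0 p_gt1 cPhi_gt0 CPsi_gt0
  dj0 HPhi HPsiu Z0 mh h0 sh hf mv v0 wv fL).
move=> g mg g0 gf N t; rewrite ZE.
have avg0 k : 0 <= \prod_m @cellavg N t m k `^ (q / p m).
  by apply: prodr_ge0 => m _; exact: powR_ge0.
(* One coefficient for all weights: the product of the powers [q / p m] of the averages. It is what
   [At_const_cubes] leaves beside the volume, and by [Psi_HLmax_ge] a multiple of it lies below the
   integrand of the W constant. *)
apply: (@cells_bound_joint N t g (kT * B) (kW / (cPsi * (\prod_m cG m) `^ q) * W)
  (fun k => \prod_m @cellavg N t m k `^ (q / p m))) => //.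
- move=> k; apply: le_trans (HB _ _ (grid_side_gt0 N k.1)) _.
  rewrite le_eqVlt; apply/orP; left; apply/eqP; congr (_ * (_ * _)).
  by apply: eq_bigr => m _; rewrite /cellavg cvol_cell cint_cell.
- move=> j.
have -> : kW / (cPsi * (\prod_m cG m) `^ q) * W *
    Sq rho (corner t j) (grid_side N j.1) `^ (q / p0) =
    (cPsi * (\prod_m cG m) `^ q)^-1 *
    (kW * W * Sq rho (corner t j) (grid_side N j.1) `^ (q / p0)) by ring.
  rewrite EFinM lee_pdivlMl//; apply: le_trans (HW _ _ (grid_side_gt0 N j.1)).
  rewrite -integral_hcube ?(ltW (grid_side_gt0 _ _))// -/(cell t j).
  have M0 x : 0 <= cubemax (@cell R d N t) (subC (@cell R d N t) j)
      (fun k => \prod_m @cellavg N t m k `^ (q / p m)) x.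
    by apply/bigmax_geP; left.
  have mM : measurable_fun setT (cubemax (@cell R d N t) (subC (@cell R d N t) j)
      (fun k => \prod_m @cellavg N t m k `^ (q / p m))).
    rewrite (_ : cubemax _ _ _ = fun x => maxQ_in (cubeQ (@cell R d N t))
      (fun k => \prod_m @cellavg N t m k `^ (q / p m)) j (code (@cell R d N t) x)).
      exact: (measurable_code (@measurable_cell R d N t)).
    by apply/funext => x; exact: cubemax_in_code.
  have := integral_scale mu (@measurable_cell R d N t j) (ltW c0) mM M0.
  move=> <-.
  apply: ge0_le_integral_nm => x xj; first by rewrite lee_fin mulr_ge0// ltW.
  rewrite EFinM -lee_pdivlMl//; apply: cubemax_le_ereal.
    rewrite mule_ge0 ?lee_fin ?invr_ge0 ?(ltW c0)//.
    apply: le_trans (@Psi_HLmax_ge _ _ x (fun=> 0) _ _) => //; last first.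
      by move=> m; exact: HLmax_ge0.
    rewrite lee_fin; apply: mulr_ge0; first exact: ltW.
    by apply: prodr_ge0 => m _; exact: powR_ge0.
  move=> k kj kx; rewrite lee_pdivlMl// -EFinM.
  apply: Psi_HLmax_ge => m; first exact: cellavg_ge0.
  exact: cellavg_le_HLmax kj kx.
Qed.

End weights.
End three_bounds.

(** * Exponents, constants and the three inequalities *)

Lemma weights_borel {R : realType} (d n : nat) (s : 'I_n -> 'rV[R]_d -> R) :
  (forall i, weight (s i)) -> exists h : 'I_n -> 'rV[R]_d -> R,
  [/\ forall i, measurable_fun setT (h i), forall i x, 0 < h i x,
    forall i, {ae leb R d, forall x, s i x = h i x} &
    forall i a l, (\int[leb R d]_(x in ccube a l) (h i x)%:E < +oo)%E].
Proof.
move=> ws; have [h Hh] := boolp.choice (fun i => weight_borel (ws i)).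
by exists h; split=> i; case: (Hh i).
Qed.

Theorem theorem3p11 (R : realType) (d n : nat) (alpha : R)
  (Phi : 'I_n -> R -> R) (Phi0 Psi : R -> R)
  (halpha : 0 <= alpha < n%:R * d%:R)
  (hPhi : forall i, [/\ classUt (Phi i), normalized (Phi i) & nabla2 (Phi i)])
  (hPsi : classUt Psi /\ normalized Psi)
  (hPhi0 : set_bij (@Rplus R) (@Rplus R) Phi0)
  (hPhi0inv : forall t : R, 0 <= t -> ginv Phi0 t = \prod_(i < n) ginv (Phi i) t)
  (hratio : forall t u : R, 0 < t -> t <= u -> Psi t / Phi0 t <= Psi u / Phi0 u) :
  [/\ exists2 C1 : R, 0 < C1 &
        forall (s : 'I_n -> 'rV[R]_d -> R) (w : 'rV[R]_d -> R),
          (forall i, weight (s i)) -> weight w ->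
          (Bconst alpha Phi Psi s w < +oo)%E ->
          forall f : 'I_n -> 'rV[R]_d -> R[i],
            (forall i, inL (Phi i) (s i) (f i)) ->
            (luxnorm Psi w (Malpha alpha (fun i x => ((s i x)%:C%C * f i x)%R))
             <= C1%:E * er_map (ginv Psi) (Bconst alpha Phi Psi s w) *
                \prod_(i < n) luxnorm (Phi i) (s i) (modulus (f i)))%E,
      exists2 C2 : R, 0 < C2 &
        forall (s : 'I_n -> 'rV[R]_d -> R) (w : 'rV[R]_d -> R),
          (forall i, weight (s i)) -> weight w ->
          (Aconst alpha Phi Psi s w < +oo)%E ->
          (forall i, (Ainf (s i) < +oo)%E) ->
          forall f : 'I_n -> 'rV[R]_d -> R[i],
            (forall i, inL (Phi i) (s i) (f i)) ->
            (luxnorm Psi w (Malpha alpha (fun i x => ((s i x)%:C%C * f i x)%R))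
             <= C2%:E * er_map (ginv Psi)
                  (Aconst alpha Phi Psi s w *
                   \sum_(i < n) er_map (Psi \o ginv Phi0) (Ainf (s i))) *
                \prod_(i < n) luxnorm (Phi i) (s i) (modulus (f i)))%E &
      exists2 C3 : R, 0 < C3 &
        forall (s : 'I_n -> 'rV[R]_d -> R) (w : 'rV[R]_d -> R),
          (forall i, weight (s i)) -> weight w ->
          (At_const alpha (fun i => complementary (Phi i)) Psi s w < +oo)%E ->
          (Wconst Phi Phi0 Psi s < +oo)%E ->
          forall f : 'I_n -> 'rV[R]_d -> R[i],
            (forall i, inL (Phi i) (s i) (f i)) ->
            (luxnorm Psi w (Malpha alpha (fun i x => ((s i x)%:C%C * f i x)%R))
             <= C3%:E * er_map (ginv Psi)
                  (Wconst Phi Phi0 Psi s *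
                   At_const alpha (fun i => complementary (Phi i)) Psi s w) *
                \prod_(i < n) luxnorm (Phi i) (s i) (modulus (f i)))%E].
Proof.
case/andP: halpha => alpha0 alpha1.
(* The range of [alpha] would be empty if [n] or [d] were 0. *)
have n_gt0 : (0 < n)%N.
  by rewrite lt0n; apply/eqP => n0; move: alpha1; rewrite n0 mul0r ltNge alpha0.
have d_gt0 : (0 < d)%N.
  by rewrite lt0n; apply/eqP => d0; move: alpha1; rewrite d0 mulr0 ltNge alpha0.
have surj q (f : R -> R) : classUt_ q f -> set_surj (@Rplus R) (@Rplus R) f.
  by case=> -[_ [_ _ _ _ fS] _ _] _ _.
have hUt i : exists p, classUt_ p (Phi i) by have [] := hPhi i.
have [p Hp] := boolp.choice hUt.
have p_gt1 i : 1 < p i.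
  have [[p1 _ _ _] _ _] := Hp i; have [_ _ N2] := hPhi i.
  exact: nabla2_exponent p1 (classUt_power_like (Hp i)) N2.
have p_gt0 i : 0 < p i by exact: lt_trans (p_gt1 i).
have [[q Hq] _] := hPsi.
have q_gt0 : 0 < q by have [[q1 _ _ _] _ _] := Hq; exact: lt_le_trans q1.
have PsiL := classUt_power_like Hq.
have GL i := ginv_power_like (p_gt0 i) (surj _ _ (Hp i)) (classUt_power_like (Hp i)).
have S0 : 0 < \sum_i (p i)^-1.
  rewrite (bigD1 (Ordinal n_gt0))//= ltr_wpDr ?invr_gt0//.
  by apply: sumr_ge0 => i _; rewrite invr_ge0 ltW.
have [p0 p0D] : exists p0, p0 = (\sum_i (p i)^-1)^-1 by eexists.
have p0_gt0 : 0 < p0 by rewrite p0D invr_gt0.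
have p0E : \sum_m p0 / p m = 1 by rewrite -mulr_sumr p0D mulVf// gt_eqF.
have G0L : power_like (ginv Phi0) p0^-1.
  have pV i : 0 < (p i)^-1 by rewrite invr_gt0.
  have [c [C [c0 C0 H]]] := power_like_prod GL S0 pV.
  exists c, C; split => // t t0; rewrite hPhi0inv// p0D invrK.
  exact: H.
have Phi0L := ginv_bij_power_like p0_gt0 hPhi0 G0L.
have p0q : p0 <= q := ratio_exponents Phi0L PsiL hratio.
have FL i : power_like (ginv (complementary (Phi i))) (1 - (p i)^-1).
  have [c [C [c0 C0 H]]] := classUt_power_like (Hp i).
  have -> : 1 - (p i)^-1 = (p i / (p i - 1))^-1.
    by rewrite invf_div mulrBl mul1r divff// gt_eqF.
  apply: ginv_power_like.
  - by rewrite divr_gt0// subr_gt0.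
  - exact: complementary_surj (p_gt1 i) c0 C0 H.
  - exact: complementary_power_like (p_gt1 i) c0 C0 H.
have lower (f : 'I_n -> R -> R) (r : 'I_n -> R) : (forall i, power_like (f i) (r i)) ->
    exists c : 'I_n -> R, (forall i, 0 < c i) /\
      forall i t, 0 <= t -> c i * t `^ r i <= f i t.
  move=> H.
  have Hi i : exists c : R, 0 < c /\ forall t, 0 <= t -> c * t `^ r i <= f i t.
    by have [c [C [c0 _ Hc]]] := H i; exists c; split => // t /Hc/andP[].
  have [c Hc] := boolp.choice Hi.
  by exists c; split => i; case: (Hc i).
have [cPhi [cPhi0' HPhi]] := lower _ _ (fun i => classUt_power_like (Hp i)).
have [cG [cG0' HG]] := lower _ _ GL.
have [cF [cF0 HF]] := lower _ _ FL.
have [cPsi [CPsi [cPsi0 CPsi0 HPsi]]] := PsiL.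
have [cPhi0 [CPhi0 [cPhi00 _ HPhi0]]] := Phi0L.
have [cG0 [CG0 [cG00 _ HG0]]] := G0L.
have [cGPsi [CGPsi [cGPsi0 _ HGPsi]]] := ginv_power_like q_gt0 (surj _ _ Hq) PsiL.
have HPhi0l t : 0 <= t -> cPhi0 * t `^ p0 <= Phi0 t by move=> /HPhi0/andP[].
have HG0l t : 0 <= t -> cG0 * t `^ p0^-1 <= ginv Phi0 t by move=> /HG0/andP[].
have HGPsil t : 0 <= t -> cGPsi * t `^ q^-1 <= ginv Psi t by move=> /HGPsi/andP[].
have cpos FC k : 0 <= FC -> 0 < FC * k `^ q^-1 * cGPsi^-1 + 1.
  by move=> FC0; rewrite ltr_wpDl// !mulr_ge0 ?powR_ge0// invr_ge0 ltW.
split.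
- exists (C_i (d := d) alpha q p cPhi cG cPsi CPsi cGPsi).
    exact/cpos/final_const_ge0/disc_const_ge0.
  move=> s w ws ww Bf f fL.
  have [h [mh h0 sh hf]] := weights_borel ws.
  have [v [mv v0 wv vf]] := weight_borel ww.
  exact: (luxnorm_Malpha_B n_gt0 d_gt0 alpha0 alpha1 p_gt1 p0_gt0 p0E p0q cPhi0' HPhi cG0' HG
    cPsi0 CPsi0 HPsi cGPsi0 HGPsil mh h0 sh hf mv v0 wv vf fL Bf).
- exists (C_ii (d := d) alpha q p cPhi cG cPsi CPsi cG0 cGPsi).
    exact/cpos/final_const_ge0/disc_const_ge0.
  move=> s w ws ww Af Wf f fL.
  have [h [mh h0 sh hf]] := weights_borel ws.
  have [v [mv v0 wv vf]] := weight_borel ww.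
  exact: (luxnorm_Malpha_A n_gt0 d_gt0 alpha0 alpha1 p_gt1 p0_gt0 p0E p0q cPhi0' HPhi cG0' HG
    cPsi0 CPsi0 HPsi cGPsi0 HGPsil cG00 HG0l mh h0 sh hf mv v0 wv vf fL Af Wf).
- exists (C_iii (d := d) alpha q p0 p cPhi cG cF cPsi CPsi cPhi0 cG0 cGPsi).
    by apply/cpos/final_const_ge0/disc_const_joint_ge0; exact: ltW.
  move=> s w ws ww Af Wf f fL.
  have [h [mh h0 sh hf]] := weights_borel ws.
  have [v [mv v0 wv vf]] := weight_borel ww.
  exact: (luxnorm_Malpha_At_W n_gt0 d_gt0 alpha0 alpha1 p_gt1 p0_gt0 p0E p0q cPhi0' HPhi cG0' HG
    cPsi0 CPsi0 HPsi cGPsi0 HGPsil cPhi00 HPhi0l cG00 HG0l cF0 HF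
    mh h0 sh hf mv v0 wv vf fL Af Wf).
Qed.
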